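(* Let $N$ be a connected complete Riemannian manifold and let $f:N\to\mathbb{R}$ be an isoparametric function. Suppose that each isoparametric hypersurface $M_t=f^{-1}(t)$ ($t$ a regular value of $f$) has constant principal curvatures with respect to the unit normal vector field in the direction of $\nabla f$, in the sense that the principal curvatures of $M_t$ depend only on $f|_{M_t}=t$ (so if $M_t$ is disconnected, all its connected components have common constant principal curvatures). Then the principal curvatures of each (non-empty) focal variety $M_{+}$, $M_{-}$ in any unit normal direction occur in pairs of opposite signs (i.e., they are of the form $\kappa_1,-\kappa_1,\dots,\kappa_q,-\kappa_q,0,\dots,0$). Thus $M_{\pm}$ are austere submanifolds of $N$ (in particular minimal).
   Context: Let $N$ be a smooth connected Riemannian manifold. A non-constant smooth function $f:N\to\mathbb{R}$ is called transnormal if there is a smooth function $b:J\to\mathbb{R}$, where $J=f(N)\subset\mathbb{R}$, such that $|\nabla f|^2=b(f)$. It is called isoparametric if moreover there is a continuous function $a:J\to\mathbb{R}$ such that $\triangle f=a(f)$, where $\triangle$ is the Laplacian. The regular level hypersurfaces $M_t:=f^{-1}(t)$ of an isoparametric function are called isoparametric hypersurfaces. If $f$ attains its maximum (resp. minimum), the preimage of the maximum (resp. minimum) value is called the focal variety $M_{+}$ (resp. $M_{-}$) of $f$; otherwise the corresponding focal variety is empty. Known structural facts (Q.M. Wang) underlying the definitions: for a transnormal function $f$ on a complete $N$, there are no critical values of $f$ in the interior of $J$, the focal varieties $M_{\pm}$ are smooth submanifolds of $N$, and each regular level hypersurface of $f$ is a tubular hypersurface (at constant distance) over either of $M_{\pm}$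 that is non-empty. For a submanifold $P\subset N$, a point $p\in P$ and a unit normal vector $v$ of $P$ at $p$, the shape operator $T_v$ is defined by $\langle T_v(X),Y\rangle=\langle\nabla_XY,v\rangle$ for vector fields $X,Y$ tangent to $P$; its eigenvalues are the principal curvatures in direction $v$. A submanifold is austere if for every unit normal vector $v$ the principal curvatures in direction $v$, counted with multiplicity, occur in pairs of opposite signs (the multiset of eigenvalues of $T_v$ is invariant under multiplication by $-1$). *)

(* Defs.v *)
From HB Require Import structures.
From mathcomp Require Import all_boot all_order all_algebra.
From mathcomp Require Import all_classical all_reals all_analysis.

Set Implicit Arguments.
Unset Strict Implicit.
Unset Printing Implicit Defensive.

Import Order.TTheory GRing.Theory Num.Theory.
Import numFieldNormedType.Exports.

Local Open Scope classical_set_scope.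
Local Open Scope ring_scope.

(* C^oo on an open set U: every iterated directional derivative of F (of any
   order, order 0 included) is differentiable at every point of U. *)
Definition smooth_on (R : realType) (E V : normedModType R)
    (U : set E) (F : E -> V) : Prop :=
  forall (s : seq E) (x : E), U x ->
    differentiable (foldr (fun v G => 'D_v G) F s) x.

(* The values of chart_map outside chart_dom, and of chart_inv outside
   chart_map @` chart_dom, carry no meaning. *)
Record chart (R : realType) (T : topologicalType) (n : nat) := Chart {
  chart_dom : set T;
  chart_map :> T -> 'rV[R]_n;
  chart_inv : 'rV[R]_n -> T;
  chart_dom_open : open chart_dom;
  chart_img_open : open (chart_map @` chart_dom);
  chart_mapK : forall p, chart_dom p -> chart_inv (chart_map p) = p;
  chart_map_continuous :
    forall p, chart_dom p -> {for p, continuous chart_map};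
  chart_inv_continuous :
    forall x, (chart_map @` chart_dom) x -> {for x, continuous chart_inv}
}.

Definition chart_img (R : realType) (T : topologicalType) (n : nat)
  (c : chart R T n) : set 'rV[R]_n := c @` chart_dom c.

Definition transition (R : realType) (T : topologicalType) (n : nat)
  (c d : chart R T n) : 'rV[R]_n -> 'rV[R]_n := fun x => d (chart_inv c x).

Definition compatible (R : realType) (T : topologicalType) (n : nat)
    (c d : chart R T n) : Prop :=
  smooth_on (c @` (chart_dom c `&` chart_dom d)) (transition c d) /\
  smooth_on (d @` (chart_dom c `&` chart_dom d)) (transition d c).

(* The smooth structure is a maximal atlas. *)
Record manifold (R : realType) (n : nat) := Manifold {
  carrier :> topologicalType;
  atlas : set (chart R carrier n);
  manifold_hausdorff : hausdorff_space carrier;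
  manifold_second_countable : @second_countable carrier;
  atlas_cover : forall p : carrier, exists2 c, atlas c & chart_dom c p;
  atlas_compatible : forall c d, atlas c -> atlas d -> compatible c d;
  atlas_maximal :
    forall c, (forall d, atlas d -> compatible c d) -> atlas c
}.

(* metric c x is the Gram matrix (g_ij) at the point of coordinates x of the
   coordinate frame of the chart c; metric_transition says that these matrices
   are the local expressions of one tensor. *)
Record riemannian (R : realType) (n : nat) := Riemannian {
  base_manifold :> manifold R n;
  metric : chart R base_manifold n -> 'rV[R]_n -> 'M[R]_n;
  metric_smooth :
    forall c, atlas c -> smooth_on (chart_img c) (metric c);
  metric_sym :
    forall c x, atlas c -> chart_img c x -> (metric c x)^T = metric c x;
  metric_pos :
    forall c x (u : 'rV[R]_n), atlas c -> chart_img c x -> u != 0 ->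
      0 < (u *m metric c x *m u^T) 0 0;
  metric_transition :
    forall c d p (u v : 'rV[R]_n), atlas c -> atlas d ->
      chart_dom c p -> chart_dom d p ->
      (u *m metric c (c p) *m v^T) 0 0 =
      ('D_u (transition c d) (c p) *m metric d (d p)
         *m ('D_v (transition c d) (c p))^T) 0 0
}.

(* From here on, tangent vectors and vector fields are given by their
   components in a chart c of the atlas, and points of the domain of c by their
   coordinates x; every notion below is independent of the choice of c. *)

Definition frame (R : realType) (n : nat) (i : 'I_n) : 'rV[R]_n :=
  delta_mx 0 i.
Arguments frame {R n} i.

Definition inner (R : realType) (n : nat) (N : riemannian R n)
    (c : chart R N n) (x u v : 'rV[R]_n) : R :=
  (u *m metric c x *m v^T) 0 0.

(* Gamma^k_ij *)
Definition christoffel (R : realType) (n : nat) (N : riemannian R n)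
    (c : chart R N n) (x : 'rV[R]_n) (k i j : 'I_n) : R :=
  2^-1 * \sum_l invmx (metric c x) k l *
    ('D_(frame i) (metric c) x j l + 'D_(frame j) (metric c) x i l
     - 'D_(frame l) (metric c) x i j).

Definition christoffel_form (R : realType) (n : nat) (N : riemannian R n)
    (c : chart R N n) (x u v : 'rV[R]_n) : 'rV[R]_n :=
  \row_k \sum_i \sum_j christoffel c x k i j * u 0 i * v 0 j.

(* Levi-Civita derivative nabla_X Y *)
Definition covd (R : realType) (n : nat) (N : riemannian R n)
    (c : chart R N n) (X Y : 'rV[R]_n -> 'rV[R]_n) (x : 'rV[R]_n) :
    'rV[R]_n :=
  'D_(X x) Y x + christoffel_form c x (X x) (Y x).

Definition geodesic (R : realType) (n : nat) (N : riemannian R n)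
    (gamma : R -> N) : Prop :=
  continuous gamma /\
  forall c : chart R N n, atlas c ->
    let sigma : R -> 'rV[R]_n := c \o gamma in
    let D := [set t | chart_dom c (gamma t)] in
    smooth_on D sigma /\
    forall t, D t ->
      'D_1 ('D_1 sigma) t
      + christoffel_form c (sigma t) ('D_1 sigma t) ('D_1 sigma t) = 0.

Definition complete (R : realType) (n : nat) (N : riemannian R n) : Prop :=
  forall (p : N) (c : chart R N n) (u : 'rV[R]_n), atlas c -> chart_dom c p ->
    exists gamma : R -> N,
      [/\ geodesic gamma, gamma 0 = p &
          'D_1 (c \o gamma : R -> 'rV[R]_n) 0 = u].

Definition local_expr (R : realType) (n : nat) (N : riemannian R n)
    (f : N -> R) (c : chart R N n) : 'rV[R]_n -> R :=
  fun x => f (chart_inv c x).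

Definition smooth_fun (R : realType) (n : nat) (N : riemannian R n)
    (f : N -> R) : Prop :=
  forall c : chart R N n, atlas c -> smooth_on (chart_img c) (local_expr f c).

Definition grad (R : realType) (n : nat) (N : riemannian R n)
    (f : N -> R) (c : chart R N n) (x : 'rV[R]_n) : 'rV[R]_n :=
  (\row_i 'D_(frame i) (local_expr f c) x) *m invmx (metric c x).

Definition grad_norm2 (R : realType) (n : nat) (N : riemannian R n)
    (f : N -> R) (c : chart R N n) (x : 'rV[R]_n) : R :=
  inner c x (grad f c x) (grad f c x).

Definition unit_grad (R : realType) (n : nat) (N : riemannian R n)
    (f : N -> R) (c : chart R N n) (x : 'rV[R]_n) : 'rV[R]_n :=
  (Num.sqrt (grad_norm2 f c x))^-1 *: grad f c x.

(* trace of the endomorphism u |-> nabla_u (grad f) *)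
Definition laplacian (R : realType) (n : nat) (N : riemannian R n)
    (f : N -> R) (c : chart R N n) (x : 'rV[R]_n) : R :=
  \sum_i (covd c (fun=> frame i) (grad f c) x) 0 i.

(* J = range f may contain end points: smoothness of b on J means that b
   is the restriction of a function smooth on an open set U containing J. *)
Definition transnormal (R : realType) (n : nat) (N : riemannian R n)
    (f : N -> R) : Prop :=
  [/\ smooth_fun f,
      exists p q, f p <> f q &
      exists (b : R -> R) (U : set R),
        [/\ open U, range f `<=` U, smooth_on U b &
            forall c p, atlas c -> chart_dom c p ->
              grad_norm2 f c (c p) = b (f p)]].

Definition isoparametric (R : realType) (n : nat) (N : riemannian R n)
    (f : N -> R) : Prop :=
  transnormal f /\
  exists2 a : R -> R, {within range f, continuous a} &
    forall c p, atlas c -> chart_dom c p -> laplacian f c (c p) = a (f p).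

Definition regular_value (R : realType) (n : nat) (N : riemannian R n)
    (f : N -> R) (t : R) : Prop :=
  forall (p : N) (c : chart R N n), f p = t -> atlas c -> chart_dom c p ->
    exists u, 'D_u (local_expr f c) (c p) != 0.

Definition focal_max (R : realType) (n : nat) (N : riemannian R n)
    (f : N -> R) : set N := [set p | forall q, f q <= f p].

Definition focal_min (R : realType) (n : nat) (N : riemannian R n)
    (f : N -> R) : set N := [set p | forall q, f p <= f q].

(* Embedded submanifold of dimension k: local slice charts in the maximal
   atlas. *)
Definition submanifold (R : realType) (n : nat) (N : riemannian R n)
    (k : nat) (P : set N) : Prop :=
  (k <= n)%N /\
  forall p, P p -> exists c : chart R N n,
    [/\ atlas c, chart_dom c p &
        forall x, chart_img c x ->
          (P (chart_inv c x) <-> forall i : 'I_n, (k <= i)%N -> x 0 i = 0)].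

(* u is the velocity at the point of coordinates x of a smooth curve in P. *)
Definition tangent (R : realType) (n : nat) (N : riemannian R n)
    (P : set N) (c : chart R N n) (x u : 'rV[R]_n) : Prop :=
  exists (e : R) (sigma : R -> 'rV[R]_n),
    [/\ 0 < e,
        smooth_on (ball (0 : R) e) sigma,
        forall t, ball (0 : R) e t ->
          chart_img c (sigma t) /\ P (chart_inv c (sigma t)),
        sigma 0 = x &
        'D_1 sigma 0 = u].

Definition unit_normal (R : realType) (n : nat) (N : riemannian R n)
    (P : set N) (c : chart R N n) (x v : 'rV[R]_n) : Prop :=
  inner c x v v = 1 /\ forall u, tangent P c x u -> inner c x u v = 0.

(* X is a smooth vector field on the open set W whose values along P are
   tangent to P. *)
Definition tangent_field (R : realType) (n : nat) (N : riemannian R n)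
    (P : set N) (c : chart R N n) (W : set 'rV[R]_n)
    (X : 'rV[R]_n -> 'rV[R]_n) : Prop :=
  smooth_on W X /\
  forall y, W y -> P (chart_inv c y) -> tangent P c y (X y).

(* The rows of B form a basis of the tangent space of P, and T is the matrix
   (acting on row vectors of coordinates) in this basis of the shape operator
   T_v, characterized by <T_v X, Y> = <nabla_X Y, v>. *)
Definition shape_operator (R : realType) (n : nat) (N : riemannian R n)
    (P : set N) (c : chart R N n) (x v : 'rV[R]_n)
    (k : nat) (B : 'M[R]_(k, n)) (T : 'M[R]_k) : Prop :=
  [/\ row_free B,
      forall u, tangent P c x u <-> (u <= B)%MS &
      forall (W : set 'rV[R]_n) (X Y : 'rV[R]_n -> 'rV[R]_n) (a b : 'rV[R]_k),
        open W -> W x -> W `<=` chart_img c ->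
        tangent_field P c W X -> tangent_field P c W Y ->
        X x = a *m B -> Y x = b *m B ->
        inner c x (a *m T *m B) (b *m B) = inner c x (covd c X Y x) v].

(* s lists the eigenvalues of the shape operator T_v with multiplicity, in an
   arbitrary order. *)
Definition principal_curvatures (R : realType) (n : nat) (N : riemannian R n)
    (P : set N) (c : chart R N n) (x v : 'rV[R]_n) (s : seq R) : Prop :=
  exists (k : nat) (B : 'M[R]_(k, n)) (T : 'M[R]_k),
    shape_operator P c x v B T /\
    char_poly T = \prod_(r <- s) ('X - r%:P).

Definition constant_principal_curvatures (R : realType) (n : nat)
    (N : riemannian R n) (f : N -> R) : Prop :=
  exists kappa : R -> seq R,
    forall (t : R) (p : N) (c : chart R N n),
      regular_value f t -> f p = t -> atlas c -> chart_dom c p ->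
      principal_curvatures (f @^-1` [set t]) c (c p)
        (unit_grad f c (c p)) (kappa t).

Definition austere (R : realType) (n : nat) (N : riemannian R n)
    (P : set N) : Prop :=
  (exists k, submanifold k P) /\
  forall (p : N) (c : chart R N n) (v : 'rV[R]_n),
    P p -> atlas c -> chart_dom c p -> unit_normal P c (c p) v ->
    exists2 s, principal_curvatures P c (c p) v s &
      perm_eq s [seq - r | r <- s].

(* Vanishing mean curvature: T_v is trace free for every unit normal v. *)
Definition minimal (R : realType) (n : nat) (N : riemannian R n)
    (P : set N) : Prop :=
  (exists k, submanifold k P) /\
  forall (p : N) (c : chart R N n) (v : 'rV[R]_n),
    P p -> atlas c -> chart_dom c p -> unit_normal P c (c p) v ->
    exists (k : nat) (B : 'M[R]_(k, n)) (T : 'M[R]_k),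
      shape_operator P c (c p) v B T /\ \tr T = 0.

(* Main.v *)
From HB Require Import structures.
Require Import Defs.
From mathcomp Require Import all_boot all_order all_algebra.
From mathcomp Require Import all_classical all_reals all_analysis.
From mathcomp Require Import perm ring lra zify complex.
Import Order.TTheory GRing.Theory Num.Theory.
Import numFieldNormedType.Exports.
Local Open Scope classical_set_scope.
Local Open Scope ring_scope.
Set Implicit Arguments.
Unset Strict Implicit.
Unset Printing Implicit Defensive.

(* Differentiating |grad f|^2 = b(f) shows that grad f is an eigenvector of the
   Hessian with eigenvalue b'(f)/2; on a focal variety P = f^-1(t0) the Hessian is
   therefore beta/2 times the projection onto the normal space, beta = b'(t0).
   Here beta <> 0, since otherwise P would be open as well as closed.  On a
   regular level the Hessian is block diagonal, with blocks b'(f)/2 and a multiple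
   of the shape operator, so that constancy of the principal curvatures makes
   det (a g - Hess f) / det g a function of a and f only.  Evaluate it, with a
   replaced by w a, at distance s from a point p of P in the directions v and - v,
   where w^2 = 4 (f - t0) / beta, so that w is asymptotic to s: after division of
   the tangential rows by w, the limits as s -> 0 are, up to the same factor, the
   characteristic polynomials of T_v and of T_(-v) = - T_v, which hence coincide. *)

(** * Smooth functions and matrices *)

(** Determinants stand in for the principal curvatures themselves, so no continuous choice of
    eigenvalues or frames is made on the nearby levels. The focal point x is approached along the
    coordinate segments x + s v and x - s v; only the second derivative of f and the first
    derivative of its Hessian at x enter the limit. The obstacle is that x + s v and x - s v lie in
    general on different levels, because of the third-order terms of f, while determinants can be
    compared only on one level. Hence the parameter w, a function of f alone: the intermediate value
    theorem provides, on both sides, points with the same small w. The constant 4 / beta comes from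
    f - t0 ~ (s^2 / 2) (beta / 2). The tangential rows are divided, and a is scaled, by w because
    the Hessian vanishes on tangent vectors at x. The quotient brings in the derivative of Hess f
    along v, whose tangential part is - (beta / 2) T_v, by the identity <nabla_X Y, v> = - (2 /
    beta) (D_v Hess f)(X, Y), obtained without extending v to a normal field. *)

Section differentiability.
Context {R : realType} {V W : normedModType R}.
Implicit Types (f : V -> W) (x : V).

(** The little-o of the definition becomes an estimate against a candidate [L]; differentiability of
    a local inverse, and its dependence on the germ only, are both proved in this form. *)
Lemma differentiable_boundP f x (L : {linear V -> W}) : continuous L ->
  (forall e, 0 < e ->
     \forall h \near (0 : V), `|f (h + x) - f x - L h| <= e * `|h|) ->
  differentiable f x /\ 'd f x = L :> (V -> W).
Proof.
move=> cL fL.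
have E : f \o shift x = cst (f x) + L +o_ 0 id.
  apply/eqaddoP => e e0; near=> h.
  rewrite /= !fctE /= opprD addrA.
  by near: h; apply: fL.
split; last exact: diff_unique.
by apply/diff_locallyP; rewrite (diff_unique cL E).
Unshelve. all: by end_near. Qed.

Lemma differentiable_bound f x : differentiable f x ->
  forall e, 0 < e ->
     \forall h \near (0 : V), `|f (h + x) - f x - 'D_h f x| <= e * `|h|.
Proof.
move=> df e e0; have /diff_locallyP[_ /eqaddoP/(_ _ e0)] := df.
apply: filterS => h; rewrite /= !fctE /= deriveE //.
by rewrite opprD addrA.
Qed.

Lemma near_eq_differentiable f g x :
  {near x, f =1 g} -> differentiable f x -> differentiable g x.
Proof.
move=> fg df.
apply: (proj1 (@differentiable_boundP g x ('d f x) _ _)).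
  exact: diff_continuous.
move=> e e0.
have fgx : f x = g x by exact: nbhs_singleton fg.
have fg' : \forall h \near (0 : V), f (h + x) = g (h + x).
  by move: fg; rewrite /= (near_shift 0 x) /= subr0.
have := differentiable_bound df e0.
apply: filterS2 fg' => h -> ; rewrite fgx.
by rewrite deriveE.
Qed.

End differentiability.

(** Coinduction: [smooth_on] speaks of all iterated directional derivatives, so a class of functions
    that are differentiable on U, and whose derivatives agree on U with members of the class,
    consists of smooth functions. Agreement on U is enough because U is open. The closure properties
    of smoothness rest on this principle. *)
Lemma smooth_on_coind {R : realType} {E V : normedModType R} (U : set E)
    (S : (E -> V) -> Prop) : open U ->
  (forall F, S F -> forall x, U x -> differentiable F x) ->
  (forall F v, S F -> exists2 F', S F' & forall x, U x -> 'D_v F x = F' x) ->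
  forall F, S F -> smooth_on U F.
Proof.
move=> oU Sd SD F SF s.
suff [G SG HG] : exists2 G, S G &
    forall x, U x -> (foldr (fun v G => 'D_v G) F s) x = G x.
  move=> x Ux; apply: near_eq_differentiable (Sd _ SG x Ux).
  near=> y; apply/esym/HG; near: y; exact: open_nbhs_nbhs.
elim: s => [|v s [G SG HG]] /=; first by exists F.
have [G' SG' HG'] := SD G v SG; exists G' => // x Ux.
rewrite -HG' //; apply: near_eq_derive.
near=> y; apply: HG; near: y; exact: open_nbhs_nbhs.
Unshelve. all: by end_near. Qed.

Section smooth_basics.
Context {R : realType} {E V : normedModType R}.
Implicit Types (U : set E) (F : E -> V).

Lemma smooth_on_differentiable U F x : smooth_on U F -> U x ->
  differentiable F x.
Proof. by move=> sF Ux; exact: (sF [::]). Qed.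

Lemma smooth_on_derivable U F x v : smooth_on U F -> U x -> derivable F x v.
Proof. by move=> sF Ux; apply/diff_derivable/smooth_on_differentiable/Ux. Qed.

Lemma smooth_on_derive U F v : smooth_on U F -> smooth_on U ('D_v F).
Proof.
by move=> sF s x Ux; have := sF (rcons s v) x Ux; rewrite foldr_rcons.
Qed.

Lemma smooth_on_sub U U' F : U' `<=` U -> smooth_on U F -> smooth_on U' F.
Proof. by move=> UU' sF s x /UU'; exact: sF. Qed.

Lemma eq_smooth_on U F G : open U -> (forall x, U x -> F x = G x) ->
  smooth_on U F -> smooth_on U G.
Proof.
move=> oU FG sF.
apply: (@smooth_on_coind _ _ _ U (fun G =>
  exists2 F', smooth_on U F' & forall x, U x -> F' x = G x)) => //.
- move=> H [F' sF' F'H] x Ux.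
  apply: near_eq_differentiable (smooth_on_differentiable sF' Ux).
  near=> y; apply: F'H; near: y; exact: open_nbhs_nbhs.
- move=> H v [F' sF' F'H]; exists ('D_v F').
    by exists ('D_v F') => //; exact: smooth_on_derive.
  move=> x Ux; apply: near_eq_derive; near=> y; apply/esym/F'H; near: y.
  exact: open_nbhs_nbhs.
- by exists F.
Unshelve. all: by end_near. Qed.

Lemma smooth_on_cst U (a : V) : smooth_on U (fun=> a).
Proof.
move=> s x _.
suff [b E0] : exists b : V, foldr (fun v G => 'D_v G) (fun=> a : V) s = cst b.
  by rewrite E0; exact: differentiable_cst.
elim: s => [|v s [b E0]] /=; first by exists a.
by rewrite E0; exists 0; apply/funext => y; rewrite derive_cst.
Qed.

End smooth_basics.

Section derive_rules.
Context {R : realType} {E : normedModType R}.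
Implicit Types (x v : E).

Lemma rV_coord n (u : 'rV[R]_n) : u = \sum_i u 0 i *: frame i.
Proof. by rewrite [LHS]row_sum_delta. Qed.

Lemma derive_frame n (V : normedModType R) (f : 'rV[R]_n -> V) (x u : 'rV[R]_n) :
  differentiable f x -> 'D_u f x = \sum_i u 0 i *: 'D_(frame i) f x.
Proof.
move=> df; rewrite deriveE // {1}[u]rV_coord linear_sum.
by apply: eq_bigr => i _; rewrite linearZ deriveE.
Qed.

Lemma derive_comp (V W : normedModType R) (G : E -> V) (f : V -> W) x v :
  differentiable G x -> differentiable f (G x) ->
  'D_v (f \o G) x = 'D_('D_v G x) f (G x).
Proof.
move=> dG df; rewrite !deriveE //; last exact: differentiable_comp.
by rewrite diff_comp.
Qed.

Lemma derive_coord m n (M : E -> 'M[R]_(m, n)) x v i j :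
  derivable M x v -> 'D_v M x i j = 'D_v (fun y => M y i j) x.
Proof. by move=> dM; rewrite derive_mx // mxE. Qed.

Lemma differentiable_mxP m n (M : E -> 'M[R]_(m, n)) x :
  differentiable M x <-> forall i j, differentiable (fun y => M y i j) x.
Proof.
split=> [dM i j|dM].
  apply: (@differentiable_comp _ _ _ _ M (fun N : 'M[R]_(m, n) => N i j)) => //.
  exact: differentiable_coord.
rewrite (_ : M = \sum_i \sum_j (fun y => M y i j *: delta_mx i j)).
  apply: differentiable_sum => i; apply: differentiable_sum => j.
  exact: differentiableZl.
apply/funext => y; rewrite fct_sumE [LHS]matrix_sum_delta.
by apply: eq_bigr => i _; rewrite fct_sumE.
Qed.

Lemma differentiable_rVP n (M : E -> 'rV[R]_n) x :
  differentiable M x <-> forall j, differentiable (fun y => M y 0 j) x.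
Proof.
split=> [/differentiable_mxP dM j //|dM]; apply/differentiable_mxP => i j.
by rewrite ord1.
Qed.

End derive_rules.

Section smooth_mx.
Context {R : realType} {E : normedModType R}.

Lemma smooth_on_mxP m n (U : set E) (M : E -> 'M[R]_(m, n)) : open U ->
  smooth_on U M <-> forall i j, smooth_on U (fun y => M y i j).
Proof.
move=> oU; split=> [sM i j|sM].
  apply: (@smooth_on_coind _ _ _ U (fun F => exists2 M : E -> 'M[R]_(m, n),
    smooth_on U M & F = (fun y => M y i j))) => //; last by exists M.
    move=> _ [N sN ->] x Ux.
    exact: (proj1 (differentiable_mxP N x) (smooth_on_differentiable sN Ux)).
  move=> _ v [N sN ->]; exists (fun y => 'D_v N y i j).
    by exists ('D_v N) => //; exact: smooth_on_derive.
  by move=> x Ux; rewrite derive_coord //; exact: smooth_on_derivable sN Ux.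
apply: (@smooth_on_coind _ _ _ U (fun N : E -> 'M[R]_(m, n) =>
  forall i j, smooth_on U (fun y => N y i j))) => //.
  move=> N sN x Ux; apply/differentiable_mxP => i j.
  exact: smooth_on_differentiable (sN i j) Ux.
move=> N v sN; exists (fun y => \matrix_(i, j) 'D_v (fun y => N y i j) y).
  move=> i j; rewrite (_ : (fun _ => _) = 'D_v (fun y => N y i j)).
    exact: smooth_on_derive.
  by apply/funext => y; rewrite mxE.
move=> x Ux; apply: derive_mx; apply/derivable_mxP => i j.
exact: smooth_on_derivable (sN i j) Ux.
Qed.

Lemma smooth_on_rVP n (U : set E) (M : E -> 'rV[R]_n) : open U ->
  smooth_on U M <-> forall j, smooth_on U (fun y => M y 0 j).
Proof.
move=> oU; split=> [/smooth_on_mxP sM j|sM]; first exact: sM.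
by apply/smooth_on_mxP => // i j; rewrite ord1.
Qed.

End smooth_mx.

(* The least class of functions containing the smooth ones and closed under
   the algebraic operations and composition; it is closed under directional
   derivatives, hence consists of smooth functions. *)
Inductive smooth_expr {R : realType} {E : normedModType R} (U : set E) :
    (E -> R) -> Prop :=
| smooth_expr_base f : smooth_on U f -> smooth_expr U f
| smooth_expr_add f g : smooth_expr U f -> smooth_expr U g ->
    smooth_expr U (fun x => f x + g x)
| smooth_expr_mul f g : smooth_expr U f -> smooth_expr U g ->
    smooth_expr U (fun x => f x * g x)
| smooth_expr_inv f : smooth_expr U f -> (forall x, U x -> f x != 0) ->
    smooth_expr U (fun x => (f x)^-1)
| smooth_expr_comp m (G : E -> 'rV[R]_m) (U' : set 'rV[R]_m) f :
    smooth_on U G -> (forall x, U x -> U' (G x)) -> smooth_on U' f ->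
    smooth_expr U (f \o G).

Section smooth_expr.
Context {R : realType} {E : normedModType R}.
Variable U : set E.
Hypothesis oU : open U.
Implicit Types f g : E -> R.

Lemma smooth_expr_sum n (f : 'I_n -> E -> R) :
  (forall i, smooth_expr U (f i)) -> smooth_expr U (fun x => \sum_i f i x).
Proof.
elim: n f => [|n IH] f sf.
  rewrite (_ : (fun _ => _) = fun=> 0); last first.
    by apply/funext => x; rewrite big_ord0.
  by apply: smooth_expr_base; exact: smooth_on_cst.
rewrite (_ : (fun _ => _) = fun x => \sum_(i < n) f (widen_ord (leqnSn n) i) x
    + f ord_max x); last by apply/funext => x; rewrite big_ord_recr.
by apply: smooth_expr_add => //; exact: IH.
Qed.

Lemma smooth_expr_differentiable f : smooth_expr U f ->
  forall x, U x -> differentiable f x.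
Proof.
elim=> {f} [f sf|f g _ IHf _ IHg|f g _ IHf _ IHg|f _ IHf f0|m G U' f sG GU sf] x Ux.
- exact: smooth_on_differentiable sf Ux.
- exact: differentiableD (IHf _ Ux) (IHg _ Ux).
- exact: differentiableM (IHf _ Ux) (IHg _ Ux).
- exact: differentiableV (IHf _ Ux) (f0 _ Ux).
- apply: differentiable_comp; first exact: smooth_on_differentiable sG Ux.
  exact: smooth_on_differentiable sf (GU _ Ux).
Qed.

Lemma smooth_expr_derive f v : smooth_expr U f ->
  exists2 f', smooth_expr U f' & forall x, U x -> 'D_v f x = f' x.
Proof.
elim=> {f} [f sf|f g sf [f' sf' Hf] sg [g' sg' Hg]|f g sf [f' sf' Hf] sg [g' sg' Hg]
  |f sf [f' sf' Hf] f0|m G U' f sG GU sf].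
- by exists ('D_v f) => //; apply/smooth_expr_base/smooth_on_derive.
- exists (fun x => f' x + g' x); first exact: smooth_expr_add.
  move=> x Ux; rewrite -Hf // -Hg // -deriveD //.
    exact/diff_derivable/smooth_expr_differentiable.
  exact/diff_derivable/smooth_expr_differentiable.
- exists (fun x => f x * g' x + g x * f' x).
    by apply: smooth_expr_add; exact: smooth_expr_mul.
  move=> x Ux; rewrite -Hf // -Hg // -[RHS]deriveM //.
    exact/diff_derivable/smooth_expr_differentiable.
  exact/diff_derivable/smooth_expr_differentiable.
- exists (fun x => (-1) * ((f x)^-1 * ((f x)^-1 * f' x))).
    apply: smooth_expr_mul; first exact/smooth_expr_base/smooth_on_cst.
    apply: smooth_expr_mul; first exact: smooth_expr_inv.
    by apply: smooth_expr_mul => //; exact: smooth_expr_inv.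
  move=> x Ux; rewrite -Hf // deriveV ?f0 //; last first.
    exact/diff_derivable/smooth_expr_differentiable.
  by rewrite mulN1r scaleNr /GRing.scale /= expr2 invfM mulrA.
(* The direction ['D_v G x] in which f is differentiated varies with x; expanding it over the fixed
   frame vectors expresses the derivative by members of the class. *)
- exists (fun x => \sum_i ('D_v G x 0 i * ('D_(frame i) f (G x)))).
    apply: smooth_expr_sum => i; apply: smooth_expr_mul.
      apply: smooth_expr_base.
      by move: i; apply/smooth_on_rVP => //; exact: smooth_on_derive.
    exact: (smooth_expr_comp sG GU (smooth_on_derive (frame i) sf)).
  move=> x Ux; rewrite derive_comp; last 2 first.
    exact: smooth_on_differentiable sG Ux.
    exact: smooth_on_differentiable sf (GU _ Ux).
  rewrite derive_frame //; exact: smooth_on_differentiable sf (GU _ Ux).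
Qed.

Lemma smooth_exprP f : smooth_expr U f -> smooth_on U f.
Proof.
move: f; apply: smooth_on_coind => //.
  exact: smooth_expr_differentiable.
by move=> f v; exact: smooth_expr_derive.
Qed.

Lemma smooth_onD f g : smooth_on U f -> smooth_on U g ->
  smooth_on U (fun x => f x + g x : R).
Proof.
move=> sf sg; apply: smooth_exprP.
by apply: smooth_expr_add; exact: smooth_expr_base.
Qed.

Lemma smooth_onM f g : smooth_on U f -> smooth_on U g ->
  smooth_on U (fun x => f x * g x : R).
Proof.
move=> sf sg; apply: smooth_exprP.
by apply: smooth_expr_mul; exact: smooth_expr_base.
Qed.

Lemma smooth_onN f : smooth_on U f -> smooth_on U (fun x => - f x : R).
Proof.
move=> sf; rewrite (_ : (fun _ => _) = fun x => -1 * f x).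
  by apply: smooth_onM => //; exact: smooth_on_cst.
by apply/funext => x; rewrite mulN1r.
Qed.

Lemma smooth_onB f g : smooth_on U f -> smooth_on U g ->
  smooth_on U (fun x => f x - g x : R).
Proof. by move=> sf sg; apply: smooth_onD => //; exact: smooth_onN. Qed.

Lemma smooth_onV f : smooth_on U f -> (forall x, U x -> f x != 0) ->
  smooth_on U (fun x => (f x)^-1 : R).
Proof.
by move=> sf f0; apply: smooth_exprP; apply: smooth_expr_inv => //; exact: smooth_expr_base.
Qed.

Lemma smooth_on_sum (I : Type) (r : seq I) (P : pred I) (f : I -> E -> R) :
  (forall i, smooth_on U (f i)) ->
  smooth_on U (fun x => \sum_(i <- r | P i) f i x).
Proof.
move=> sf; elim: r => [|i r IH].
  rewrite (_ : (fun _ => _) = fun=> 0); first exact: smooth_on_cst.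
  by apply/funext => x; rewrite big_nil.
rewrite (_ : (fun _ => _) = fun x => (if P i then f i x else 0) +
  \sum_(j <- r | P j) f j x); last first.
  by apply/funext => x; rewrite big_cons; case: ifP; rewrite ?add0r.
apply: smooth_onD => //; case: (P i) => //; exact: smooth_on_cst.
Qed.

Lemma smooth_on_prod (I : Type) (r : seq I) (f : I -> E -> R) :
  (forall i, smooth_on U (f i)) -> smooth_on U (fun x => \prod_(i <- r) f i x).
Proof.
move=> sf; elim: r => [|i r IH].
  rewrite (_ : (fun _ => _) = fun=> 1); first exact: smooth_on_cst.
  by apply/funext => x; rewrite big_nil.
rewrite (_ : (fun _ => _) = fun x => f i x * \prod_(j <- r) f j x).
  exact: smooth_onM.
by apply/funext => x; rewrite big_cons.
Qed.

Lemma smooth_on_comp m (G : E -> 'rV[R]_m) (U' : set 'rV[R]_m) (f : 'rV[R]_m -> R) :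
  smooth_on U G -> (forall x, U x -> U' (G x)) -> smooth_on U' f ->
  smooth_on U (f \o G).
Proof.
by move=> sG GU sf; exact: (smooth_exprP (smooth_expr_comp sG GU sf)).
Qed.

Lemma smooth_on_comp_mx m p q (G : E -> 'rV[R]_m) (U' : set 'rV[R]_m)
    (f : 'rV[R]_m -> 'M[R]_(p, q)) : open U' ->
  smooth_on U G -> (forall x, U x -> U' (G x)) -> smooth_on U' f ->
  smooth_on U (f \o G).
Proof.
move=> oU' sG GU sf; apply/smooth_on_mxP => // i j.
exact: (smooth_on_comp sG GU (proj1 (smooth_on_mxP f oU') sf i j)).
Qed.

Lemma smooth_on_mulmx m n p (M : E -> 'M[R]_(m, n)) (N : E -> 'M[R]_(n, p)) :
  smooth_on U M -> smooth_on U N -> smooth_on U (fun x => M x *m N x).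
Proof.
move=> /smooth_on_mxP sM /smooth_on_mxP sN; apply/smooth_on_mxP => // i j.
rewrite (_ : (fun _ => _) = fun x => \sum_k M x i k * N x k j).
  by apply: smooth_on_sum => k; apply: smooth_onM; [exact: sM|exact: sN].
by apply/funext => x; rewrite mxE.
Qed.

Lemma smooth_on_addmx m n (M N : E -> 'M[R]_(m, n)) :
  smooth_on U M -> smooth_on U N -> smooth_on U (fun x => M x + N x).
Proof.
move=> /smooth_on_mxP sM /smooth_on_mxP sN; apply/smooth_on_mxP => // i j.
rewrite (_ : (fun _ => _) = fun x => M x i j + N x i j).
  by apply: smooth_onD; [exact: sM|exact: sN].
by apply/funext => x; rewrite mxE.
Qed.

Lemma smooth_on_scalemx m n (k : E -> R) (N : E -> 'M[R]_(m, n)) :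
  smooth_on U k -> smooth_on U N -> smooth_on U (fun x => k x *: N x).
Proof.
move=> sk /smooth_on_mxP sN; apply/smooth_on_mxP => // i j.
rewrite (_ : (fun _ => _) = fun x => k x * N x i j).
  by apply: smooth_onM; [exact: sk|exact: sN].
by apply/funext => x; rewrite mxE.
Qed.

Lemma smooth_on_det n (M : E -> 'M[R]_n) :
  smooth_on U M -> smooth_on U (fun x => \det (M x)).
Proof.
move=> /smooth_on_mxP sM; rewrite /determinant.
apply: smooth_on_sum => s; apply: smooth_onM; first exact: smooth_on_cst.
by apply: smooth_on_prod => i; exact: sM.
Qed.

Lemma smooth_on_invmx n (M : E -> 'M[R]_n) : (forall x, U x -> M x \in unitmx) ->
  smooth_on U M -> smooth_on U (fun x => invmx (M x)).
Proof.
move=> uM sM.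
apply: (@eq_smooth_on _ _ _ U (fun x => (\det (M x))^-1 *: \adj (M x))) => //.
  by move=> x Ux; rewrite /invmx uM.
apply: smooth_on_scalemx.
  apply: smooth_onV; first exact: smooth_on_det.
  by move=> x /uM; rewrite unitmxE unitfE.
apply/smooth_on_mxP => // i j.
rewrite (_ : (fun _ => _) = fun x => (-1) ^+ (j + i) * \det (row' j (col' i (M x)))).
  apply: smooth_onM; first exact: smooth_on_cst.
  apply: smooth_on_det; apply/smooth_on_mxP => // k l.
  rewrite (_ : (fun _ => _) = fun x => M x (lift j k) (lift i l)).
    by move/smooth_on_mxP: sM; exact.
  by apply/funext => x; rewrite !mxE.
by apply/funext => x; rewrite !mxE.
Qed.

End smooth_expr.

(** * Mean value theorem and symmetry of second derivatives *)

Section mean_value.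
Context {R : realType} {E : normedModType R}.
Implicit Types (f : E -> R) (x u v : E).

Lemma is_derive_line (V : normedModType R) (f : E -> V) x u (t : R) :
  differentiable f (x + t *: u) ->
  is_derive t 1 (fun t => f (x + t *: u)) ('D_u f (x + t *: u)).
Proof.
move=> df; pose G (t : R) : E := x + t *: u.
have dG : is_derive t 1 G u.
  have -> : G = cst x + (fun t => t *: u) by [].
  have dZ := is_diff_scalel t u.
  apply: DeriveDef.
    exact/diff_derivable/differentiableD.
  rewrite deriveD; [|exact: derivable_cst|exact: diff_derivable].
  by rewrite derive_cst add0r deriveE // diff_val scale1r.
have dG' : differentiable G t by apply/derivable1_diffP.
apply: DeriveDef.
  by apply/diff_derivable; exact: (@differentiable_comp _ _ _ _ G f).
by rewrite (derive_comp _ dG' df) derive_val.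
Qed.

Lemma mvt_line f x u :
  (forall t : R, 0 <= t <= 1 -> differentiable f (x + t *: u)) ->
  exists2 t : R, 0 < t < 1 & f (x + u) - f x = 'D_u f (x + t *: u).
Proof.
move=> df; have d (t : R) : 0 <= t <= 1 -> is_derive t 1 (fun t => f (x + t *: u))
    ('D_u f (x + t *: u)) by move=> t01; apply/is_derive_line/df.
have := @MVT R (fun t => f (x + t *: u)) (fun t => 'D_u f (x + t *: u)) 0 1 ltr01.
rewrite scale1r scale0r addr0 subr0.
case.
- move=> t; rewrite in_itv /= => /andP[t0 t1]; apply: d.
  by rewrite !ltW.
- apply: derivable_within_continuous => t; rewrite in_itv /= => t01.
  by have := d t t01 => -[].
- by move=> t; rewrite in_itv /= mulr1 => t01 ->; exists t.
Qed.

(** The mean value theorem along u, applied to f (y + s v) - f y, leaves a difference of two values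
    of ['D_u f] near x, which the differentiability of ['D_u f] at x estimates. The second
    difference is symmetric in u and v, whence Schwarz's theorem [derive_sym]. *)
Lemma second_difference f x u v (e : R) : 0 < e ->
  (\near x, differentiable f x) -> differentiable ('D_u f) x ->
  exists2 r, 0 < r & forall s, 0 < s < r ->
    `|f (x + s *: u + s *: v) - f (x + s *: u) - f (x + s *: v) + f x
      - s ^+ 2 * 'D_v ('D_u f) x| <= e * s ^+ 2.
Proof.
move=> e0 ndf dDf.
(* Chosen so that t s u + t' s v, with t and t' in [0, 1], has norm at most s M / 2: each of two
   expansions with error rate e / M then costs e s / 2. The summand 1 keeps M positive. *)
set M := 2 * (`|u| + `|v| + 1).
have M0 : 0 < M by rewrite mulr_gt0 // ltr_wpDl // addr_ge0.
have [r1 /= r10 Hr1] := proj1 (nbhs_ballP _ _) ndf.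
have [r2 /= r20 Hr2] := proj1 (nbhs_ballP _ _)
  (differentiable_bound dDf (divr_gt0 e0 M0)).
exists (Num.min r1 r2 / M) => [|s /andP[s0]].
  by rewrite divr_gt0 // lt_min r10.
rewrite ltr_pdivlMr // lt_min => /andP[sr1 sr2].
have bnd (t t' : R) : 0 <= t <= 1 -> 0 <= t' <= 1 ->
    `|t *: (s *: u) + t' *: (s *: v)| <= s * (M / 2).
  move=> /andP[t0 t1] /andP[t'0 t'1].
  rewrite (le_trans (ler_normD _ _)) // !normrZ.
  rewrite (ger0_norm t0) (ger0_norm t'0) (gtr0_norm s0).
  have := mulr_ge0 (ltW s0) (normr_ge0 u); have := mulr_ge0 (ltW s0) (normr_ge0 v).
  rewrite /M; nra.
have sM : s * (M / 2) < s * M by rewrite ltr_pM2l //; lra.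
have inb (t t' : R) : 0 <= t <= 1 -> 0 <= t' <= 1 ->
    differentiable f (x + t *: (s *: u) + t' *: (s *: v)).
  move=> t01 t'01; apply: Hr1; rewrite -ball_normE /= -addrA opprD addrA subrr sub0r.
  by rewrite normrN (le_lt_trans (bnd _ _ t01 t'01)) // (lt_trans sM).
have inb2 (t t' : R) : 0 <= t <= 1 -> 0 <= t' <= 1 ->
    `|'D_u f (x + (t *: (s *: u) + t' *: (s *: v))) - 'D_u f x
       - 'D_(t *: (s *: u) + t' *: (s *: v)) ('D_u f) x| <= e / 2 * s.
  move=> t01 t'01.
  rewrite [X in 'D_u f X - _]addrC; apply: le_trans (Hr2 _ _) _.
    rewrite -ball_normE /= sub0r normrN.
    by rewrite (le_lt_trans (bnd _ _ t01 t'01)) // (lt_trans sM).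
  apply: le_trans (ler_wpM2l _ (bnd _ _ t01 t'01)) _.
    by rewrite divr_ge0 // ltW.
  by rewrite le_eqVlt; apply/orP; left; apply/eqP; field; rewrite gt_eqF.
have le01 : 0 <= (1 : R) <= 1 by rewrite ler01 lexx.
have le00 : 0 <= (0 : R) <= 1 by rewrite lexx ler01.
pose g y := f (y + s *: v) - f y.
have dshift y w : differentiable f (y + w) ->
    is_diff y (fun y => f (y + w)) ('d f (y + w)).
  move=> dfy; have dS : is_diff y (fun y : E => y + w) id.
    have -> : (fun y : E => y + w) = id + cst w by [].
    by apply: is_diff_eq; rewrite addr0.
  apply: DiffDef.
    by apply: (@differentiable_comp _ _ _ _ (fun y => y + w) f).
  by rewrite (@diff_comp _ _ _ _ (fun y => y + w) f) // diff_val.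
have [] := @mvt_line g x (s *: u).
  move=> t t01; apply: differentiableB.
    have := inb t 1 t01 le01; rewrite scale1r => D1.
    by case: (dshift _ _ D1).
  by have := inb t 0 t01 le00; rewrite scale0r addr0.
move=> t /andP[t0 t1]; rewrite /g.
have t01 : 0 <= t <= 1 by rewrite !ltW.
have D1 : differentiable f (x + t *: (s *: u) + s *: v).
  by have := inb t 1 t01 le01; rewrite scale1r.
have D0 : differentiable f (x + t *: (s *: u)).
  by have := inb t 0 t01 le00; rewrite scale0r addr0.
have dS := dshift _ _ D1.
rewrite deriveB; [|exact: diff_derivable|exact: diff_derivable].
have E2 : 'D_(s *: u) (fun y => f (y + s *: v)) (x + t *: (s *: u)) =
    s * 'D_u f (x + t *: (s *: u) + s *: v).
  by rewrite deriveE // diff_val linearZ deriveE.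
have E3 : 'D_(s *: u) f (x + t *: (s *: u)) = s * 'D_u f (x + t *: (s *: u)).
  by rewrite deriveE // linearZ deriveE.
rewrite E2 E3 => E1.
(* The unknown intermediate t contributes the same term t s D_u D_u f to both expansions and drops
   out of their difference. *)
have := inb2 t 1 t01 le01; have := inb2 t 0 t01 le00.
have Dlin (t' : R) : 'D_(t *: (s *: u) + t' *: (s *: v)) ('D_u f) x =
    t * (s * 'D_u ('D_u f) x) + t' * (s * 'D_v ('D_u f) x).
  by rewrite !(deriveE _ dDf) linearD 4!linearZ.
rewrite !Dlin !mul1r !mul0r !addr0 !scale1r !scale0r !addr0 !addrA.
rewrite (_ : f (x + s *: u + s *: v) - _ - _ + _ =
  f (x + s *: u + s *: v) - f (x + s *: u) - (f (x + s *: v) - f x)); last by lra.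
rewrite E1.
set a := 'D_u f (x + t *: _); set b := 'D_u f (x + t *: _ + _); set c := 'D_u f x.
set d := 'D_u ('D_u f) x; set k := 'D_v _ _ => H1 H2; rewrite opprD addrA in H2.
rewrite (_ : s * b - s * a - s ^+ 2 * k =
  s * ((b - c - t * (s * d) - s * k) - (a - c - t * (s * d)))); last by ring.
rewrite normrM (gtr0_norm s0) expr2 [leRHS]mulrCA ler_pM2l //.
rewrite (le_trans (ler_normB _ _)) //.
rewrite [leRHS](_ : _ = e / 2 * s + e / 2 * s); last by field.
by rewrite lerD.
Qed.

Lemma derive_sym f x u v : (\near x, differentiable f x) ->
  differentiable ('D_u f) x -> differentiable ('D_v f) x ->
  'D_v ('D_u f) x = 'D_u ('D_v f) x.
Proof.
move=> ndf du dv; apply/eqP; rewrite -subr_eq0 -normr_le0; apply/ler_addgt0Pr => e e0.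
have e20 : 0 < e / 2 by rewrite divr_gt0.
have [r1 r10 H1] := second_difference v e20 ndf du.
have [r2 r20 H2] := second_difference u e20 ndf dv.
pose s := Num.min r1 r2 / 2.
have m0 : 0 < Num.min r1 r2 by rewrite lt_min r10.
have s0 : 0 < s by rewrite divr_gt0.
have sm : s < Num.min r1 r2 by rewrite /s; lra.
move: (sm); rewrite lt_min => /andP[sr1 sr2].
have := H1 s; rewrite s0 sr1 => /(_ isT).
have := H2 s; rewrite s0 sr2 => /(_ isT).
rewrite (addrAC x (s *: v)) -(addrA (f (x + s *: u + s *: v) - f (x + s *: v))).
set F := f _; set A := f _; set B := f _; set C := f x.
set a := 'D_u _ _; set b := 'D_v _ _ => K1 K2.
have s20 : 0 < s ^+ 2 by rewrite exprn_gt0.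
rewrite add0r -(ler_pM2l s20) -(gtr0_norm s20) -normrM (gtr0_norm s20).
rewrite (_ : s ^+ 2 * (b - a) = (F - A + (- B + C) - s ^+ 2 * a) - (F - B - A + C - s ^+ 2 * b));
   last by ring.
rewrite (le_trans (ler_normB _ _)) // (_ : s ^+ 2 * e = e / 2 * s ^+ 2 + e / 2 * s ^+ 2).
  exact: lerD K1 K2.
by field.
Qed.

Lemma smooth_on_derive_sym (U : set E) f x u v : open U -> U x -> smooth_on U f ->
  'D_v ('D_u f) x = 'D_u ('D_v f) x.
Proof.
move=> oU Ux sf; apply: derive_sym.
- near=> y; apply: (smooth_on_differentiable sf); near: y; exact: open_nbhs_nbhs.
- exact: smooth_on_differentiable (smooth_on_derive u sf) Ux.
- exact: smooth_on_differentiable (smooth_on_derive v sf) Ux.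
Unshelve. all: by end_near. Qed.

Lemma smooth_on_lin (V : normedModType R) (U : set E) (L : {linear E -> V}) :
  open U -> continuous L -> smooth_on U L.
Proof.
move=> oU cL; apply: (@smooth_on_coind _ _ _ U
    (fun F => F = L :> (E -> V) \/ exists a, F = cst a)) => //; last by left.
- move=> _ [->|[a ->]] x _; first exact: linear_differentiable.
  exact: differentiable_cst.
- move=> _ v [->|[a ->]]; last first.
    by exists (cst 0); [right; exists 0|move=> x _; rewrite derive_cst].
  exists (cst (L v)); first by right; exists (L v).
  move=> x _; rewrite deriveE; last exact: linear_differentiable.
  by rewrite diff_lin.
Qed.

Lemma smooth_on_id (U : set E) : open U -> smooth_on U (@id E).
Proof. by move=> oU; apply: (@smooth_on_lin E U idfun) => // x; exact: cvg_id. Qed.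

End mean_value.

Section row_maps.
Context {R : realType}.

Lemma smooth_on_mulmxr m n p (A : 'M[R]_(n, p)) (U : set 'M[R]_(m, n)) :
  open U -> smooth_on U (mulmxr A).
Proof.
by move=> oU; apply: smooth_on_mulmx => //; [exact: smooth_on_id|exact: smooth_on_cst].
Qed.

Lemma continuous_mulmxr m n p (A : 'M[R]_(n, p)) :
  continuous (mulmxr A : 'M[R]_(m, n) -> 'M[R]_(m, p)).
Proof.
move=> x; apply: differentiable_continuous.
by apply: (@smooth_on_differentiable _ _ _ setT) => //; apply: smooth_on_mulmxr; exact: openT.
Qed.

Lemma derive_mulmxr (E : normedModType R) m n p (A : 'M[R]_(n, p))
    (M : E -> 'M[R]_(m, n)) x v :
  differentiable M x -> 'D_v (fun y => M y *m A) x = 'D_v M x *m A.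
Proof.
move=> dM.
have dA : differentiable (mulmxr A : 'M[R]_(m, n) -> 'M[R]_(m, p)) (M x).
  exact/linear_differentiable/continuous_mulmxr.
rewrite (_ : (fun _ => _) = mulmxr A \o M) // derive_comp // deriveE //.
by rewrite diff_lin //; exact: continuous_mulmxr.
Qed.

Lemma coord_le_norm n (u : 'rV[R]_n) i : `|u 0 i| <= `|u|.
Proof.
by rewrite [leRHS]/Num.Def.normr /= mx_normrE; exact: (le_bigmax _ _ (0, i)).
Qed.

Lemma norm_le_coord n (u : 'rV[R]_n) (e : R) : 0 <= e ->
  (forall i, `|u 0 i| <= e) -> `|u| <= e.
Proof.
move=> e0 ue; rewrite [leLHS]/Num.Def.normr /= mx_normrE bigmax_le //= => -[i j] _ /=.
by rewrite ord1.
Qed.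

End row_maps.

(** * The inverse function theorem *)

(* Joins the complete uniform structure of matrices with their norm, as the Banach
   fixed point theorem requires. *)
HB.instance Definition _ (R : realType) (m n : nat) := Complete.on 'M[R]_(m, n).

Section inverse_function.
Context {R : realType} {n : nat}.
Variables (Om : set 'rV[R]_n) (Phi : 'rV[R]_n -> 'rV[R]_n) (x0 : 'rV[R]_n).
Hypotheses (oOm : open Om) (Omx0 : Om x0) (sPhi : smooth_on Om Phi).
Hypothesis DPhi : forall u, 'D_u Phi x0 = u.

Let rem (x : 'rV[R]_n) : 'rV[R]_n := Phi x - x.

Let srem : smooth_on Om rem.
Proof.
rewrite (_ : rem = fun x => Phi x + (-1) *: x).
  apply: smooth_on_addmx => //; apply: smooth_on_scalemx => //; first exact: smooth_on_cst.
  exact: smooth_on_id.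
by apply/funext => x; rewrite scaleN1r.
Qed.

Let jac (x : 'rV[R]_n) : 'M[R]_n := \matrix_(j, i) 'D_(frame j) (fun y => Phi y 0 i) x.

Let sjac : smooth_on Om jac.
Proof.
apply/smooth_on_mxP => // i j.
rewrite (_ : (fun _ => _) = 'D_(frame i) (fun y => Phi y 0 j)).
  by apply: smooth_on_derive; move/smooth_on_rVP: sPhi; apply.
by apply/funext => x; rewrite mxE.
Qed.

Let DPhiE x u : Om x -> 'D_u Phi x = u *m jac x.
Proof.
move=> Ox; have dP := smooth_on_differentiable sPhi Ox.
rewrite derive_frame //; apply/rowP => i; rewrite summxE mxE; apply: eq_bigr => j _.
by rewrite !mxE derive_coord //; exact: diff_derivable.
Qed.

Let remE x u : Om x -> 'D_u rem x = 'D_u Phi x - u.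
Proof.
move=> Ox; have dP := smooth_on_differentiable sPhi Ox.
by rewrite deriveB ?derive_id //; exact: diff_derivable.
Qed.

Let small_ball : exists2 r, 0 < r & forall x, `|x - x0| < r ->
  Om x /\ forall u, `|'D_u rem x| <= 2^-1 * `|u|.
Proof.
(* A sum of n partial derivatives of this size stays below 1/2 in the sup norm; n.+1 covers the case
   n = 0. *)
have e0 : 0 < (2 * n.+1%:R)^-1 :> R by rewrite invr_gt0 mulr_gt0.
have nb : \near x0, Om x0 /\ forall i j, `|'D_(frame j) (fun y => rem y 0 i) x0| <= (2 * n.+1%:R)^-1.
  apply: filterI; first exact: open_nbhs_nbhs.
  apply: (@filter_forall _ _ _ (nbhs x0)) => i; apply: filter_forall => j.
  have sij : smooth_on Om ('D_(frame j) (fun y => rem y 0 i)).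
    exact: smooth_on_derive (proj1 (smooth_on_rVP rem oOm) srem i).
  have := differentiable_continuous (smooth_on_differentiable sij Omx0).
  move=> /cvgrPdist_le /(_ _ e0).
  rewrite -derive_coord; last exact: smooth_on_derivable srem Omx0.
  rewrite remE // DPhi subrr mxE.
  by apply: filterS => x; rewrite sub0r normrN.
have [r /= r0 Hr] := proj1 (nbhs_ballP _ _) nb.
exists r => // x xr; have [Ox Hx] : Om x /\ forall i j,
    `|'D_(frame j) (fun y => rem y 0 i) x| <= (2 * n.+1%:R)^-1.
  by apply: Hr; rewrite -ball_normE /= distrC.
split=> // u; apply: norm_le_coord; first by rewrite mulr_ge0 // invr_ge0.
move=> i; have dr := smooth_on_differentiable srem Ox.
rewrite derive_frame // summxE (le_trans (ler_norm_sum _ _ _)) //.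
apply: (@le_trans _ _ (\sum_(j < n) `|u| * (2 * n.+1%:R)^-1)).
  apply: ler_sum => j _; rewrite mxE normrM ler_pM ?coord_le_norm //.
  rewrite derive_coord; first exact: Hx.
  exact: diff_derivable.
rewrite sumr_const card_ord -[leLHS]mulr_natr [leRHS]mulrC -mulrA ler_wpM2l //.
rewrite invfM -mulrA ler_piMr ?invr_ge0 // mulrC ler_pdivrMr //.
by rewrite mul1r ler_nat.
Unshelve. all: by end_near. Qed.

(** The remainder Phi - id is 1/2-Lipschitz near x0, so solving Phi x = y is a fixed point problem
    for the contraction x -> y - rem x, and Phi shrinks distances at most by the factor 2. The maps
    to be straightened are built so that their differential at the point is the identity. *)
Lemma inverse_function : exists (U V : set 'rV[R]_n) (G : 'rV[R]_n -> 'rV[R]_n),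
  [/\ open U, U x0, U `<=` Om, open V & smooth_on V G] /\
  [/\ forall x, U x -> V (Phi x) /\ G (Phi x) = x,
      forall y, V y -> U (G y) /\ Phi (G y) = y &
      forall u, 'D_u G (Phi x0) = u].
Proof.
have [r r0 Hr] := small_ball.
have lip x y : `|x - x0| < r -> `|y - x0| < r -> `|rem x - rem y| <= 2^-1 * `|x - y|.
  move=> xr yr; apply: norm_le_coord; first by rewrite mulr_ge0 // invr_ge0.
  move=> i; have inb (t : R) : 0 <= t <= 1 -> `|y + t *: (x - y) - x0| < r.
    move=> /andP[t0 t1].
    have -> : y + t *: (x - y) - x0 = t *: (x - x0) + (1 - t) *: (y - x0).
      by apply/rowP => k; rewrite !mxE; ring.
    rewrite (le_lt_trans (ler_normD _ _)) // !normrZ (ger0_norm t0).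
    rewrite ger0_norm ?subr_ge0 //.
    pose M := Num.max `|x - x0| `|y - x0|.
    have xM : `|x - x0| <= M by rewrite le_max lexx.
    have yM : `|y - x0| <= M by rewrite le_max lexx orbT.
    apply: (@le_lt_trans _ _ M); last by rewrite gt_max xr yr.
    have -> : M = t * M + (1 - t) * M by ring.
    by rewrite lerD // ler_wpM2l // subr_ge0.
  have dri z : Om z -> differentiable (fun y => rem y 0 i) z.
    move=> Oz; exact: smooth_on_differentiable (proj1 (smooth_on_rVP rem oOm) srem i) Oz.
  have [|t /andP[t0 t1]] := @mvt_line _ _ (fun y => rem y 0 i) y (x - y).
    by move=> t /inb /Hr[/dri].
  have -> : y + (x - y) = x by rewrite addrC subrK.
  have -> : (rem x - rem y) 0 i = rem x 0 i - rem y 0 i by rewrite [LHS]mxE; congr (_ + _); rewrite [LHS]mxE.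
  move=> ->.
  have [] := Hr (y + t *: (x - y)); first by apply: inb; rewrite !ltW.
  move=> Oz /(_ (x - y)); apply: le_trans.
  rewrite -derive_coord; last exact: smooth_on_derivable srem Oz.
  exact: coord_le_norm.
have r20 : 0 < r / 2 by rewrite divr_gt0.
have r2r : r / 2 < r by lra.
have x0x0 : `|x0 - x0| < r by rewrite subrr normr0.
have expand x y : `|x - x0| < r -> `|y - x0| < r -> `|x - y| <= 2 * `|Phi x - Phi y|.
  move=> xr yr; have := lip _ _ xr yr.
  have -> : Phi x - Phi y = (x - y) + (rem x - rem y).
    by apply/rowP => k; rewrite !mxE; ring.
  have := ler_normB (x - y + (rem x - rem y)) (rem x - rem y).
  by rewrite addrK; lra.
(* With |y - Phi x0| < r / 4, the map x -> y - rem x sends the closed ball of radius r / 2 into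
   itself, as r / 4 + (r / 2) / 2 = r / 2; the strict inequality puts the fixed point in the open
   ball. *)
pose V := [set y | `|y - Phi x0| < r / 4].
pose U := [set x | `|x - x0| < r / 2 /\ V (Phi x)].
have oball (z : 'rV[R]_n) e : open [set x | `|x - z| < e].
  rewrite (_ : [set _ | _] = ball z e); first exact: ball_open.
  by rewrite -ball_normE; apply/seteqP; split=> x /=; rewrite distrC.
have surj y : V y -> exists x, U x /\ Phi x = y.
  move=> Vy; pose B := [set x : 'rV[R]_n | `|x - x0| <= r / 2].
  have TB : set_fun B B (fun x => y - rem x).
    move=> x Bx; rewrite /B /=.
    have -> : y - rem x - x0 = (y - Phi x0) - (rem x - rem x0).
      by rewrite /rem; apply/rowP => k; rewrite !mxE; ring.
    rewrite (le_trans (ler_normB _ _)) //.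
    have xr : `|x - x0| < r by exact: le_lt_trans Bx r2r.
    have := lip _ _ xr x0x0; move: Vy Bx; rewrite /V /B /=; lra.
  pose T := mkfun_fun TB.
  have cT : is_contraction T.
    exists (2^-1)%:nng; split; first by rewrite /= invf_lt1 // ltr1n.
    move=> [x x'] [/= Bx Bx'].
    have -> : T x - T x' = - (rem x - rem x').
      rewrite -[T x]/(y - rem x) -[T x']/(y - rem x'); move: (rem x) (rem x') => p q.
      by rewrite opprD opprK addrACA subrr add0r opprB addrC.
    by rewrite normrN; apply: lip; [exact: le_lt_trans Bx r2r|exact: le_lt_trans Bx' r2r].
  have cB : closed B.
    have -> : B = (fun x => `|x - x0|) @^-1` [set s | s <= r / 2] by [].
    apply: closed_comp; last exact: closed_le.
    move=> x _; apply: continuous_comp; last exact: norm_continuous.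
    by apply: continuousB; [exact: cvg_id|exact: cst_continuous].
  have B0 : B !=set0 by exists x0; rewrite /B /= subrr normr0 ltW.
  have [x Bx xE] := banach_fixed_point cT cB B0.
  have Px : Phi x = y.
    have h : x = x + (y - Phi x) by rewrite addrCA -opprB; exact: xE.
    apply/esym/eqP; rewrite -subr_eq0; apply/eqP; apply: (addrI x).
    by rewrite addr0 -h.
  exists x; split => //; split; last by rewrite Px.
  have xr : `|x - x0| < r by exact: le_lt_trans Bx r2r.
  have := expand _ _ xr x0x0; rewrite Px.
  by move: Vy; rewrite /V /=; lra.
pose G y := xget x0 [set x | U x /\ Phi x = y].
have GP y : V y -> U (G y) /\ Phi (G y) = y.
  by move=> /surj[x Hx]; exact: (@xgetPex _ x0 [set x | U x /\ Phi x = y] (ex_intro _ x Hx)).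
have Ur x : U x -> `|x - x0| < r by case=> h _; exact: lt_trans h r2r.
have inj x y : U x -> U y -> Phi x = Phi y -> x = y.
  move=> /Ur xr /Ur yr Pxy; have := expand _ _ xr yr.
  by rewrite Pxy subrr normr0 mulr0 normr_le0 subr_eq0 => /eqP.
have GK x : U x -> G (Phi x) = x.
  move=> Ux; have Vx : V (Phi x) by case: Ux.
  by have [UG PG] := GP _ Vx; exact: inj.
have oV : open V by exact: oball.
have oU : open U.
  rewrite openE => x [xr Vx]; apply: filterI.
    by apply: open_nbhs_nbhs; split => //; exact: (oball x0 (r / 2)).
  have cP := differentiable_continuous (smooth_on_differentiable sPhi (proj1 (Hr x (lt_trans xr r2r)))).
  by apply: (cP V); exact: open_nbhs_nbhs.
have UOm x : U x -> Om x by move=> /Ur /Hr[].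
have Vx0 : V (Phi x0) by rewrite /V /= subrr normr0 divr_gt0.
have Ux0 : U x0 by split=> //; rewrite subrr normr0.
(* A row vector u killed by the Jacobian satisfies 'D_u rem = - u, so |u| <= |u| / 2. *)
have ujac x : U x -> jac x \in unitmx.
  move=> Ux; rewrite -row_free_unit -kermx_eq0; apply/eqP/row_matrixP => i.
  rewrite row0; set u := row i _.
  have uJ : u *m jac x = 0.
    by apply/sub_kermxP; exact: row_sub.
  have [Ox /(_ u)] := Hr _ (Ur _ Ux); rewrite remE // DPhiE // uJ sub0r normrN.
  have := normr_ge0 u; move=> h1 h2; apply/eqP; rewrite -normr_le0; lra.
have dG y : V y -> differentiable G y /\ forall k, 'D_k G y = k *m invmx (jac (G y)).
  move=> Vy; have [UG PG] := GP _ Vy.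
  have cA : continuous (mulmxr (invmx (jac (G y))) : 'rV[R]_n -> 'rV[R]_n).
    exact: continuous_mulmxr.
  have [C C0 HC] := linear_lipschitz cA.
  have [] := @differentiable_boundP _ _ _ G y (mulmxr (invmx (jac (G y)))) cA; last first.
    by move=> dG dGE; split=> // k; rewrite deriveE // dGE.
  move=> e e0.
  have dP := smooth_on_differentiable sPhi (UOm _ UG).
  (* C is a Lipschitz constant of the inverse Jacobian; the 2 comes from |G (k + y) - G y| <= 2
     |k|. *)
  have e'0 : 0 < e / (2 * C) by rewrite divr_gt0 // mulr_gt0.
  have [s /= s0 Hs] := proj1 (nbhs_ballP _ _) (differentiable_bound dP e'0).
  near=> k.
  have Vk : V (k + y).
    near: k; have Vy' : nbhs (0 + y) V by rewrite add0r; exact: open_nbhs_nbhs.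
    have cy : {for (0 : 'rV[R]_n), continuous (fun k : 'rV[R]_n => k + y)}.
      by apply: continuousD; [exact: cvg_id|exact: cst_continuous].
    exact: cy Vy'.
  have [UGk PGk] := GP _ Vk.
  pose h := G (k + y) - G y.
  have hk : `|h| <= 2 * `|k|.
    by have := expand _ _ (Ur _ UGk) (Ur _ UG); rewrite PGk PG addrK.
  have hs : ball 0 s h.
    rewrite -ball_normE /= sub0r normrN (le_lt_trans hk) // -ltr_pdivlMl //.
    near: k; apply/nbhs_ballP; exists (2^-1 * s); first by rewrite /= mulr_gt0 // invr_gt0.
    by move=> k; rewrite -ball_normE /= sub0r normrN.
  have := Hs _ hs; rewrite /h /= subrK PGk PG addrK DPhiE; last exact: UOm.
  rewrite -/h => kh.
  have -> : h - k *m invmx (jac (G y)) = - ((k - h *m jac (G y)) *m invmx (jac (G y))).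
    by rewrite mulmxBl mulmxK ?ujac // opprB.
  rewrite normrN (le_trans (HC _)) //.
  apply: (@le_trans _ _ (C * (e / (2 * C) * (2 * `|k|)))).
    rewrite ler_pM2l // (le_trans kh) // ler_pM2l //.
  rewrite le_eqVlt; apply/orP; left; apply/eqP; field.
  by rewrite gt_eqF.
exists U, V, G; split; split => //.
- apply/smooth_on_rVP => // i.
  (* The class of all f \o G with f smooth on U is stable: the differential of G at y is the inverse
     Jacobian of Phi at G y, again a smooth function composed with G. *)
  apply: (@smooth_on_coind _ _ _ V (fun F => exists2 f : 'rV[R]_n -> R,
     smooth_on U f & F = f \o G)) => //; last 1 first.
    exists (fun x => x 0 i) => //.
    by move: i; apply/smooth_on_rVP => //; exact: smooth_on_id.
  + move=> _ [f sf ->] y Vy; apply: differentiable_comp; first by case: (dG y Vy).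
    by apply: (smooth_on_differentiable sf); case: (GP y Vy).
  + move=> _ v [f sf ->].
    set F' : 'rV[R]_n -> R := (fun x => \sum_j (v *m invmx (jac x)) 0 j * 'D_(frame j) f x) \o G; exists F'.
      eexists; last by reflexivity.
      apply: smooth_on_sum => // j; apply: smooth_onM => //; last exact: smooth_on_derive.
      move: j; apply/smooth_on_rVP => //; apply: smooth_on_mulmx => //.
        exact: smooth_on_cst.
      by apply: smooth_on_invmx => //; exact: smooth_on_sub sjac.
    move=> y Vy; have [dGy DGy] := dG y Vy.
    have dfy : differentiable f (G y).
      by apply: (smooth_on_differentiable sf); case: (GP y Vy).
    by rewrite derive_comp // derive_frame // DGy.
- by move=> x Ux; split; [case: Ux|exact: GK].
- move=> u; have [_ ->] := dG _ Vx0; rewrite GK //.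
  rewrite -[X in X *m invmx _](DPhi u) DPhiE // mulmxK //; exact: ujac.
Unshelve. all: by end_near. Qed.

End inverse_function.

(** * Determinants and characteristic polynomials *)

Section determinants.
Context {F : fieldType}.

(** Sylvester's identity: two block matrices multiplied in either order give block triangular
    products, whose determinants agree. *)
Lemma det_1D_mulmx m n (A : 'M[F]_(m, n)) (B : 'M[F]_(n, m)) :
  \det (1%:M + A *m B) = \det (1%:M + B *m A).
Proof.
have E1 : block_mx 1%:M (- A) B 1%:M *m block_mx 1%:M A 0 1%:M =
    block_mx 1%:M 0 B (1%:M + B *m A).
  by rewrite mulmx_block !mul1mx !mulmx1 !mulmx0 !addr0 subrr addrC.
have E2 : block_mx 1%:M A 0 1%:M *m block_mx 1%:M (- A) B 1%:M =
    block_mx (1%:M + A *m B) 0 B 1%:M.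
  by rewrite mulmx_block !mul1mx !mul0mx !mulmx1 !add0r addNr.
have := congr1 determinant E1; have := congr1 determinant E2.
rewrite !det_mulmx mulrC => ->; rewrite !det_lblock !det1 mulr1 => ->.
by rewrite mul1r.
Qed.

(** In C B C B = C B, where C B is the rank factorization of K, the full-rank factors at both ends
    cancel. *)
Lemma idempotent_base n (K : 'M[F]_n) : K *m K = K ->
  row_base K *m col_base K = 1%:M.
Proof.
move=> KK; have /row_fullP[D] := col_base_full K; have := mulmx_base K.
move: (row_base_free K); move: (\rank K) (row_base K) (col_base K) D.
move=> k B C D fB CB DC.
apply: (row_free_inj fB); rewrite mul1mx.
transitivity (D *m (C *m B) *m (C *m B)); first by rewrite !mulmxA DC mul1mx.
by rewrite CB -mulmxA KK -CB mulmxA DC mul1mx.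
Qed.

Lemma mxtrace_idempotent n (K : 'M[F]_n) : K *m K = K ->
  \tr K = (\rank K)%:R.
Proof.
move=> /idempotent_base BC.
by rewrite -{1}(mulmx_base K) mxtrace_mulC BC mxtrace1.
Qed.

Lemma idempotent_factor n k (K : 'M[F]_n) (B : 'M[F]_(k, n)) : K *m K = K ->
  row_free B -> (B == K)%MS -> exists2 A, A *m B = K & B *m A = 1%:M.
Proof.
move=> KK fB /andP[/submxP[D BD] /submxP[A KA]].
exists A => //; apply: (row_free_inj fB).
by rewrite mul1mx -mulmxA -KA {1}BD -mulmxA KK -BD.
Qed.

(* The determinant of an operator that is block triangular with respect to the
   splitting K + P = 1, the block on the range of P being scalar. *)
Lemma det_split_idempotent n k (K P Y : 'M[F]_n) (A : 'M[F]_(n, k))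
    (B : 'M[F]_(k, n)) (a c : F) :
  K + P = 1%:M -> P *m K = 0 -> A *m B = K -> B *m A = 1%:M ->
  \det (K *m (a%:M - Y) - c *: P) =
    \det (K - c *: P) * \det (a%:M - B *m Y *m A).
Proof.
move=> KP PK AB BA.
have KK : K *m K = K by rewrite -AB mulmxA -(mulmxA A) BA mulmx1.
(* Once K - c P is factored out, what remains is the identity plus A times a k by n matrix, and
   [det_1D_mulmx] reduces its determinant to size k. *)
have -> : K *m (a%:M - Y) - c *: P =
    (K - c *: P) *m (1%:M + A *m (B *m ((a - 1)%:M - Y))).
  rewrite (mulmxA A B) AB mulmxDr mulmx1 mulmxA mulmxBl -scalemxAl PK scaler0 subr0 KK.
  rewrite addrAC; congr (_ - _).
  rewrite -{2}(mulmx1 K) -mulmxDr; congr (_ *m _).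
  by apply/matrixP => i j; rewrite !mxE; case: (i == j); rewrite /= ?mulr1n ?mulr0n; ring.
rewrite det_mulmx det_1D_mulmx; congr (_ * \det _).
rewrite mulmxBr mul_mx_scalar mulmxBl -scalemxAl BA scalemx1.
by apply/matrixP => i j; rewrite !mxE; case: (i == j); rewrite /= ?mulr1n ?mulr0n; ring.
Qed.

Lemma det_split_neq0 n (K P : 'M[F]_n) (c : F) :
  K + P = 1%:M -> P *m K = 0 -> c != 0 -> \det (K - c *: P) != 0.
Proof.
move=> KP PK c0.
have PP : P *m P = P by rewrite -[RHS]mulmx1 -KP mulmxDr PK add0r.
have KPi : K *m P = 0.
  by apply: (addIr (P *m P)); rewrite -mulmxDl KP mul1mx add0r PP.
have KK : K *m K = K by rewrite -[RHS]mulmx1 -KP mulmxDr KPi addr0.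
have inv : (K - c *: P) *m (K - c^-1 *: P) = 1%:M.
  rewrite mulmxBr !mulmxBl KK -scalemxAl PK scaler0 subr0.
  rewrite -!scalemxAr KPi -scalemxAl PP scaler0 sub0r scalerA mulVf // scale1r opprK.
  exact: KP.
by rewrite -unitfE -unitmxE; case/mulmx1_unit: inv.
Qed.

Lemma char_poly_horner n (T : 'M[F]_n) a : (char_poly T).[a] = \det (a%:M - T).
Proof.
rewrite /char_poly -horner_evalE -det_map_mx; congr (\det _).
apply/matrixP => i j; rewrite !mxE /= /horner_eval.
by rewrite hornerD hornerN hornerMn hornerX hornerC.
Qed.

End determinants.

Section symmetric_operator.
Context {R : realType}.

(** The spectral theorem, reduced to the reality of the complex roots: for an eigenvector u + i v
    with eigenvalue z, self-adjointness of T for the inner product M gives Im z (|u|^2 + |v|^2) = 0.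
    Self-adjointness reads (T M)^T = T M because T acts on row vectors. *)
Lemma self_adjoint_split n (M T : 'M[R]_n) :
  (forall u : 'rV[R]_n, u != 0 -> 0 < (u *m M *m u^T) 0 0) ->
  (T *m M)^T = T *m M -> M^T = M ->
  exists s : seq R, char_poly T = \prod_(r <- s) ('X - r%:P).
Proof.
move=> posM symTM symM.
pose f := real_complex R.
have [r Hr] := closed_field_poly_normal (map_poly f (char_poly T)).
have monr : lead_coef (map_poly f (char_poly T)) = 1.
  by rewrite lead_coef_map (monicP (char_poly_monic T)) rmorph1.
rewrite monr scale1r in Hr.
have rreal z : z \in r -> z = f (complex.Re z).
  move=> zr.
  have : root (map_poly f (char_poly T)) z by rewrite Hr root_prod_XsubC.
  rewrite map_char_poly -eigenvalue_root_char => /eigenvalueP[w wT w0].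
  pose u := map_mx (@complex.Re R) w; pose v := map_mx (@complex.Im R) w.
  have uT : u *m T = complex.Re z *: u - complex.Im z *: v.
    apply/rowP => j; have := congr1 (@complex.Re R) (congr1 (fun A : 'rV_n => A 0 j) wT).
    rewrite !mxE raddf_sum /=; under eq_bigr do rewrite !mxE.
    case: z (w 0 j) {zr wT} => a b [c d] /= <-; apply: eq_bigr => k _.
    by rewrite !mxE; case: (w 0 k) => x y /=; rewrite mulr0 subr0.
  have vT : v *m T = complex.Im z *: u + complex.Re z *: v.
    apply/rowP => j; have := congr1 (@complex.Im R) (congr1 (fun A : 'rV_n => A 0 j) wT).
    rewrite !mxE raddf_sum /=; under eq_bigr do rewrite !mxE.
    case: z (w 0 j) {zr wT uT} => a b [c d] /= E; rewrite addrC -E; apply: eq_bigr => k _.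
    by rewrite !mxE; case: (w 0 k) => x y /=; rewrite mulr0 add0r.
  have sym : u *m T *m M *m v^T = (v *m T *m M *m u^T)^T.
    rewrite trmx_mul trmxK -!mulmxA; congr (_ *m _).
    by rewrite trmx_mul symTM mulmxA.
  have symuv : u *m M *m v^T = (v *m M *m u^T)^T.
    by rewrite !trmx_mul trmxK symM mulmxA.
  have im0 : complex.Im z * ((u *m M *m u^T) 0 0 + (v *m M *m v^T) 0 0) = 0.
    have := congr1 (fun A : 'M[R]_1 => A 0 0) sym; have := congr1 (fun A : 'M[R]_1 => A 0 0) symuv.
    rewrite uT vT !mulmxBl !mulmxDl -!scalemxAl !mxE => ->.
    by lra.
  have pos (x : 'rV[R]_n) : 0 <= (x *m M *m x^T) 0 0.
    have [->|x0] := eqVneq x 0; first by rewrite !mul0mx mxE.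
    exact/ltW/posM.
  have pos2 : 0 < (u *m M *m u^T) 0 0 + (v *m M *m v^T) 0 0.
    rewrite lt_neqAle addr_ge0 ?pos // andbT eq_sym paddr_eq0 ?pos //.
    apply: contra w0 => /andP[uM vM].
    have u0 : u = 0.
      apply/eqP; apply: contraTT uM => /posM; rewrite lt_neqAle eq_sym.
      by case/andP.
    have v0 : v = 0.
      apply/eqP; apply: contraTT vM => /posM; rewrite lt_neqAle eq_sym.
      by case/andP.
    apply/eqP/rowP => j; move: (congr1 (fun A : 'rV_n => A 0 j) u0).
    move: (congr1 (fun A : 'rV_n => A 0 j) v0); rewrite !mxE.
    by case: (w 0 j) => a b /= -> ->.
  move/eqP: im0; rewrite mulf_eq0 (gt_eqF pos2) orbF => /eqP.
  by case: z {zr wT uT vT} => a b /= ->.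
exists (map (@complex.Re R) r).
apply: (map_poly_inj f); rewrite Hr rmorph_prod /= big_map.
rewrite !big_seq; apply: eq_bigr => z /rreal zE.
by rewrite rmorphB /= map_polyX map_polyC /= {1}zE.
Qed.

End symmetric_operator.

Section opposite_roots.
Context {R : realType}.

Lemma horner_inj (p q : {poly R}) : (forall a, p.[a] = q.[a]) -> p = q.
Proof.
move=> pq; apply/eqP; rewrite -subr_eq0; apply/eqP.
apply: (@roots_geq_poly_eq0 _ _ (mkseq (fun i => i%:R) (size (p - q)))).
- by apply/allP => a _; rewrite /root hornerD hornerN pq subrr.
- by rewrite map_inj_uniq ?iota_uniq // => i j /eqP; rewrite eqr_nat => /eqP.
- by rewrite size_mkseq.
Qed.

Lemma char_polyN n (T : 'M[R]_n) a :
  (char_poly (- T)).[a] = (-1) ^+ n * (char_poly T).[- a].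
Proof.
rewrite !char_poly_horner -detZ; congr (\det _).
by rewrite scaleN1r opprB opprK raddfN /= opprK addrC.
Qed.

Lemma prod_XsubC_opp (s : seq R) a :
  \prod_(r <- s) ('X - r%:P).[- a] =
  (-1) ^+ size s * \prod_(r <- [seq - r | r <- s]) ('X - r%:P).[a].
Proof.
rewrite big_map; elim: s => [|r s IH]; first by rewrite !big_nil mulr1.
rewrite !big_cons /= exprS IH !hornerXsubC; ring.
Qed.

(** Replacing the variable by its opposite turns [char_poly (- T)] into the polynomial with the
    opposite roots, and a split polynomial determines its roots up to order. The signs cancel
    because s has n terms. *)
Lemma opp_roots_perm n (T : 'M[R]_n) (s : seq R) :
  char_poly T = \prod_(r <- s) ('X - r%:P) -> char_poly (- T) = char_poly T ->
  perm_eq s [seq - r | r <- s].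
Proof.
move=> Ts TN.
have sz : size s = n.
  by have := size_char_poly T; rewrite Ts size_prod_XsubC => -[].
apply: prod_XsubC_eq; apply: horner_inj => a.
rewrite -Ts -TN char_polyN Ts -sz.
by rewrite !horner_prod prod_XsubC_opp mulrA -exprMn mulrNN mulr1 expr1n mul1r.
Qed.

(** The positive terms of s serve as kappa; by symmetry the negative terms are their opposites, and
    m counts the zeros. *)
Lemma opp_perm_split (s : seq R) : perm_eq s [seq - r | r <- s] ->
  exists (kappa : seq R) (m : nat),
    perm_eq s (kappa ++ [seq - r | r <- kappa] ++ nseq m 0).
Proof.
move=> sN; pose kappa := [seq r <- s | 0 < r].
exists kappa, (count_mem 0 s).
apply/seq.permP => p; rewrite !count_cat count_map.
have posE : count (preim -%R p) kappa = count p [seq r <- s | r < 0].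
  move/seq.permP: sN => /(_ (predI p (fun r => r < 0))).
  rewrite count_map !count_filter => ->.
  by apply: eq_count => r /=; rewrite oppr_lt0.
rewrite posE !count_filter.
rewrite -[count_mem 0 s]/(count (pred1 0) s).
have -> : count p (nseq (count (pred1 0) s) 0) = count (predI p (pred1 0)) s.
  rewrite count_nseq; elim: s {sN kappa posE} => [|r s IH] /=; first by rewrite muln0.
  by rewrite mulnDr IH; case: eqVneq => [->|]; rewrite ?muln1 ?muln0 ?andbT ?andbF.
elim: s {sN kappa posE} => [|r s IH] //=.
rewrite IH; case: (ltrgtP r 0) => [r0|r0|->] /=;
  rewrite ?andbT ?andbF ?ltxx /=; case: (p _) => /=; lia.
Qed.

End opposite_roots.

(** * Calculus in a chart *)

Section matrix_calculus.
Context {R : realType} {E : normedModType R}.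
Implicit Types (x v : E).

Lemma derive_sum_fun (I : finType) (f : I -> E -> R) x v :
  (forall i, derivable (f i) x v) ->
  'D_v (fun y => \sum_i f i y) x = \sum_i 'D_v (f i) x.
Proof.
move=> df; have der : is_derive x v (\sum_i f i) (\sum_i 'D_v (f i) x).
  elim/big_ind2: _ => [|? ? ? ? ? ?|i _]; [exact: is_derive_cst|exact: is_deriveD|].
  exact: derivableP.
rewrite -[RHS](@derive_val _ _ _ _ _ _ _ der); congr ('D_v _ x).
by apply/funext => y; rewrite fct_sumE.
Qed.

Lemma differentiable_mulmx m n p (M : E -> 'M[R]_(m, n)) (N : E -> 'M[R]_(n, p)) x :
  differentiable M x -> differentiable N x -> differentiable (fun y => M y *m N y) x.
Proof.
move=> /differentiable_mxP dM /differentiable_mxP dN; apply/differentiable_mxP => i j.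
rewrite (_ : (fun _ => _) = \sum_k ((fun y => M y i k : R) * (fun y => N y k j : R))).
  by apply: differentiable_sum => k; exact: differentiableM.
by apply/funext => y; rewrite mxE fct_sumE.
Qed.

Lemma derive_mulmx m n p (M : E -> 'M[R]_(m, n)) (N : E -> 'M[R]_(n, p)) x v :
  differentiable M x -> differentiable N x ->
  'D_v (fun y => M y *m N y) x = 'D_v M x *m N x + M x *m 'D_v N x.
Proof.
move=> dM dN; have dMN := differentiable_mulmx dM dN.
have /differentiable_mxP dMij := dM; have /differentiable_mxP dNij := dN.
apply/matrixP => i j; rewrite derive_coord; last exact: diff_derivable.
rewrite (_ : (fun y => _) = fun y => \sum_k (fun y => M y i k : R) y * (fun y => N y k j : R) y);
  last by apply/funext => y; rewrite mxE.
rewrite derive_sum_fun => [|k]; last exact/diff_derivable/differentiableM.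
rewrite !mxE -big_split; apply: eq_bigr => k _ /=.
rewrite (derive_coord _ _ (@diff_derivable _ _ _ _ _ v dM)) (derive_coord _ _ (@diff_derivable _ _ _ _ _ v dN)).
rewrite [LHS](@deriveM _ _ (fun y => M y i k : R) (fun y => N y k j : R)); [|exact: diff_derivable..].
by rewrite /GRing.scale /= [LHS]addrC [X in X + _ = _]mulrC.
Qed.

Lemma differentiable_trmx m n (M : E -> 'M[R]_(m, n)) x :
  differentiable M x -> differentiable (fun y => (M y)^T) x.
Proof.
move=> /differentiable_mxP dM; apply/differentiable_mxP => i j.
rewrite (_ : (fun _ => _) = fun y => M y j i) //.
by apply/funext => y; rewrite mxE.
Qed.

Lemma derive_trmx m n (M : E -> 'M[R]_(m, n)) x v :
  differentiable M x -> 'D_v (fun y => (M y)^T) x = ('D_v M x)^T.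
Proof.
move=> dM; apply/matrixP => i j; rewrite mxE.
rewrite !derive_coord; [|exact: diff_derivable|exact/diff_derivable/differentiable_trmx].
by congr ('D_v _ x); apply/funext => y; rewrite mxE.
Qed.

Lemma derive_near_cst (V : normedModType R) (f : E -> V) (a : V) x v :
  (\near x, f x = a) -> 'D_v f x = 0.
Proof. by move=> /(@near_eq_derive _ _ _ f (cst a) x v) ->; rewrite derive_cst. Qed.

End matrix_calculus.

Section quadratic_forms.
Context {R : realType} {n : nat}.
Variable g : 'M[R]_n.
Hypothesis posg : forall u : 'rV[R]_n, u != 0 -> 0 < (u *m g *m u^T) 0 0.
Hypothesis symg : g^T = g.

Lemma posdef_ge0 (u : 'rV[R]_n) : 0 <= (u *m g *m u^T) 0 0.
Proof.
have [->|u0] := eqVneq u 0; first by rewrite !mul0mx mxE.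
exact/ltW/posg.
Qed.

Lemma posdef_eq0 (u : 'rV[R]_n) : (u *m g *m u^T) 0 0 = 0 -> u = 0.
Proof.
by move=> gu; have [//|/posg] := eqVneq u 0; rewrite gu ltxx.
Qed.

Lemma posdef_unit : g \in unitmx.
Proof.
rewrite -row_free_unit -kermx_eq0; apply/eqP/row_matrixP => i; rewrite row0.
apply: posdef_eq0; have : row i (kermx g) *m g = 0.
  by apply/sub_kermxP; exact: row_sub.
by move=> ->; rewrite mul0mx mxE.
Qed.

Lemma sym_form (u v : 'rV[R]_n) : (u *m g *m v^T) 0 0 = (v *m g *m u^T) 0 0.
Proof.
rewrite -[LHS]/((u *m g *m v^T) 0 0) -[u *m g *m v^T]trmxK mxE.
by rewrite !trmx_mul trmxK symg mulmxA.
Qed.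

Lemma posdef_cauchy_schwarz (u v : 'rV[R]_n) :
  ((u *m g *m v^T) 0 0) ^+ 2 <= (u *m g *m u^T) 0 0 * (v *m g *m v^T) 0 0.
Proof.
have [->|v0] := eqVneq v 0.
  by rewrite trmx0 mulmx0 !mul0mx !mxE expr0n mulr0.
have vv := posg v0.
set a := (u *m g *m v^T) 0 0; set d := (v *m g *m v^T) 0 0.
have := posdef_ge0 (u - (a / d) *: v).
have -> : ((u - (a / d) *: v) *m g *m (u - (a / d) *: v)^T) 0 0 =
    (u *m g *m u^T) 0 0 - a ^+ 2 / d.
  have -> : (u - (a / d) *: v)^T = u^T - (a / d) *: v^T.
    by apply/matrixP => i j; rewrite !mxE.
  rewrite !(mulmxBr, mulmxBl) -!scalemxAl -!scalemxAr !mxE.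
  have e : (v *m g *m u^T) 0 0 = a by rewrite sym_form.
  move: e; rewrite /a /d !mxE => ->; field.
  by move: vv; rewrite mxE; case: ltgtP.
by rewrite subr_ge0 ler_pdivrMr.
Qed.

End quadratic_forms.

Section determinant_continuity.
Context {R : realType} {n : nat}.

Lemma differentiable_determinant (A : 'M[R]_n) : differentiable (fun A : 'M[R]_n => \det A) A.
Proof.
have sdet : smooth_on [set: 'M[R]_n] (fun A => \det A).
  by apply: smooth_on_det; [exact: openT|apply: smooth_on_id; exact: openT].
exact: smooth_on_differentiable sdet I.
Qed.

Lemma differentiable_det (E : normedModType R) (M : E -> 'M[R]_n) x :
  differentiable M x -> differentiable (fun y => \det (M y)) x.
Proof. by move=> dM; exact: differentiable_comp dM (differentiable_determinant _). Qed.

Lemma continuous_mulmxl m p (A : 'M[R]_(m, n)) :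
  continuous (fun B : 'M[R]_(n, p) => A *m B).
Proof.
move=> B; apply: differentiable_continuous; apply: differentiable_mulmx => //.
Qed.

End determinant_continuity.

(** * The differential and the covariant Hessian of a function in a chart *)

Section hessian_definitions.
Context {R : realType} {n : nat} {N : riemannian R n}.
Variables (f : N -> R) (c : chart R N n) (x : 'rV[R]_n).

Definition dlocal : 'rV[R]_n := \row_i 'D_(frame i) (local_expr f c) x.

Definition d2local : 'M[R]_n :=
  \matrix_(i, j) 'D_(frame i) ('D_(frame j) (local_expr f c)) x.

Definition christoffel_mx : 'M[R]_n :=
  \matrix_(i, j) \sum_k christoffel c x k i j * dlocal 0 k.

(** The covariant Hessian as a bilinear form; the corresponding endomorphism, acting on row vectors,
    is [hessian *m invmx (metric c x)]. *)
Definition hessian : 'M[R]_n := d2local - christoffel_mx.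

End hessian_definitions.

Section hessian_theory.
Context {R : realType} {n : nat} {N : riemannian R n}.
Variables (f : N -> R) (c : chart R N n).
Hypotheses (sf : smooth_fun f) (ac : atlas c).

Let Om : set 'rV[R]_n := chart_img c.
Let F : 'rV[R]_n -> R := local_expr f c.
Let g : 'rV[R]_n -> 'M[R]_n := metric c.

Lemma open_chart_img : open Om.
Proof. exact: chart_img_open. Qed.

Let oOm := open_chart_img.
Hint Resolve oOm : core.

Lemma smooth_local : smooth_on Om F.
Proof. exact: sf. Qed.

Lemma local_differentiable x : Om x -> differentiable F x.
Proof. exact: smooth_on_differentiable smooth_local. Qed.

Lemma derive_local u x : Om x -> 'D_u F x = (u *m (dlocal f c x)^T) 0 0.
Proof.
move=> Ox; rewrite derive_frame; last exact: local_differentiable.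
by rewrite mxE; apply: eq_bigr => i _; rewrite !mxE.
Qed.

Lemma smooth_dlocal : smooth_on Om (dlocal f c).
Proof.
apply/smooth_on_rVP => // j; rewrite (_ : (fun _ => _) = 'D_(frame j) F).
  exact/smooth_on_derive/smooth_local.
by apply/funext => y; rewrite mxE.
Qed.

Lemma smooth_d2local : smooth_on Om (d2local f c).
Proof.
apply/smooth_on_mxP => // i j.
rewrite (_ : (fun _ => _) = 'D_(frame i) ('D_(frame j) F)).
  exact/smooth_on_derive/smooth_on_derive/smooth_local.
by apply/funext => y; rewrite mxE.
Qed.

Lemma dlocal_differentiable x : Om x -> differentiable (dlocal f c) x.
Proof. exact: smooth_on_differentiable smooth_dlocal. Qed.

Lemma d2local_differentiable x : Om x -> differentiable (d2local f c) x.
Proof. exact: smooth_on_differentiable smooth_d2local. Qed.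

Lemma d2local_sym x : Om x -> (d2local f c x)^T = d2local f c x.
Proof.
move=> Ox; apply/matrixP => i j; rewrite !mxE.
exact: smooth_on_derive_sym smooth_local.
Qed.

Lemma derive_dlocal u x : Om x -> 'D_u (dlocal f c) x = u *m d2local f c x.
Proof.
move=> Ox; rewrite derive_frame; last exact: dlocal_differentiable.
apply/rowP => j; rewrite summxE mxE; apply: eq_bigr => i _.
rewrite !mxE derive_coord; last exact/diff_derivable/dlocal_differentiable.
have -> : (fun y => dlocal f c y 0 j) = 'D_(frame j) F; last by [].
by apply/funext => y; rewrite mxE.
Qed.

(** Total symmetry of the third derivatives. In the computation of the shape operator of the focal
    variety it turns a derivative along the tangent vector X into one along the normal vector v. *)
Lemma derive_d2local_form (X Y v : 'rV[R]_n) x : Om x ->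
  (Y *m 'D_X (d2local f c) x *m v^T) 0 0 = (X *m 'D_v (d2local f c) x *m Y^T) 0 0.
Proof.
move=> Ox.
have [T [D2 s1 s2]] : exists T : 'I_n -> 'I_n -> 'I_n -> R,
  [/\ forall u i j, 'D_u (d2local f c) x i j = \sum_k u 0 k * T k i j,
      forall i j k, T k i j = T i k j & forall i j k, T k i j = T k j i].
  exists (fun k i j => 'D_(frame k) ('D_(frame i) ('D_(frame j) F)) x); split.
  - move=> u i j; rewrite derive_frame; last exact: d2local_differentiable.
    rewrite summxE; apply: eq_bigr => k _; rewrite mxE derive_coord.
      have -> : (fun y => d2local f c y i j) = 'D_(frame i) ('D_(frame j) F); last by [].
      by apply/funext => y; rewrite mxE.
    exact/diff_derivable/d2local_differentiable.
  - move=> i j k.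
    exact: (smooth_on_derive_sym _ _ oOm Ox (smooth_on_derive _ smooth_local)).
  - move=> i j k; apply: near_eq_derive; near=> y.
    apply: (smooth_on_derive_sym _ _ oOm _ smooth_local).
    by near: y; exact: open_nbhs_nbhs.
have E (A B C : 'rV[R]_n) : (A *m 'D_B (d2local f c) x *m C^T) 0 0 =
    \sum_j \sum_i \sum_k A 0 i * B 0 k * C 0 j * T k i j.
  rewrite mxE; apply: eq_bigr => j _; rewrite mxE big_distrl; apply: eq_bigr => i _ /=.
  rewrite D2 big_distrr big_distrl; apply: eq_bigr => k _ /=; rewrite mxE; ring.
rewrite !E [LHS]exchange_big; apply: eq_bigr => i _ /=.
rewrite [LHS]exchange_big; apply: eq_bigr => k _ /=; apply: eq_bigr => j _.
rewrite (s2 i j k) (s1 j i k); ring.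
Unshelve. all: by end_near. Qed.

Lemma metric_differentiable x : Om x -> differentiable g x.
Proof. exact: smooth_on_differentiable (metric_smooth ac). Qed.

Lemma metric_tr x : Om x -> (g x)^T = g x.
Proof. by move=> Ox; apply: Defs.metric_sym. Qed.

Lemma metric_posdef x (u : 'rV[R]_n) : Om x -> u != 0 -> 0 < (u *m g x *m u^T) 0 0.
Proof. by move=> Ox; apply: metric_pos. Qed.

Lemma metric_unit x : Om x -> g x \in unitmx.
Proof. by move=> Ox; apply: posdef_unit => u; exact: metric_posdef. Qed.

Lemma smooth_invmetric : smooth_on Om (fun x => invmx (g x)).
Proof. by apply: smooth_on_invmx => //; [exact: metric_unit|exact: metric_smooth]. Qed.

Lemma derive_metric_tr x u : Om x -> ('D_u g x)^T = 'D_u g x.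
Proof.
move=> Ox; rewrite -derive_trmx; last exact: metric_differentiable.
apply: near_eq_derive; near=> y; apply: metric_tr.
by near: y; exact: open_nbhs_nbhs.
Unshelve. all: by end_near. Qed.

Lemma derive_metric_sym x u i j : Om x -> 'D_u g x i j = 'D_u g x j i.
Proof. by move=> Ox; rewrite -{1}(derive_metric_tr u Ox) mxE. Qed.

Lemma smooth_christoffel k i j : smooth_on Om (fun x => christoffel c x k i j).
Proof.
have sD a b d : smooth_on Om (fun x => 'D_(frame a) (metric c) x b d : R).
  have := smooth_on_derive (frame a) (metric_smooth ac).
  by move=> /smooth_on_mxP; apply; exact: chart_img_open.
apply: smooth_onM => //; first exact: smooth_on_cst.
apply: smooth_on_sum => // l; apply: smooth_onM => //.
  by move: k l; apply/smooth_on_mxP => //; exact: smooth_invmetric.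
by apply: smooth_onB => //; apply: smooth_onD => //; exact: sD.
Qed.

Lemma smooth_hessian : smooth_on Om (hessian f c).
Proof.
apply: smooth_on_addmx => //; first exact: smooth_d2local.
apply/smooth_on_mxP => // i j.
rewrite (_ : (fun _ => _) =
    fun x => - \sum_k christoffel c x k i j * dlocal f c x 0 k); last first.
  by apply/funext => y; rewrite !mxE.
apply: smooth_onN => //; apply: smooth_on_sum => // k; apply: smooth_onM => //.
  exact: smooth_christoffel.
by move: k; apply/smooth_on_rVP => //; exact: smooth_dlocal.
Qed.

Lemma hessian_differentiable x : Om x -> differentiable (hessian f c) x.
Proof. exact: smooth_on_differentiable smooth_hessian. Qed.

Lemma smooth_grad : smooth_on Om (grad f c).
Proof. by apply: smooth_on_mulmx => //; [exact: smooth_dlocal|exact: smooth_invmetric]. Qed.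

Lemma grad_differentiable x : Om x -> differentiable (grad f c) x.
Proof. exact: smooth_on_differentiable smooth_grad. Qed.

Lemma grad_metric x : Om x -> grad f c x *m g x = dlocal f c x.
Proof. by move=> Ox; rewrite mulmxKV // metric_unit. Qed.

Lemma grad_eq0 x : Om x -> (grad f c x = 0) <-> (dlocal f c x = 0).
Proof.
move=> Ox; split=> [y0|d0]; first by rewrite -grad_metric // y0 mul0mx.
by rewrite /grad -/(dlocal f c x) d0 mul0mx.
Qed.

(** Contracted with df, the inverse metric in the Christoffel symbols raises the index of df and
    leaves the gradient. *)
Lemma christoffel_mxE x i j : Om x ->
  christoffel_mx f c x i j = 2^-1 * \sum_l grad f c x 0 l *
    ('D_(frame i) g x j l + 'D_(frame j) g x i l - 'D_(frame l) g x i j).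
Proof.
move=> Ox; rewrite mxE; under eq_bigr do rewrite /christoffel -mulrA big_distrl /=.
rewrite -big_distrr exchange_big /=; congr (_ * _); apply: eq_bigr => l _.
rewrite [grad _ _ _ _ _]mxE big_distrl; apply: eq_bigr => k _ /=.
rewrite -[invmx (g x) k l]/(invmx (g x) k l).
rewrite -/(dlocal f c x) mulrAC; congr (_ * _); exact: mulrC.
Qed.

Lemma christoffel_mx_tr x : Om x -> (christoffel_mx f c x)^T = christoffel_mx f c x.
Proof.
move=> Ox; apply/matrixP => i j; rewrite mxE !christoffel_mxE //; congr (_ * _).
apply: eq_bigr => l _; congr (_ * _).
rewrite [X in X - _]addrC; apply: (congr1 (fun z => _ - z)).
exact: derive_metric_sym.
Qed.

Lemma hessian_tr x : Om x -> (hessian f c x)^T = hessian f c x.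
Proof. by move=> Ox; rewrite linearB /= d2local_sym // christoffel_mx_tr. Qed.

Lemma christoffel_form_mul x (u v d : 'rV[R]_n) :
  (christoffel_form c x u v *m d^T) 0 0 =
  (u *m (\matrix_(i, j) \sum_k christoffel c x k i j * d 0 k) *m v^T) 0 0.
Proof.
rewrite !mxE; under eq_bigr do rewrite mxE big_distrl /=.
rewrite exchange_big /=; under [RHS]eq_bigr do rewrite mxE big_distrl /=.
rewrite [RHS]exchange_big; apply: eq_bigr => i _ /=.
under eq_bigr do rewrite big_distrl /=.
rewrite exchange_big; apply: eq_bigr => j _ /=.
rewrite !mxE big_distrr big_distrl; apply: eq_bigr => k _ /=; rewrite !mxE; ring.
Qed.

Lemma christoffel_form_dlocal x (u v : 'rV[R]_n) :
  (christoffel_form c x u v *m (dlocal f c x)^T) 0 0 =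
  (u *m christoffel_mx f c x *m v^T) 0 0.
Proof. exact: christoffel_form_mul. Qed.

(** Of the three derivatives of the metric, two cancel by antisymmetry when contracted twice with
    the gradient. *)
Lemma grad_christoffel_mx x k : Om x ->
  (grad f c x *m christoffel_mx f c x) 0 k =
  2^-1 * (grad f c x *m 'D_(frame k) g x *m (grad f c x)^T) 0 0.
Proof.
move=> Ox; rewrite !mxE; set y := grad f c x.
under eq_bigr do rewrite christoffel_mxE // mulrCA.
rewrite -big_distrr /=; congr (_ * _).
transitivity (\sum_i \sum_l y 0 i * y 0 l * 'D_(frame k) g x i l); last first.
  rewrite exchange_big; apply: eq_bigr => l _; rewrite !mxE big_distrl.
  by apply: eq_bigr => i _ /=; ring.
transitivity (\sum_i \sum_l (y 0 i * y 0 l * 'D_(frame k) g x i l +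
  (y 0 i * y 0 l * 'D_(frame i) g x k l - y 0 i * y 0 l * 'D_(frame l) g x i k))).
  by apply: eq_bigr => i _; rewrite big_distrr; apply: eq_bigr => l _ /=; ring.
transitivity (\sum_i \sum_l y 0 i * y 0 l * 'D_(frame k) g x i l +
  (\sum_i \sum_l y 0 i * y 0 l * 'D_(frame i) g x k l -
   \sum_i \sum_l y 0 i * y 0 l * 'D_(frame l) g x i k)).
  rewrite -sumrB -big_split; apply: eq_bigr => i _ /=.
  by rewrite -sumrB -big_split.
rewrite [X in _ - X]exchange_big /= -[RHS]addr0; congr (_ + _).
rewrite -sumrB big1 // => i _; rewrite -sumrB big1 // => l _.
have -> : 'D_(frame i) g x k l = 'D_(frame i) g x l k by exact: derive_metric_sym.
rewrite [y 0 l * y 0 i]mulrC; exact: subrr.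
Qed.

End hessian_theory.

Lemma derive_scal1 {R : realType} (V : normedModType R) (b : R -> V) (t a : R) :
  differentiable b t -> 'D_a b t = a *: 'D_1 b t.
Proof.
move=> db; rewrite !deriveE // -[in LHS](mulr1 a).
by rewrite -[a * 1]/(a *: (1 : R)) linearZ.
Qed.

Lemma norm_form_le {R : realType} n (A : 'M[R]_n) (u v : 'rV[R]_n) :
  `|(u *m A *m v^T) 0 0| <= n%:R ^+ 2 * `|A| * `|u| * `|v|.
Proof.
have le_mx i j : `|A i j| <= `|A|.
  by rewrite [leRHS]/Num.Def.normr /= mx_normrE; exact: (le_bigmax _ _ (i, j)).
rewrite mxE (le_trans (ler_norm_sum _ _ _)) //.
have H j : `|(u *m A) 0 j * v^T j 0| <= n%:R * `|A| * `|u| * `|v|.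
  rewrite normrM mxE [v^T j 0]mxE ler_pM ?coord_le_norm // (le_trans (ler_norm_sum _ _ _)) //.
  apply: (@le_trans _ _ (\sum_(k < n) `|A| * `|u|)).
    by apply: ler_sum => k _; rewrite normrM mulrC ler_pM ?coord_le_norm.
  by rewrite sumr_const card_ord -[leLHS]mulr_natl mulrA.
apply: le_trans (ler_sum _ (fun j _ => H j)) _.
by rewrite sumr_const card_ord -[leLHS]mulr_natl expr2 !mulrA.
Qed.

(** * Transnormal functions *)

Section transnormal_chart.
Context {R : realType} {n : nat} {N : riemannian R n}.
Variables (f : N -> R) (c : chart R N n).
Hypotheses (sf : smooth_fun f) (ac : atlas c).
Variables (b : R -> R) (J : set R).
Hypotheses (oJ : open J) (sb : smooth_on J b).
Hypothesis FJ : forall x, chart_img c x -> J (local_expr f c x).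
Hypothesis bE : forall x, chart_img c x -> grad_norm2 f c x = b (local_expr f c x).

Let Om : set 'rV[R]_n := chart_img c.
Let F : 'rV[R]_n -> R := local_expr f c.
Let g : 'rV[R]_n -> 'M[R]_n := metric c.
Let oOm : open Om := open_chart_img (c := c).
Hint Resolve oOm : core.

Let b_differentiable x : Om x -> differentiable b (F x).
Proof. by move=> /FJ; exact: smooth_on_differentiable. Qed.

Let Db_differentiable x : Om x -> differentiable ('D_1 b) (F x).
Proof. by move=> /FJ; apply: smooth_on_differentiable; exact: smooth_on_derive. Qed.

(* The gradient is an eigenvector of the Hessian: differentiate |grad f|^2 = b(f). *)
Lemma grad_hessian x : Om x ->
  grad f c x *m hessian f c x = (2^-1 * 'D_1 b (F x)) *: dlocal f c x.
Proof.
move=> Ox; apply/rowP => k; set y := grad f c x.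
have dy := grad_differentiable sf ac Ox; have dg := metric_differentiable ac Ox.
have dF := local_differentiable sf ac Ox.
pose q z := grad f c z *m g z *m (grad f c z)^T.
have Dyg : 'D_(frame k) (grad f c) x *m g x =
    frame k *m d2local f c x - y *m 'D_(frame k) g x.
  rewrite -(derive_dlocal sf ac (frame k) Ox).
  have -> : 'D_(frame k) (dlocal f c) x = 'D_(frame k) (fun z => grad f c z *m g z) x.
    apply: near_eq_derive; near=> z; apply/esym/grad_metric => //.
    by near: z; exact: open_nbhs_nbhs.
  by rewrite derive_mulmx // addrK.
have Dq : 'D_(frame k) q x 0 0 =
    2 * (frame k *m d2local f c x *m y^T) 0 0 - (y *m 'D_(frame k) g x *m y^T) 0 0.
  have dyg : differentiable (fun z => grad f c z *m g z) x by exact: differentiable_mulmx.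
  have dyT := differentiable_trmx dy.
  rewrite /q derive_mulmx // derive_mulmx // derive_trmx //.
  rewrite Dyg subrK.
  have -> : y *m g x *m ('D_(frame k) (grad f c) x)^T =
      ((frame k *m d2local f c x - y *m 'D_(frame k) g x) *m y^T)^T.
    rewrite -Dyg [(_ *m y^T)^T]trmx_mul trmxK [(_ *m g x)^T]trmx_mul.
    by rewrite (metric_tr ac Ox) mulmxA.
  rewrite -/y mulmxBl; move: (_ *m d2local f c x *m y^T) (y *m _ *m y^T) => A B.
  rewrite !mxE; ring.
have qE : 'D_(frame k) q x 0 0 = 'D_(frame k) F x * 'D_1 b (F x).
  rewrite derive_coord; last first.
    apply: diff_derivable; apply: differentiable_mulmx; last exact: differentiable_trmx.
    exact: differentiable_mulmx.
  have -> : 'D_(frame k) (fun z => q z 0 0 : R) x = 'D_(frame k) (b \o F) x.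
    apply: near_eq_derive; near=> z; rewrite -[LHS]/(grad_norm2 f c z); apply: bE.
    by near: z; exact: open_nbhs_nbhs.
  have db := b_differentiable Ox.
  by rewrite (derive_comp _ dF db) (derive_scal1 ('D_(frame k) F x) db).
have Fk : 'D_(frame k) F x = dlocal f c x 0 k by rewrite mxE.
(* The metric derivative left over in [Dq] is twice the Christoffel term of the Hessian, so that
   [Dq] is twice the k-th component of grad f . Hess f. *)
rewrite mulmxBr [LHS]mxE [X in _ + X]mxE grad_christoffel_mx // [RHS]mxE.
rewrite -/y -/g.
have -> : (y *m d2local f c x) 0 k = (frame k *m d2local f c x *m y^T) 0 0.
  by rewrite (sym_form (d2local_sym sf ac Ox)) trmx_delta -colE [RHS]mxE.
move: qE; rewrite Dq Fk; lra.
Unshelve. all: by end_near. Qed.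

Lemma grad_norm2_eq0 x : Om x -> b (F x) = 0 -> dlocal f c x = 0.
Proof.
move=> Ox bF; apply/(grad_eq0 f ac Ox); apply: (posdef_eq0 (g := g x)).
  by move=> u; exact: metric_posdef.
by rewrite -[LHS]/(grad_norm2 f c x) bE.
Qed.

Lemma grad_norm2_crit x : Om x -> dlocal f c x = 0 -> b (F x) = 0.
Proof.
move=> Ox /(grad_eq0 f ac Ox) y0; rewrite -bE // /grad_norm2 y0 /inner !mul0mx.
by rewrite mxE.
Qed.

Section critical_point.
Variable x : 'rV[R]_n.
Hypotheses (Ox : Om x) (dF0 : dlocal f c x = 0).
Let y0 : grad f c x = 0. Proof. exact/grad_eq0. Qed.

Lemma crit_hessian : hessian f c x = d2local f c x.
Proof.
rewrite /hessian (_ : christoffel_mx f c x = 0) ?subr0 //.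
by apply/matrixP => i j; rewrite !mxE big1 // => k _; rewrite dF0 mxE mulr0.
Qed.

Lemma derive_grad_crit u : 'D_u (grad f c) x = u *m d2local f c x *m invmx (g x).
Proof.
have dd := dlocal_differentiable sf ac Ox.
rewrite -[grad f c]/(fun z => dlocal f c z *m invmx (g z)) derive_mulmx //.
  by rewrite dF0 mul0mx addr0 derive_dlocal.
exact: smooth_on_differentiable (smooth_invmetric ac) Ox.
Qed.

(** Derivative of [grad_hessian] at a critical point: grad f and df vanish there, so in both
    products only the term that differentiates this factor survives. When b' is not zero, the
    relation says that a multiple of the Hessian endomorphism is a projection. *)
Lemma crit_d2local_sq : d2local f c x *m invmx (g x) *m d2local f c x =
  (2^-1 * 'D_1 b (F x)) *: d2local f c x.
Proof.
apply/row_matrixP => k; rewrite !rowE; set u := delta_mx 0 k.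
rewrite !mulmxA -derive_grad_crit -scalemxAr.
have dy := grad_differentiable sf ac Ox; have dH := hessian_differentiable sf ac Ox.
have := derive_mulmx u dy dH; rewrite y0 mul0mx addr0 crit_hessian => <-.
have -> : 'D_u (fun z => grad f c z *m hessian f c z) x =
    'D_u (fun z => (2^-1 * 'D_1 b (F z)) *: dlocal f c z) x.
  apply: near_eq_derive; near=> z; apply: grad_hessian.
  by near: z; exact: open_nbhs_nbhs.
have dd := dlocal_differentiable sf ac Ox.
have dF := local_differentiable sf ac Ox.
have dDb : differentiable (fun z => 2^-1 * 'D_1 b (F z) : R) x.
  apply: (@differentiableM _ _ (cst 2^-1) ('D_1 b \o F)) => //.
  by apply: differentiable_comp => //; exact: Db_differentiable.
have ddj j : differentiable (fun z => dlocal f c z 0 j : R) x.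
  by move: dd => /differentiable_rVP.
rewrite -(derive_dlocal sf ac u Ox); apply/rowP => j; rewrite mxE.
rewrite !derive_coord; last 2 first.
- exact: diff_derivable.
- apply/diff_derivable/differentiable_rVP => i.
  rewrite (_ : (fun _ => _) = (fun z => 2^-1 * 'D_1 b (F z) : R) * (fun z => dlocal f c z 0 i : R)).
    exact: differentiableM.
  by apply/funext => z; rewrite mxE.
rewrite (_ : (fun z => _) = (fun z => 2^-1 * 'D_1 b (F z) : R) * (fun z => dlocal f c z 0 j : R));
  last by apply/funext => z; rewrite mxE.
rewrite deriveM; [|exact: diff_derivable|exact: diff_derivable].
by rewrite dF0 mxE scale0r addr0.
Unshelve. all: by end_near. Qed.

End critical_point.

(** Taylor's bound at a double zero of b: the mean value theorem writes b t as (t - t0) times a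
    value of b', and b' is O(t - t0) since it is differentiable. *)
Let quadratic_bound x : Om x -> b (F x) = 0 -> 'D_1 b (F x) = 0 ->
  exists2 C, 0 <= C &
    exists2 r, 0 < r & forall t, `|t - F x| < r -> `|b t| <= C * (t - F x) ^+ 2.
Proof.
move=> Ox b0 b'0; set t0 := F x.
have dDb := Db_differentiable Ox.
set k := 'D_1 ('D_1 b) t0; exists (1 + `|k|); first by rewrite addr_ge0.
have nJ : \forall t \near t0, J t by apply: open_nbhs_nbhs; split => //; exact: FJ.
have [r1 /= r10 H1] := proj1 (nbhs_ballP _ _) nJ.
have [r2 /= r20 H2] := proj1 (nbhs_ballP _ _) (differentiable_bound dDb (ltr01 : 0 < 1)).
exists (Num.min r1 r2) => [|t]; first by rewrite lt_min r10.
rewrite lt_min => /andP[tr1 tr2].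
have dbt (s : R) : 0 <= s <= 1 -> differentiable b (t0 + s *: (t - t0)).
  move=> /andP[s0 s1]; apply: (smooth_on_differentiable sb); apply: H1.
  rewrite -ball_normE /= opprD addrA subrr sub0r normrN normrM (ger0_norm s0).
  by apply: le_lt_trans tr1; rewrite ler_piMl.
have [s /andP[s0 s1]] := mvt_line dbt.
rewrite subrKC [b t0]b0 subr0 => ->.
have dbs : differentiable b (t0 + s *: (t - t0)) by apply: dbt; rewrite !ltW.
rewrite (derive_scal1 _ dbs) normrM expr2.
have -> : (t - t0) * (t - t0) = `|t - t0| * `|t - t0| by rewrite -normrM ger0_norm // -expr2 sqr_ge0.
rewrite mulrCA ler_wpM2l //.
set h := s *: (t - t0); have hle : `|h| <= `|t - t0|.
  by rewrite normrM (gtr0_norm s0) ler_piMl // ltW.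
have := H2 h; rewrite -ball_normE /= sub0r normrN => /(_ (le_lt_trans hle tr2)).
rewrite (derive_scal1 h dDb) -/t0 -/k [X in _ - X - _]b'0 subr0 mul1r [h + t0]addrC => Hh.
have -> : 'D_1 b (t0 + h) = ('D_1 b (t0 + h) - h *: k) + h *: k by rewrite subrK.
rewrite (le_trans (ler_normD _ _)) // mulrDl mul1r lerD //.
  exact: le_trans Hh hle.
by rewrite normrM mulrC ler_wpM2l.
Qed.

(* If b vanished to second order at the critical value then f would be constant
   near x: along a short segment, |d(f - f(x))| <= |f - f(x)| / 2. *)
Lemma flat_critical_value x : Om x -> b (F x) = 0 -> 'D_1 b (F x) = 0 ->
  \forall y \near x, F y = F x.
Proof.
move=> Ox b0 b'0; set t0 := F x.
have [C1 C10 [r r0 Hb]] := quadratic_bound Ox b0 b'0.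
have cF := differentiable_continuous (local_differentiable sf ac Ox).
have cg := differentiable_continuous (metric_differentiable ac Ox).
pose C2 := n%:R ^+ 2 * (`|g x| + 1); pose D := C1 * C2.
have C20 : 0 <= C2 by rewrite mulr_ge0 // ?sqr_ge0 // addr_ge0.
have D0 : 0 <= D by rewrite mulr_ge0.
have nearx : \forall y \near x, [/\ Om y, `|F y - t0| < r & `|g y| <= `|g x| + 1].
  near=> y; split.
  - by near: y; exact: open_nbhs_nbhs.
  - by near: y; move/cvgrPdist_lt: cF => /(_ _ r0); apply: filterS => y; rewrite distrC.
  - near: y; move/cvgrPdist_le: cg => /(_ _ ltr01); apply: filterS => y gy.
    rewrite -[g y](subrK (g x)) addrC (le_trans (ler_normD _ _)) // lerD2l.
    by rewrite distrC.
have [e /= e0 He] := proj1 (nbhs_ballP _ _) nearx.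
(* For |u| <= d, the Cauchy-Schwarz inequality bounds |df(u)|^2 by C2 d^2 times C1 (F - t0)^2, and
   this d makes D d^2 <= 1/4. *)
pose d := (2 * (1 + D))^-1.
have d0 : 0 < d by rewrite invr_gt0 mulr_gt0 // ltr_pwDl.
have dD : D * d ^+ 2 <= 2^-1 ^+ 2.
  rewrite /d invfM exprMn mulrCA ler_piMr ?sqr_ge0 // exprVn ler_pdivrMr; last first.
    by rewrite exprn_gt0 // ltr_pwDl.
  by rewrite mul1r; nra.
have slope y u : ball x e y -> `|u| <= d -> `|'D_u F y| <= 2^-1 * `|F y - t0|.
  move=> /He[Oy Fy gy] ud.
  have -> : 2^-1 * `|F y - t0| = `|2^-1 * (F y - t0)|.
    by rewrite normrM ger0_norm // invr_ge0.
  rewrite -ler_sqr ?nnegrE // -normrX -[in leRHS]normrX ger0_norm ?sqr_ge0 //.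
  rewrite [leRHS]ger0_norm ?sqr_ge0 //.
  rewrite (derive_local sf ac) // -(grad_metric f ac Oy).
  have -> : (u *m (grad f c y *m metric c y)^T) 0 0 = (u *m g y *m (grad f c y)^T) 0 0.
    by rewrite trmx_mul (metric_tr ac Oy) mulmxA.
  apply: le_trans (posdef_cauchy_schwarz (fun u => @metric_posdef _ _ _ _ ac y u Oy) (metric_tr ac Oy) u (grad f c y)) _.
  rewrite -[X in _ * X <= _]/(grad_norm2 f c y) bE //.
  apply: (@le_trans _ _ (C2 * d ^+ 2 * (C1 * (F y - t0) ^+ 2))).
    have bnn : 0 <= b (F y) by rewrite -bE //; apply: posdef_ge0 => w; exact: metric_posdef.
    rewrite ler_pM //.
    - by apply: posdef_ge0 => w; exact: metric_posdef.
    - apply: le_trans (ler_norm _) _; apply: le_trans (norm_form_le _ _ _) _.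
      rewrite -mulrA expr2 ler_pM ?mulr_ge0 // ?sqr_ge0 //.
        by rewrite /C2 ler_wpM2l // sqr_ge0.
      by rewrite ler_pM.
    - by apply: le_trans (ler_norm _) _; exact: Hb.
  rewrite exprMn mulrA ler_wpM2r ?sqr_ge0 //.
  by rewrite mulrAC [C2 * C1]mulrC.
have : \forall y \near x, `|y - x| < Num.min e d.
  have m0 : 0 < Num.min e d by rewrite lt_min e0.
  apply/nbhs_ballP; exists (Num.min e d) => // y.
  by rewrite -ball_normE /= distrC.
apply: filterS => y; rewrite lt_min => /andP[ye yd].
set u := y - x.
have inb (s : R) : 0 <= s <= 1 -> ball x e (x + s *: u).
  move=> /andP[s0 s1]; rewrite -ball_normE /= opprD addrA subrr sub0r normrN normrZ ger0_norm //.
  by apply: le_lt_trans ye; rewrite ler_piMl.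
have dFs (s : R) : 0 <= s <= 1 -> differentiable F (x + s *: u).
  by move=> /inb/He[Oy _ _]; exact: local_differentiable.
pose psi (s : R) := `|F (x + s *: u) - t0|.
have cpsi : {within `[0, 1], continuous psi}.
  apply: continuous_in_subspaceT => s; rewrite inE /= in_itv /= => s01.
  have /is_derive_line[ds _] := dFs s s01.
  have /differentiable_continuous cs : differentiable (fun s : R => F (x + s *: u)) s.
    exact/derivable1_diffP.
  by apply: cvg_norm; apply: cvgB; [exact: cs|exact: cvg_cst].
(* Where |F - t0| is maximal on the segment, the mean value theorem and [slope] bound it by half of
   another of its values, so the maximum is 0. *)
have [s /[!in_itv] /= s01 smax] := EVT_max ler01 cpsi.
have [s0 s1] := andP s01.
have [|t /andP[t0' t1]] := @mvt_line _ _ F x (s *: u).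
  move=> t /andP[t0' t1]; rewrite scalerA; apply: dFs.
  by rewrite mulr_ge0 // mulr_ile1.
rewrite scalerA => E1.
have ts01 : 0 <= t * s <= 1 by rewrite mulr_ge0 ?(ltW t0') // mulr_ile1 // ltW.
have psi_s : psi s <= 2^-1 * psi (t * s).
  rewrite /psi -/t0 E1; apply: slope; first exact: inb.
  by rewrite normrZ ger0_norm // (le_trans (ler_piMl _ _)) // ltW.
have psi0 : psi s <= 0.
  have := smax (t * s); rewrite in_itv /= => /(_ ts01); lra.
have : psi 1 <= 0.
  by apply: le_trans (smax 1 _) psi0; rewrite in_itv /= ler01 lexx.
by rewrite /psi scale1r /u subrKC normr_le0 subr_eq0 => /eqP.
Unshelve. all: by end_near. Qed.

End transnormal_chart.

Section curves.
Context {R : realType} {n : nat}.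

(** The image of a coordinate line under a local parametrization, cut down to where it is defined:
    the source of the curves that [tangent] asks for. *)
Lemma smooth_line (V : set 'rV[R]_n) (G : 'rV[R]_n -> 'rV[R]_n) z u :
  open V -> V z -> smooth_on V G ->
  exists2 e : R, 0 < e & [/\ smooth_on (ball (0 : R) e) (fun s : R => G (z + s *: u)),
    forall s, ball (0 : R) e s -> V (z + s *: u) &
    'D_1 (fun s : R => G (z + s *: u)) 0 = 'D_u G z].
Proof.
move=> oV Vz sG.
have sL e : smooth_on (ball (0 : R) e) (fun s : R => z + s *: u).
  apply: smooth_on_addmx; first exact: ball_open.
    exact: smooth_on_cst.
  apply: smooth_on_scalemx; first exact: ball_open.
    by apply: smooth_on_id; exact: ball_open.
  exact: smooth_on_cst.
have cL : {for 0, continuous (fun s : R => z + s *: u)}.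
  apply: differentiable_continuous; apply: (smooth_on_differentiable (sL 1)).
  exact: ballxx.
have : \forall s \near (0 : R), V (z + s *: u).
  apply: cL; apply: open_nbhs_nbhs; split => //.
  by rewrite scale0r addr0.
move=> /nbhs_ballP[e e0 He]; exists e; first exact: e0.
split; [|exact: He|].
  apply: (smooth_on_comp_mx _ oV (sL e)) => //; exact: ball_open.
have dG : differentiable G (z + 0 *: u).
  by apply: (smooth_on_differentiable sG); rewrite scale0r addr0.
have := is_derive_line dG; rewrite scale0r addr0 => dl.
exact: (@derive_val _ _ _ _ _ _ _ dl).
Qed.

End curves.

(** * Local structure of a critical level *)

Section focal_chart.
Context {R : realType} {n : nat} {N : riemannian R n}.
Variables (f : N -> R) (c : chart R N n).
Hypotheses (sf : smooth_fun f) (ac : atlas c).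
Variables (b : R -> R) (J : set R).
Hypothesis sb : smooth_on J b.
Hypothesis FJ : forall x, chart_img c x -> J (local_expr f c x).
Hypothesis bE : forall x, chart_img c x -> grad_norm2 f c x = b (local_expr f c x).

Let Om : set 'rV[R]_n := chart_img c.
Let F : 'rV[R]_n -> R := local_expr f c.
Let g : 'rV[R]_n -> 'M[R]_n := metric c.
Let oOm : open Om := open_chart_img (c := c).
Hint Resolve oOm : core.

Variables (x : 'rV[R]_n) (t0 : R).
Hypotheses (Ox : Om x) (Fx : F x = t0) (bt0 : b t0 = 0).
Let beta := 'D_1 b t0.
Hypothesis beta0 : beta != 0.

Let H : 'M[R]_n := d2local f c x.

(** The Hessian as an endomorphism of row vectors, divided by beta / 2, its only possible non-zero
    eigenvalue. It is idempotent by [crit_d2local_sq] and self-adjoint for the metric by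
    [metric_normal_proj_tr]. *)
Definition normal_proj : 'M[R]_n := (2 / 'D_1 b t0) *: (d2local f c x *m invmx (metric c x)).
Definition tangent_proj : 'M[R]_n := 1%:M - normal_proj.

Let Pi := normal_proj.
Let K := tangent_proj.

Lemma focal_crit y : Om y -> F y = t0 -> dlocal f c y = 0.
Proof. by move=> Oy Fy; apply: (grad_norm2_eq0 ac bE) => //; rewrite -/F Fy. Qed.

Let dF0 : dlocal f c x = 0. Proof. exact: focal_crit. Qed.
Let g_unit : g x \in unitmx. Proof. exact: metric_unit. Qed.
Let g_tr : (g x)^T = g x. Proof. exact: metric_tr. Qed.
Let H_tr : H^T = H. Proof. exact: d2local_sym. Qed.

Let HgH : H *m invmx (g x) *m H = (2^-1 * beta) *: H.
Proof. by have := crit_d2local_sq sf ac sb FJ bE Ox dF0; rewrite -/F Fx. Qed.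

Let cbeta : 2 / beta * (2^-1 * beta) = 1.
Proof. by field. Qed.

Let cbeta' : 2^-1 * beta * (2 / beta) = 1.
Proof. by field. Qed.

Lemma normal_proj_d2local : Pi *m H = H.
Proof. by rewrite -scalemxAl HgH scalerA cbeta scale1r. Qed.

Lemma normal_proj_idem : Pi *m Pi = Pi.
Proof.
by rewrite {2}/Pi /normal_proj -scalemxAr mulmxA normal_proj_d2local.
Qed.

Lemma normal_proj_metric : Pi *m g x = (2 / beta) *: H.
Proof. by rewrite -scalemxAl mulmxKV. Qed.

Lemma d2local_proj : H = (2^-1 * beta) *: (Pi *m g x).
Proof. by rewrite normal_proj_metric scalerA cbeta' scale1r. Qed.

Lemma metric_normal_proj_tr : g x *m Pi^T = Pi *m g x.
Proof.
rewrite normal_proj_metric /Pi /normal_proj linearZ /= trmx_mul H_tr trmx_inv g_tr.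
by rewrite -scalemxAr mulmxA mulmxV // mul1mx.
Qed.

Lemma tangent_proj_normal : K *m Pi = 0.
Proof. by rewrite mulmxBl mul1mx normal_proj_idem subrr. Qed.

Lemma normal_proj_tangent : Pi *m K = 0.
Proof. by rewrite mulmxBr mulmx1 normal_proj_idem subrr. Qed.

Lemma tangent_proj_idem : K *m K = K.
Proof. by rewrite {1}/K mulmxBl mul1mx normal_proj_tangent subr0. Qed.

Lemma tangent_normal_proj : K + Pi = 1%:M.
Proof. by rewrite subrK. Qed.

Lemma metric_tangent_proj_tr : g x *m K^T = K *m g x.
Proof.
by rewrite linearB /= trmx1 mulmxBr mulmxBl mulmx1 mul1mx metric_normal_proj_tr.
Qed.

Lemma tangent_proj_d2local : K *m H = 0.
Proof. by rewrite mulmxBl mul1mx normal_proj_d2local subrr. Qed.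

Lemma d2local_kernel (u : 'rV[R]_n) : (u *m H = 0) <-> (u *m Pi = 0).
Proof.
split=> [uH|uPi].
  by rewrite /Pi /normal_proj -scalemxAr mulmxA uH mul0mx scaler0.
by rewrite -normal_proj_d2local mulmxA uPi mul0mx.
Qed.

Lemma tangent_projP (u : 'rV[R]_n) : (u <= K)%MS <-> u *m Pi = 0.
Proof.
split=> [/submxP[D ->]|uPi]; first by rewrite -mulmxA tangent_proj_normal mulmx0.
by apply/submxP; exists u; rewrite mulmxBr uPi subr0 mulmx1.
Qed.

Lemma mxtrace_normal_proj : \tr Pi = (\rank Pi)%:R.
Proof. by apply: mxtrace_idempotent; exact: normal_proj_idem. Qed.

(** The zero of b at t0 is simple. Consequently critical points near x lie on the level t0, and
    nearby points off this level are regular. *)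
Lemma focal_value_isolated : \forall t \near t0, b t = 0 -> t = t0.
Proof.
have db : differentiable b t0.
  by apply: (smooth_on_differentiable sb); rewrite -Fx; exact: FJ.
  have e0 : 0 < `|beta| / 2 by rewrite divr_gt0 // normr_gt0.
  have nb : \forall t \near t0, `|b t - b t0 - 'D_(t - t0) b t0| <= `|beta| / 2 * `|t - t0|.
    rewrite (near_shift 0 t0) /= subr0.
    have := differentiable_bound db e0.
    by apply: filterS => h; rewrite /= addrK.
  apply: filterS nb => t Hbd bt; apply/eqP; rewrite -subr_eq0 -normr_le0.
  move: Hbd; rewrite bt bt0 (derive_scal1 _ db) subrr sub0r normrN normrM mulrC.
  have : 0 < `|beta| by rewrite normr_gt0.
  rewrite -/beta; move: `|beta| `|t - t0| (normr_ge0 (t - t0)) => B T; nra.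
Qed.

(* Near a critical point the zeros of the normal components of df are critical:
   there grad f is killed by the matrix hessian - b'(f)/2 g - g g(x)^-1 H, which is
   -b'(t0)/2 g(x) at x, hence invertible nearby. *)
Lemma focal_normal_zeros : \forall y \near x,
  dlocal f c y *m invmx (g x) *m H = 0 -> F y = t0.
Proof.
pose M y := hessian f c y - (2^-1 * 'D_1 b (F y)) *: g y - g y *m invmx (g x) *m H.
have dF := local_differentiable sf ac Ox.
have dDb : differentiable (fun y => 2^-1 * 'D_1 b (F y) : R) x.
  apply: (@differentiableM _ _ (cst 2^-1) ('D_1 b \o F)) => //.
  apply: (differentiable_comp dF).
  apply: (smooth_on_differentiable _ (FJ Ox)); exact: smooth_on_derive.
have dg := metric_differentiable ac Ox.
have dM : differentiable M x.
  apply: differentiableB; first apply: differentiableB.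
  - exact: hessian_differentiable.
  - apply/differentiable_mxP => i j.
    have /differentiable_mxP dgij := dg.
    rewrite (_ : (fun _ => _) = (fun y => 2^-1 * 'D_1 b (F y) : R) * (fun y => g y i j : R)).
      exact: differentiableM.
    by apply/funext => y; rewrite mxE.
  - apply: (@differentiable_mulmx _ _ _ _ _ (fun y => g y *m invmx (g x)) (fun=> H)) => //.
    by apply: (@differentiable_mulmx _ _ _ _ _ g (fun=> invmx (g x))) => //.
have Mx : M x = (- (2^-1 * beta)) *: g x.
  rewrite /M (crit_hessian dF0) mulmxV // mul1mx Fx -/beta.
  by rewrite addrAC subrr add0r scaleNr.
have dMx : \det (M x) != 0.
  rewrite Mx detZ mulf_neq0 //.
    by rewrite expf_neq0 // oppr_eq0 mulf_neq0 // invr_eq0 pnatr_eq0.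
  by rewrite -unitfE -unitmxE.
have ddet := differentiable_det dM.
have near_det : \forall y \near x, \det (M y) != 0.
  have /cvgrPdist_lt := differentiable_continuous ddet.
  move=> /(_ `|\det (M x)|); rewrite normr_gt0 => /(_ dMx).
  apply: filterS => y; apply: contraTneq => ->.
  by rewrite subr0 ltxx.
have near_b := focal_value_isolated.
have near_Fb : \forall y \near x, b (F y) = 0 -> F y = t0.
  have cF : F @ x --> t0 by rewrite -Fx; exact: differentiable_continuous.
  exact: (cF _ near_b).
near=> y => Z.
have Oy : Om y by near: y; exact: open_nbhs_nbhs.
have yM : grad f c y *m M y = 0.
  rewrite /M 2!mulmxBr (grad_hessian sf ac sb FJ bE Oy) -scalemxAr.
  by rewrite !mulmxA (grad_metric f ac Oy) subrr Z subrr.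
have y0 : grad f c y = 0.
  have uM : M y \in unitmx by rewrite unitmxE unitfE; near: y.
  by rewrite -(mulmxK uM (grad f c y)) yM mul0mx.
have d0 : dlocal f c y = 0 by apply/(grad_eq0 f ac Oy).
have : b (F y) = 0 by exact: (grad_norm2_crit ac bE Oy d0).
by near: y.
Unshelve. all: by end_near. Qed.

(** As t0 is a critical value, the implicit function theorem does not apply to f; the level is cut
    out by the normal components of df instead, with [focal_normal_zeros] for the non-trivial
    inclusion. Phi keeps the tangential coordinates, and 2 / beta times g(x)^-1 inverts the Hessian
    on the normal space, so that the differential of Phi at x is the identity. *)
Lemma focal_straightening : exists (U V : set 'rV[R]_n) (Phi G : 'rV[R]_n -> 'rV[R]_n),
  [/\ [/\ open U, U x, U `<=` Om & open V],
      smooth_on U Phi /\ smooth_on V G,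
      (forall y, U y -> V (Phi y) /\ G (Phi y) = y) /\
      (forall z, V z -> U (G z) /\ Phi (G z) = z),
      Phi x = 0 /\ (forall u, 'D_u G 0 = u) &
      forall y, U y -> F y = t0 <-> Phi y *m Pi = 0].
Proof.
pose Phi y : 'rV[R]_n := (y - x) *m K + dlocal f c y *m ((2 / beta) *: (invmx (g x) *m Pi)).
have sPhi : smooth_on Om Phi.
  apply: smooth_on_addmx => //.
    apply: (smooth_on_mulmx oOm (M := fun y => y - x)); last exact: smooth_on_cst.
    by apply: smooth_on_addmx => //; [exact: smooth_on_id|exact: smooth_on_cst].
  apply: smooth_on_mulmx => //; first exact: smooth_dlocal.
  exact: smooth_on_cst.
have DPhi u : 'D_u Phi x = u.
  have dd := dlocal_differentiable sf ac Ox.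
  have dB : differentiable (fun y : 'rV[R]_n => y - x) x.
    by apply: (@differentiableB _ _ _ id (cst x)).
  have dK : differentiable (fun y : 'rV[R]_n => (y - x) *m K) x.
    by apply: (@differentiable_mulmx _ _ _ _ _ (fun y : 'rV[R]_n => y - x) (fun=> K)).
  have dL : differentiable (fun y => dlocal f c y *m ((2 / beta) *: (invmx (g x) *m Pi))) x.
    exact: (@differentiable_mulmx _ _ _ _ _ (dlocal f c) (fun=> (2 / beta) *: (invmx (g x) *m Pi))).
  rewrite -['D_u Phi x]/('D_u ((fun y => (y - x) *m K) +
      (fun y => dlocal f c y *m ((2 / beta) *: (invmx (g x) *m Pi)))) x).
  rewrite deriveD; [|exact: diff_derivable|exact: diff_derivable].
  rewrite (derive_mulmxr _ _ dd) (derive_dlocal sf ac u Ox).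
  rewrite (derive_mulmxr _ _ dB) (_ : (fun y : 'rV[R]_n => y - x) = id - cst x) //.
  rewrite deriveB; [|exact: derivable_id|exact: derivable_cst].
  have HP : d2local f c x *m ((2 / beta) *: (invmx (g x) *m Pi)) = Pi.
    by rewrite -scalemxAr mulmxA scalemxAl; exact: normal_proj_idem.
  rewrite derive_id derive_cst subr0 -[u *m d2local f c x *m _]mulmxA HP.
  by rewrite -mulmxDr tangent_normal_proj mulmx1.
have PhiPi y : Phi y *m Pi = (2 / beta) *: (dlocal f c y *m invmx (g x) *m Pi).
  have yK0 : (y - x) *m K *m Pi = 0 by rewrite -mulmxA tangent_proj_normal mulmx0.
  have HP : ((2 / beta) *: (invmx (g x) *m Pi)) *m Pi = (2 / beta) *: (invmx (g x) *m Pi).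
    by rewrite -scalemxAl -mulmxA normal_proj_idem.
  rewrite mulmxDl yK0 add0r -[dlocal f c y *m _ *m Pi]mulmxA HP.
  by rewrite -[dlocal f c y *m _ *m Pi]mulmxA -scalemxAr.
have [W [oW Wx WOm HW]] : exists W : set 'rV[R]_n, [/\ open W, W x, W `<=` Om &
    forall y, W y -> dlocal f c y *m invmx (g x) *m H = 0 -> F y = t0].
  have nn : \forall y \near x, Om y /\ (dlocal f c y *m invmx (g x) *m H = 0 -> F y = t0).
    near=> y; split; first by near: y; exact: open_nbhs_nbhs.
    by near: y; exact: focal_normal_zeros.
  exists (interior (fun y => Om y /\ (dlocal f c y *m invmx (g x) *m H = 0 -> F y = t0))).
  split; [exact: open_interior|exact: nn| |].
    by move=> y /interior_subset[].
  by move=> y /interior_subset[].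
have [U [V [G [[oU Ux UO oV sG] [GPhi PhiG DG]]]]] :=
  inverse_function oW Wx (smooth_on_sub WOm sPhi) DPhi.
have Phix : Phi x = 0 by rewrite /Phi subrr dF0 !mul0mx addr0.
rewrite Phix in DG.
have UOm : U `<=` Om by move=> y /UO /WOm.
exists U, V, Phi, G; split => //.
  by split => //; exact: smooth_on_sub sPhi.
move=> y Uy; rewrite PhiPi; split=> [Fy|/eqP].
  by rewrite focal_crit ?mul0mx ?scaler0 //; exact: UOm.
rewrite scaler_eq0 mulf_eq0 pnatr_eq0 invr_eq0 (negbTE beta0) /= => /eqP Z.
by apply: HW; [exact: UO|rewrite -normal_proj_d2local mulmxA Z mul0mx].
Unshelve. all: by end_near. Qed.

(** df vanishes all along P, so its derivative along a curve in P with velocity u is zero. *)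
Lemma tangent_d2local (P : set N) y u : (forall q, P q -> f q = t0) ->
  tangent P c y u -> u *m d2local f c y = 0.
Proof.
move=> PE [e [s [e0 ss sP <- <-]]].
have b0 : ball (0 : R) e 0 by exact: ballxx.
have Os t : ball (0 : R) e t -> Om (s t) by move=> /sP[].
rewrite -(derive_dlocal sf ac); last exact: Os.
have d1 : differentiable s 0 by exact: smooth_on_differentiable ss b0.
have d2 : differentiable (dlocal f c) (s 0) by apply: dlocal_differentiable => //; exact: Os.
rewrite -(@derive_comp _ _ _ _ s (dlocal f c) 0 1 d1 d2); apply: (derive_near_cst (a := 0)).
near=> t; apply: focal_crit.
  by apply: Os; near: t; exact: nbhsx_ballx.
by apply: PE; apply: (proj2 (sP t _)); near: t; exact: nbhsx_ballx.
Unshelve. all: by end_near. Qed.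

(** In the straightened coordinates the level is the kernel of the normal projection, and G carries
    its lines to curves in P with the same velocity at x. *)
Lemma tangent_focal (P : set N) u : (forall q, P q <-> f q = t0) ->
  tangent P c x u <-> (u <= K)%MS.
Proof.
move=> PE; split=> [tu|/tangent_projP uPi].
  apply/tangent_projP/d2local_kernel; apply: (tangent_d2local (P := P)) tu.
  by move=> q /PE.
have [U [V [Phi [G [[oU Ux UO oV] [sPhi sG] [GP PG] [Phix DG] UE]]]]] := focal_straightening.
have V0 : V 0 by rewrite -Phix; case: (GP x Ux).
have [e e0 [se Ve D1]] := smooth_line u oV V0 sG.
exists e, (fun s : R => G (0 + s *: u)); split => //.
- move=> s /Ve Vs; have [UGs PGs] := PG _ Vs; split; first exact: UO.
  by apply/PE; apply/(UE _ UGs); rewrite PGs add0r -scalemxAl uPi scaler0.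
- by rewrite scale0r addr0 -Phix; case: (GP x Ux).
- by rewrite D1 DG.
Qed.

End focal_chart.

(** * Regular level hypersurfaces *)

Section shape_matrices.
Context {F : fieldType}.

Lemma form_inj m n (M M' : 'M[F]_(m, n)) :
  (forall (a : 'rV_m) (b : 'rV_n), (a *m M *m b^T) 0 0 = (a *m M' *m b^T) 0 0) -> M = M'.
Proof.
move=> MM'; apply/matrixP => i j.
have := MM' (delta_mx 0 i) (delta_mx 0 j).
by rewrite trmx_delta -!rowE -!colE !mxE.
Qed.

(** Solves the equation <T X, Y> = a S(X, Y) that defines a shape operator on the range of K, a
    projection self-adjoint for g: T is a times the matrix of the tangential part of S g^-1. It
    serves level hypersurfaces with a = - 1 / |grad f| and focal varieties with a = - 2 / beta. *)
Lemma shape_formP n k (K g S : 'M[F]_n) (A : 'M[F]_(n, k)) (B : 'M[F]_(k, n))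
    (T : 'M[F]_k) a :
  g \in unitmx -> g *m K^T = K *m g -> A *m B = K -> B *m A = 1%:M ->
  T *m B *m g *m B^T = a *: (B *m S *m B^T) <->
  T = a *: (B *m S *m invmx g *m A).
Proof.
move=> gu gK AB BA.
have BK : B *m K = B by rewrite -AB mulmxA BA mul1mx.
have KA : K *m A = A by rewrite -AB -mulmxA BA mulmx1.
have KT : K^T = invmx g *m (K *m g) by rewrite -gK mulKmx.
split=> [E|->].
  have := congr1 (fun M => M *m A^T *m invmx g *m A) E.
  rewrite /= -(mulmxA _ B^T) -trmx_mul AB -(mulmxA _ g) gK -(mulmxA T) (mulmxA B) BK.
  rewrite mulmxA mulmxK // -mulmxA BA mulmx1 => ->.
  rewrite -!scalemxAl -(mulmxA _ B^T) -trmx_mul AB KT.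
  by rewrite !mulmxA mulmxK // -!mulmxA KA.
rewrite -!scalemxAl; congr (_ *: _).
rewrite -(mulmxA _ A B) AB -(mulmxA _ K g) -(mulmxA _ (invmx g)) -KT.
by rewrite -(mulmxA _ K^T) -trmx_mul BK.
Qed.

End shape_matrices.

Section level_sets.
Context {R : realType} {n : nat} {N : riemannian R n}.
Variables (f : N -> R) (c : chart R N n).
Hypotheses (sf : smooth_fun f) (ac : atlas c).

Let Om : set 'rV[R]_n := chart_img c.
Let F : 'rV[R]_n -> R := local_expr f c.
Let g : 'rV[R]_n -> 'M[R]_n := metric c.
Let oOm : open Om := open_chart_img (c := c).
Hint Resolve oOm : core.

Lemma tangent_level x u : Om x -> dlocal f c x != 0 ->
  tangent (f @^-1` [set F x]) c x u <-> (u *m (dlocal f c x)^T) 0 0 = 0.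
Proof.
move=> Ox d0; split.
  move=> [e [s [e0 ss sP sx su]]].
  have b0 : ball (0 : R) e 0 by exact: ballxx.
  have d1 : differentiable s 0 by exact: smooth_on_differentiable ss b0.
  have d2 : differentiable F (s 0) by rewrite sx; exact: local_differentiable.
  rewrite -(derive_local sf ac) // -su -sx.
  rewrite -(@derive_comp _ _ _ _ s F 0 1 d1 d2); apply: (derive_near_cst (a := F x)).
  near=> t; have [] := sP t; last by [].
  by near: t; exact: nbhsx_ballx.
move=> ud.
have [w wd] : exists w : 'rV[R]_n, (w *m (dlocal f c x)^T) 0 0 = 1.
  have [i di] : exists i, dlocal f c x 0 i != 0.
    by move/rV0Pn: d0.
  exists ((dlocal f c x 0 i)^-1 *: frame i).
  by rewrite -scalemxAl -rowE mxE [row _ _ 0 0]mxE [(_^T) _ _]mxE mulVf.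
(* h is the non-linear part of F at x and df_x maps w to 1, so df_x (Phi y - x) = F y - F x: Phi
   sends the level into an affine hyperplane, and its differential at x is the identity because that
   of h vanishes. *)
pose h y : R := F y - F x - ((y - x) *m (dlocal f c x)^T) 0 0.
pose Phi y : 'rV[R]_n := y + h y *: w.
have sh : smooth_on Om h.
  apply: smooth_onB => //.
    by apply: smooth_onB => //; [exact: smooth_local|exact: smooth_on_cst].
  apply: (proj1 (smooth_on_mxP (fun y => (y - x) *m (dlocal f c x)^T) oOm)).
  apply: smooth_on_mulmx => //; last exact: smooth_on_cst.
  by apply: smooth_on_addmx => //; [exact: smooth_on_id|exact: smooth_on_cst].
have sPhi : smooth_on Om Phi.
  apply: smooth_on_addmx => //; first exact: smooth_on_id.
  by apply: smooth_on_scalemx => //; exact: smooth_on_cst.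
have dF := local_differentiable sf ac Ox.
have dB : differentiable (fun y : 'rV[R]_n => y - x) x.
  by apply: (@differentiableB _ _ _ id (cst x)).
have dBd : differentiable (fun y : 'rV[R]_n => (y - x) *m (dlocal f c x)^T) x.
  by apply: (@differentiable_mulmx _ _ _ _ _ (fun y : 'rV[R]_n => y - x) (fun=> (dlocal f c x)^T)).
have Dh v : 'D_v h x = 0.
  rewrite -['D_v h x]/('D_v (F - cst (F x) - (fun y => ((y - x) *m (dlocal f c x)^T) 0 0 : R)) x).
  have dBd0 : differentiable (fun y => ((y - x) *m (dlocal f c x)^T) 0 0 : R) x.
    by move/differentiable_mxP: dBd; apply.
  have dFc : differentiable (F - cst (F x)) x by exact: differentiableB.
  rewrite deriveB; [|exact: diff_derivable|exact: diff_derivable].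
  rewrite deriveB; [|exact: diff_derivable|exact: derivable_cst].
  rewrite derive_cst subr0 (derive_local sf ac) //.
  rewrite -(derive_coord _ _ (@diff_derivable _ _ _ _ _ v dBd)).
  rewrite (derive_mulmxr _ _ dB).
  rewrite (_ : (fun y : 'rV[R]_n => y - x) = id - cst x) //.
  rewrite deriveB; [|exact: derivable_id|exact: derivable_cst].
  by rewrite derive_id derive_cst subr0 subrr.
have dh : differentiable h x by exact: smooth_on_differentiable sh Ox.
have DPhi v : 'D_v Phi x = v.
  have dhw : differentiable (fun y => h y *: w) x by exact: differentiableZl.
  rewrite -['D_v Phi x]/('D_v (id + (fun y => h y *: w)) x).
  rewrite deriveD; [|exact: derivable_id|exact: diff_derivable].
  by rewrite derive_id [X in _ + X]deriveE // diffZl // -deriveE // Dh scale0r addr0.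
have [U [V [G [[oU Ux UO oV sG] [GP PG DG]]]]] := inverse_function oOm Ox sPhi DPhi.
have Phix : Phi x = x.
  by rewrite /Phi /h !subrr mul0mx mxE subr0 scale0r addr0.
have Vx : V x by have [] := GP x Ux; rewrite Phix.
have [e e0 [se Ve D1]] := smooth_line u oV Vx sG.
exists e, (fun s : R => G (x + s *: u)); split => //.
- move=> s /Ve Vs; have [UGs PGs] := PG _ Vs; split; first exact: UO.
  rewrite /= -/(F _); move: PGs; set y := G _ => PGs.
  pose L (z : 'rV[R]_n) : R := (z *m (dlocal f c x)^T) 0 0.
  have LD p q : L (p + q) = L p + L q by rewrite /L mulmxDl mxE.
  have LZ k p : L (k *: p) = k * L p by rewrite /L -scalemxAl mxE.
  have LN p : L (- p) = - L p by rewrite /L mulNmx mxE.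
  have := congr1 L PGs; rewrite /Phi LD !LZ LD LZ [L u]ud [L w]wd.
  rewrite -[h y]/(F y - F x - L (y - x)) LD LN.
  rewrite -[f (chart_inv c y)]/(local_expr f c y) /F; lra.
- by rewrite scale0r addr0; have [_] := GP x Ux; rewrite Phix.
- by rewrite D1 -{1}Phix DG.
Unshelve. all: by end_near. Qed.

Section level_shape.
Variable x : 'rV[R]_n.
Hypotheses (Ox : Om x) (d0 : dlocal f c x != 0).
Let nu := unit_grad f c x.
Let rho := Num.sqrt (grad_norm2 f c x).

Let g2_gt0 : 0 < grad_norm2 f c x.
Proof.
apply: (metric_posdef ac Ox); apply: contra_neq d0 => y0.
by apply/(grad_eq0 f ac Ox).
Qed.

Let rho_gt0 : 0 < rho. Proof. by rewrite sqrtr_gt0. Qed.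

Let nuE : nu = rho^-1 *: grad f c x. Proof. by []. Qed.

Let inner_nu (u : 'rV[R]_n) : inner c x u nu = rho^-1 * (u *m (dlocal f c x)^T) 0 0.
Proof.
rewrite /inner nuE linearZ /= -scalemxAr mxE; congr (_ * _).
by rewrite -(grad_metric f ac Ox) [in RHS]trmx_mul (metric_tr ac Ox) mulmxA.
Qed.

Let open_nonzero w : open (Om `&` [set z | 'D_w F z != 0]).
Proof.
rewrite openE => z [Oz wz]; apply: filterI; first exact: open_nbhs_nbhs.
have cw : {for z, continuous ('D_w F)}.
  apply: differentiable_continuous.
  exact: (smooth_on_differentiable (smooth_on_derive w (smooth_local sf ac)) Oz).
by apply: (cw [set y | y != 0]); apply: open_nbhs_nbhs; split => //; exact: open_neq.
Qed.

(** Shape operators are tested on tangent fields, so a tangent vector is extended by projecting the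
    constant field X0 to ker df along a transversal w. The result lies in ker df on a whole
    neighbourhood, not only along the level of x, so this relation can be differentiated in
    coordinates. *)
Lemma tangent_level_extend (X0 : 'rV[R]_n) : (X0 *m (dlocal f c x)^T) 0 0 = 0 ->
  forall w, 'D_w F x != 0 ->
  exists X, [/\ tangent_field (f @^-1` [set F x]) c (Om `&` [set z | 'D_w F z != 0]) X,
    X x = X0 & forall z, Om z -> 'D_w F z != 0 -> (X z *m (dlocal f c z)^T) 0 0 = 0].
Proof.
move=> X0d w w0; set W := Om `&` _.
pose X z := X0 - ('D_X0 F z / 'D_w F z) *: w.
have Xd z : Om z -> 'D_w F z != 0 -> (X z *m (dlocal f c z)^T) 0 0 = 0.
  move=> Oz wz; rewrite mulmxBl -scalemxAl mxE [X in _ + X]mxE [X in _ - X]mxE.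
  by rewrite -!(derive_local sf ac _ Oz) divfK // subrr.
have oW : open W := @open_nonzero w.
have sXw v : smooth_on W ('D_v F).
  by apply: smooth_on_derive; apply: smooth_on_sub (smooth_local sf ac) => z [].
exists X; split => //; last first.
  by rewrite /X derive_local // X0d mul0r scale0r subr0.
split.
  apply: (smooth_on_addmx oW (M := fun=> X0)); first exact: smooth_on_cst.
  apply: (@eq_smooth_on _ _ _ _ (fun z => (-1 * ('D_X0 F z * ('D_w F z)^-1)) *: w)) => //.
    by move=> z _; rewrite mulN1r scaleNr.
  apply: smooth_on_scalemx => //; last exact: smooth_on_cst.
  apply: smooth_onM => //; first exact: smooth_on_cst.
  apply: smooth_onM => //.
  by apply: smooth_onV => // z [].
move=> z [Oz wz] Pz.
have dz : dlocal f c z != 0.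
  by apply: contraNneq wz => dz; rewrite derive_local // dz trmx0 mulmx0 mxE.
have <- : F z = F x by exact: Pz.
by apply/tangent_level => //; exact: Xd.
Qed.

(** Differentiating df(Y) = 0 along X gives df(nabla_X Y) = - Hess f(X, Y); the unit normal is the
    gradient divided by rho = |grad f|. *)
Lemma level_covd (X0 Y0 : 'rV[R]_n) :
  (X0 *m (dlocal f c x)^T) 0 0 = 0 -> (Y0 *m (dlocal f c x)^T) 0 0 = 0 ->
  exists W X Y, [/\ [/\ open W, W x & W `<=` chart_img c],
    tangent_field (f @^-1` [set F x]) c W X, tangent_field (f @^-1` [set F x]) c W Y,
    X x = X0 /\ Y x = Y0 &
    inner c x (covd c X Y x) nu = - rho^-1 * (X0 *m hessian f c x *m Y0^T) 0 0].
Proof.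
move=> X0d Y0d.
have [w w0] : exists w, 'D_w F x != 0.
  have [i di] : exists i, dlocal f c x 0 i != 0 by move/rV0Pn: d0.
  by exists (frame i); rewrite mxE in di.
have [X [tX Xx _]] := tangent_level_extend X0d w0.
have [Y [tY Yx Yd]] := tangent_level_extend Y0d w0.
pose W := Om `&` [set z | 'D_w F z != 0].
have oW : open W := @open_nonzero w.
exists W, X, Y; split => //; first by split => // z [].
have Wx : W x by [].
have dY : differentiable Y x by case: tY => sY _; exact: smooth_on_differentiable sY Wx.
have dd := dlocal_differentiable sf ac Ox.
rewrite inner_nu /covd Xx Yx mulmxDl mxE christoffel_form_dlocal.
have : 'D_X0 (fun z => Y z *m (dlocal f c z)^T) x = 0.
  apply: (derive_near_cst (a := 0)); near=> z.
  have [Oz wz] : W z by near: z; exact: open_nbhs_nbhs.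
  by apply/matrixP => i j; rewrite !ord1 [RHS]mxE; exact: Yd.
rewrite derive_mulmx //; last exact: differentiable_trmx.
rewrite derive_trmx // (derive_dlocal sf ac X0 Ox) Yx trmx_mul (d2local_sym sf ac Ox).
move=> /(congr1 (fun M : 'M[R]_1 => M 0 0)); rewrite mxE [RHS]mxE mulmxA.
rewrite (sym_form (d2local_sym sf ac Ox)) => /eqP; rewrite addr_eq0 => /eqP ->.
rewrite /hessian mulmxBr mulmxBl [in RHS]mxE [X in _ = _ * (_ + X)]mxE.
rewrite mulNr -mulrN opprB; congr (_ * _); exact: addrC.
Unshelve. all: by end_near. Qed.

Variables (b : R -> R) (J : set R).
Hypotheses (sb : smooth_on J b).
Hypothesis FJ : forall x, chart_img c x -> J (local_expr f c x).
Hypothesis bE : forall x, chart_img c x -> grad_norm2 f c x = b (local_expr f c x).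

(* In the splitting of the tangent space into ker df and the line of grad f, the
   Hessian is block diagonal with blocks - rho T and b'(f)/2. *)
Lemma level_hessian_det (s : seq R) a :
  principal_curvatures (f @^-1` [set F x]) c x nu s ->
  \det (a *: g x - hessian f c x) =
    (a - 2^-1 * 'D_1 b (F x)) *
    ((- Num.sqrt (b (F x))) ^+ size s *
     (\prod_(r <- s) ('X - r%:P)).[- (a / Num.sqrt (b (F x)))]) * \det (g x).
Proof.
move=> [k [B [T [[fB tB TE] Ts]]]].
rewrite -(bE Ox) -/rho.
have gu := metric_unit ac Ox; have gt := metric_tr ac Ox.
set mu := 2^-1 * 'D_1 b (F x).
(* On row vectors u Q = <u, nu> nu, the projection onto the normal line; K = 1 - Q projects onto ker
   df. *)
pose Q := g x *m nu^T *m nu.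
have nunu : nu *m g x *m nu^T = 1%:M.
  have gd : (grad f c x *m (dlocal f c x)^T) 0 0 = rho ^+ 2.
    rewrite -(grad_metric f ac Ox) [(_ *m metric c x)^T]trmx_mul gt mulmxA.
    by rewrite sqr_sqrtr // ltW.
  apply/matrixP => i j; rewrite !ord1 -[LHS]/(inner c x nu nu) inner_nu nuE -scalemxAl.
  rewrite [X in _ * X]mxE gd [RHS]mxE eqxx mulr1n; field.
  by rewrite gt_eqF.
have QQ : Q *m Q = Q.
  transitivity (g x *m nu^T *m (nu *m g x *m nu^T) *m nu); first by rewrite !mulmxA.
  by rewrite nunu mulmx1.
pose K := 1%:M - Q.
have KQ : K + Q = 1%:M by rewrite subrK.
have QK : Q *m K = 0 by rewrite mulmxBr mulmx1 QQ subrr.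
have KK : K *m K = K by rewrite {1}/K mulmxBl mul1mx QK subr0.
have gK : g x *m K^T = K *m g x.
  rewrite linearB /= trmx1 mulmxBr mulmxBl mulmx1 mul1mx; congr (_ - _).
  by rewrite /Q !trmx_mul trmxK gt !mulmxA.
have uK (u : 'rV[R]_n) : (u <= K)%MS <-> (u *m (dlocal f c x)^T) 0 0 = 0.
  have uQ : (u *m (dlocal f c x)^T) 0 0 = 0 <-> u *m Q = 0.
    have e : u *m Q = (rho^-1 * (u *m (dlocal f c x)^T) 0 0) *: nu.
      rewrite -inner_nu /Q !mulmxA [u *m _ *m nu^T]mx11_scalar.
      by rewrite mul_scalar_mx.
    rewrite e; split=> [->|/eqP]; first by rewrite mulr0 scale0r.
    rewrite scaler_eq0 mulf_eq0 invr_eq0 (gt_eqF rho_gt0) /= => /orP[/eqP//|/eqP nu0].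
    move: nunu; rewrite nu0 !mul0mx => /matrixP/(_ 0 0); rewrite !mxE eqxx => /eqP.
    by rewrite eq_sym oner_eq0.
  rewrite uQ; split=> [/submxP[D ->]|uQ0].
    by rewrite -mulmxA mulmxBl mul1mx QQ subrr mulmx0.
  by apply/submxP; exists u; rewrite mulmxBr uQ0 subr0 mulmx1.
have tK (u : 'rV[R]_n) : (u <= B)%MS <-> (u <= K)%MS.
  by rewrite -tB uK; exact: tangent_level.
have BK : (B == K)%MS.
  by apply/andP; split; apply/rV_subP => u /tK.
have [A AB BA] := idempotent_factor KK fB BK.
have TB : T *m B *m g x *m B^T = - rho^-1 *: (B *m hessian f c x *m B^T).
  apply: form_inj => p q.
  have rowB (r : 'rV[R]_k) : ((r *m B) *m (dlocal f c x)^T) 0 0 = 0.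
    by apply/uK/tK; exact: submxMl.
  have [W [X [Y [[oW Wx WO] tX tY [Xx Yx] E]]]] := level_covd (rowB p) (rowB q).
  have := TE W X Y p q oW Wx WO tX tY Xx Yx; rewrite E => TEq.
  rewrite -scalemxAr -scalemxAl [RHS]mxE -[X in _ = _ * X]/((p *m (B *m hessian f c x *m B^T) *m q^T) 0 0).
  have -> : p *m (B *m hessian f c x *m B^T) *m q^T =
      p *m B *m hessian f c x *m (q *m B)^T by rewrite trmx_mul !mulmxA.
  by rewrite -TEq /inner trmx_mul !mulmxA.
have TA := proj1 (shape_formP (hessian f c x) T (- rho^-1) gu gK AB BA) TB.
set E := hessian f c x *m invmx (g x).
have QE : Q *m E = mu *: Q.
  have nuH : nu *m hessian f c x = mu *: (nu *m g x).
    rewrite nuE -!scalemxAl (grad_hessian sf ac sb FJ bE Ox) (grad_metric f ac Ox).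
    by rewrite scalerA mulrC -scalerA.
  rewrite /Q /E mulmxA -(mulmxA _ nu) nuH -scalemxAr -scalemxAl mulmxA mulmxK //.
have -> : a *: g x - hessian f c x = (a%:M - E) *m g x.
  by rewrite mulmxBl mul_scalar_mx mulmxKV.
rewrite det_mulmx; congr (_ * _).
have -> : a%:M - E = K *m (a%:M - E) - (mu - a) *: Q.
  rewrite {1}/K mulmxBl mul1mx mulmxBr QE mul_mx_scalar scalerBl.
  by move: (a%:M - E) (Q) => X Y; apply/matrixP => i j; rewrite !mxE; ring.
rewrite (det_split_idempotent _ _ _ KQ QK AB BA).
congr (_ * _).
  (* The identity plus a column times a row: [det_1D_mulmx] reduces its determinant to that of a 1
     by 1 matrix, a - mu. *)
  have -> : K - (mu - a) *: Q = 1%:M + (g x *m ((a - mu - 1) *: nu^T)) *m nu.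
    have -> : (g x *m ((a - mu - 1) *: nu^T)) *m nu = (a - mu - 1) *: Q.
      by rewrite -[g x *m _]scalemxAr -scalemxAl.
    by rewrite /K; move: (Q) => Y; apply/matrixP => i j; rewrite !mxE; ring.
  have e1 : nu *m (g x *m ((a - mu - 1) *: nu^T)) = (a - mu - 1)%:M.
    by rewrite mulmxA -[nu *m _ *m (_ *: _)]scalemxAr nunu scalemx1.
  by rewrite det_1D_mulmx e1 -raddfD det_scalar1 /= addrC subrK.
(* Hence a - B E A = - rho (- a / rho - T), the origin of the power of - rho and of the argument - a
   / rho. *)
have -> : B *m E *m A = - rho *: T.
  rewrite TA scalerA mulrNN mulfV ?scale1r ?gt_eqF // /E !mulmxA //.
have sz : size s = k.
  by have := size_char_poly T; rewrite Ts size_prod_XsubC => -[].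
rewrite sz -Ts char_poly_horner -detZ; congr (\det _).
rewrite scalerBr scale_scalar_mx mulrNN mulrCA mulfV ?mulr1 ?gt_eqF //.
Qed.

End level_shape.
End level_sets.

(** * Approaching the focal variety *)

Section one_sided_limits.
Context {R : realType}.

(** Subtracting the quadratic term a t^2 / 2 leaves a function of t whose derivative on [0, s] is
    o(s), as ['D_v f] vanishes and is differentiable at x; the mean value theorem makes its
    variation o(s^2). *)
Lemma second_order_expansion (E : normedModType R) (f : E -> R) x v :
  (\near x, differentiable f x) -> 'D_v f x = 0 -> differentiable ('D_v f) x ->
  (f (x + s *: v) - f x) / s ^+ 2 @[s --> 0^'+] --> 2^-1 * 'D_v ('D_v f) x.
Proof.
move=> ndf Df0 dDf; set a := 'D_v ('D_v f) x.
apply/cvgrPdist_le => e e0.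
have v0 : 0 < `|v| + 1 by rewrite ltr_wpDl.
have e'0 : 0 < e / (`|v| + 1) by rewrite divr_gt0.
have [r1 /= r10 H1] := proj1 (nbhs_ballP _ _) ndf.
have [r2 /= r20 H2] := proj1 (nbhs_ballP _ _) (differentiable_bound dDf e'0).
have m0 : 0 < Num.min r1 r2 by rewrite lt_min r10.
near=> s.
have s0 : 0 < s by near: s; exact: nbhs_right_gt.
have sr : s * (`|v| + 1) < Num.min r1 r2.
  rewrite -ltr_pdivlMr //; near: s; apply: nbhs_right_lt; exact: divr_gt0.
move: sr; rewrite lt_min => /andP[sr1 sr2].
have small t : 0 <= t <= s -> `|t *: v| <= s * `|v|.
  by move=> /andP[t0 ts]; rewrite normrZ ger0_norm // ler_wpM2r.
have sv : s * `|v| < s * (`|v| + 1) by rewrite ltr_pM2l // ltrDl.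
have df t : 0 <= t <= s -> differentiable f (x + t *: v).
  move=> /small ts; apply: H1; rewrite -ball_normE /= opprD addrA subrr sub0r normrN.
  by rewrite (le_lt_trans ts) // (lt_trans sv).
pose psi := (fun t => f (x + t *: v) : R) - (2^-1 * a) *: (fun t : R => t ^+ 2).
have Dpsi t : 0 <= t <= s -> is_derive t 1 psi
      ('D_v f (x + t *: v) - a * t).
  move=> /df dft; have d1 := is_derive_line dft.
  apply: is_derive_eq.
  by rewrite /GRing.scale /=; lra.
have [||t] := @MVT R psi (fun t => 'D_v f (x + t *: v) - a * t) 0 s s0.
- by move=> t; rewrite in_itv /= => /andP[t0 ts]; apply: Dpsi; rewrite !ltW.
- apply: derivable_within_continuous => t; rewrite in_itv /= => ts.
  by have [] := Dpsi t ts.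
rewrite in_itv /= => /andP[t0 ts].
rewrite subr0 /psi !fctE /= scale0r addr0 expr0n /= scaler0 subr0 => E1.
have tb : 0 <= t <= s by rewrite !ltW.
have : `|'D_v f (x + t *: v) - a * t| <= e * s.
  have tin : ball 0 r2 (t *: v).
    by rewrite -ball_normE /= sub0r normrN (le_lt_trans (small _ tb)) // (lt_trans sv).
  have Dlin : 'D_(t *: v) ('D_v f) x = a * t.
    by rewrite deriveE // linearZ /= -deriveE // mulrC.
  have := H2 _ tin; rewrite Dlin Df0 subr0 [t *: v + x]addrC => Hb; apply: le_trans Hb _.
  apply: le_trans (ler_wpM2l _ (small _ tb)) _; first by rewrite ltW.
  have eE : e = e / (`|v| + 1) * (`|v| + 1) by rewrite divfK // gt_eqF.
  rewrite [in leRHS]eE -mulrA ler_pM2l // mulrDl mul1r [leLHS]mulrC lerDl; exact: ltW.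
move=> Hb; have s20 : 0 < s ^+ 2 by rewrite exprn_gt0.
have -> : 2^-1 * a - (f (x + s *: v) - f x) / s ^+ 2 =
    - (('D_v f (x + t *: v) - a * t) * s / s ^+ 2).
  rewrite -E1 /GRing.scale /=; field; by rewrite gt_eqF.
rewrite normrN normrM normfV (gtr0_norm s20) ler_pdivrMr // normrM (gtr0_norm s0) expr2 mulrA.
by rewrite ler_pM2r.
Unshelve. all: by end_near. Qed.

(* Both limits are limits of the same function of w, which takes on either side
   all sufficiently small positive values. *)
Lemma matched_limits (w1 w2 Q : R -> R) (l1 l2 d : R) : 0 < d ->
  (forall w, w = w1 \/ w = w2 -> [/\ {within `[0, d], continuous w}, w 0 = 0 &
     forall s, 0 < s <= d -> 0 < w s]) ->
  Q (w1 s) @[s --> 0^'+] --> l1 -> Q (w2 s) @[s --> 0^'+] --> l2 -> l1 = l2.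
Proof.
move=> d0 Hw c1 c2; apply/eqP; rewrite -subr_eq0 -normr_le0 leNgt; apply/negP => e0.
have e20 : 0 < `|l1 - l2| / 2 by rewrite divr_gt0.
have near_both : \forall s \near 0^'+, [/\ s < d, `|l1 - Q (w1 s)| < `|l1 - l2| / 2 &
    `|l2 - Q (w2 s)| < `|l1 - l2| / 2].
  near=> s; split.
  - by near: s; exact: nbhs_right_lt.
  - by near: s; move/cvgrPdist_lt: c1; apply.
  - by near: s; move/cvgrPdist_lt: c2; apply.
have [r /= r0 Hr] := near_both.
have {}Hr s : 0 < s -> s < r -> [/\ s < d, `|l1 - Q (w1 s)| < `|l1 - l2| / 2 &
    `|l2 - Q (w2 s)| < `|l1 - l2| / 2].
  by move=> s0 sr; apply: Hr => //=; rewrite sub0r normrN gtr0_norm.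
pose s0 := r / 2.
have s00 : 0 < s0 by rewrite divr_gt0.
have s0r : s0 < r by rewrite /s0; lra.
have [s0d _ _] := Hr _ s00 s0r.
have s0d' : 0 < s0 <= d by rewrite s00 ltW.
(* The smaller of the two values at s0 is taken by both functions on ]0, s0], since both are
   continuous and start from 0. *)
pose a := Num.min (w1 s0) (w2 s0).
have a0 : 0 < a.
  by rewrite lt_min; have [] := Hw w1 (or_introl erefl); have [] := Hw w2 (or_intror erefl);
     move=> _ _ -> // _ _ ->.
have hit w : w = w1 \/ w = w2 -> a <= w s0 -> exists2 s, 0 < s < r & w s = a.
  move=> ww aw; have [cw w0 _] := Hw w ww.
  have cw' : {within `[0, s0], continuous w}.
    apply: continuous_subspaceW cw => t; rewrite /= !in_itv /= => /andP[-> ts] /=.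
    exact: le_trans ts (ltW s0d).
  have [||s] := @IVT R w 0 s0 a _ cw'.
  - exact: ltW.
  - by rewrite w0 ge_min le_max aw (ltW a0) orbT.
  rewrite in_itv /= => /andP[s_ge0 ss0] ws; exists s => //.
  rewrite (le_lt_trans ss0) // andbT lt_neqAle s_ge0 andbT.
  by apply/eqP => s_eq; move: a0; rewrite -ws -s_eq w0 ltxx.
have [s1 /andP[s10 s1r] W1] : exists2 s, 0 < s < r & w1 s = a.
  by apply: hit; [left|rewrite ge_min lexx].
have [s2 /andP[s20 s2r] W2] : exists2 s, 0 < s < r & w2 s = a.
  by apply: hit; [right|rewrite ge_min lexx orbT].
have [_ + _] := Hr _ s10 s1r; have [_ _] := Hr _ s20 s2r.
rewrite W1 W2; have := ler_distD (Q a) l1 l2; rewrite [`|Q a - l2|]distrC; lra.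
Unshelve. all: by end_near. Qed.

End one_sided_limits.

Section focal_limit.
Context {R : realType} {n : nat} {N : riemannian R n}.
Variables (f : N -> R) (c : chart R N n).
Hypotheses (sf : smooth_fun f) (ac : atlas c).
Variables (b : R -> R) (J : set R).
Hypothesis sb : smooth_on J b.
Hypothesis FJ : forall x, chart_img c x -> J (local_expr f c x).
Hypothesis bE : forall x, chart_img c x -> grad_norm2 f c x = b (local_expr f c x).

Let Om : set 'rV[R]_n := chart_img c.
Let F : 'rV[R]_n -> R := local_expr f c.
Let g : 'rV[R]_n -> 'M[R]_n := metric c.
Let oOm : open Om := open_chart_img (c := c).
Hint Resolve oOm : core.

Variable Psi : R -> R -> R.
Hypothesis PsiE : forall y a, Om y -> b (F y) != 0 ->
  \det (a *: g y - hessian f c y) = Psi (F y) a * \det (g y).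

Variables (x : 'rV[R]_n) (t0 : R).
Hypotheses (Ox : Om x) (Fx : F x = t0) (bt0 : b t0 = 0).
Let beta := 'D_1 b t0.
Hypothesis beta0 : beta != 0.

Let H : 'M[R]_n := d2local f c x.
Let Pi := normal_proj f c b x t0.
Let K := tangent_proj f c b x t0.

Let dF0 : dlocal f c x = 0. Proof. exact: (focal_crit ac bE bt0). Qed.

Section direction.
Variable v : 'rV[R]_n.
Hypotheses (vPi : v *m Pi = v) (gv : inner c x v v = 1).

(** The difference F - t0 is equivalent to beta s^2 / 4, so the radicand is equivalent to s^2
    whatever the sign of beta. [Num.sqrt] returns 0 on negative numbers; [w_pos] excludes this case
    for small s > 0. *)
Let w s := Num.sqrt (4 / beta * (F (x + s *: v) - t0)).

Let DvF : 'D_v ('D_v F) x = 2^-1 * beta.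
Proof.
have dd := dlocal_differentiable sf ac Ox.
have -> : 'D_v ('D_v F) x = 'D_v (fun y => (dlocal f c y *m v^T) 0 0 : R) x.
  apply: near_eq_derive; near=> y; have Oy : Om y by near: y; exact: open_nbhs_nbhs.
  rewrite (derive_local sf ac v Oy) -[(_ *m _) 0 0]/((v *m (dlocal f c y)^T) 0 0).
  by rewrite -[v *m _]trmxK mxE trmx_mul trmxK.
have dm : differentiable (fun y => dlocal f c y *m v^T) x.
  exact: (@differentiable_mulmx _ _ _ _ _ (dlocal f c) (fun=> v^T)).
rewrite -(derive_coord _ _ (@diff_derivable _ _ _ _ _ v dm)) (derive_mulmxr _ _ dd).
rewrite (derive_dlocal sf ac v Ox).
rewrite (d2local_proj f ac Ox beta0) -/Pi -scalemxAr -scalemxAl mxE.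
by rewrite mulmxA vPi -[X in _ * X]/(inner c x v v) gv mulr1.
Unshelve. all: by end_near. Qed.

Let w2_lim : 4 / beta * (F (x + s *: v) - t0) / s ^+ 2 @[s --> 0^'+] --> (1 : R).
Proof.
have ndF : \near x, differentiable F x.
  near=> y; apply: (local_differentiable sf ac); near: y; exact: open_nbhs_nbhs.
have DF0 : 'D_v F x = 0 by rewrite (derive_local sf ac v Ox) dF0 trmx0 mulmx0 mxE.
have dDF : differentiable ('D_v F) x.
  exact: smooth_on_differentiable (smooth_on_derive v (smooth_local sf ac)) Ox.
have := second_order_expansion ndF DF0 dDF; rewrite DvF -/F Fx => lim2.
have e1 : 4 / beta * (2^-1 * (2^-1 * beta)) = 1 by field.
rewrite -[X in _ --> X]e1.
apply: (cvg_trans _ (cvgM (cvg_cst (4 / beta)) lim2)); apply: near_eq_cvg.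
by near=> s; rewrite /= mulrA.
Unshelve. all: by end_near. Qed.

Let w_over_s : w s / s @[s --> 0^'+] --> (1 : R).
Proof.
have L : Num.sqrt (4 / beta * (F (x + s *: v) - t0) / s ^+ 2) @[s --> 0^'+] --> (1 : R).
  rewrite -[X in _ --> X]sqrtr1.
  exact: (continuous_cvg _ (@sqrt_continuous R 1) w2_lim).
apply: (cvg_trans _ L); apply: near_eq_cvg; near=> s.
have s0 : 0 < s by near: s; exact: nbhs_right_gt.
rewrite /w mulrC sqrtrM ?invr_ge0 ?sqr_ge0 // sqrtrV ?sqr_ge0 // sqrtr_sqr gtr0_norm //.
exact: mulrC.
Unshelve. all: by end_near. Qed.

Let w_pos : \forall s \near 0^'+, 0 < w s.
Proof.
have half : 0 < (2^-1 : R) by rewrite invr_gt0.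
near=> s; have s0 : 0 < s by near: s; exact: nbhs_right_gt.
have : `|1 - w s / s| < 2^-1.
  by near: s; move/cvgrPdist_lt: w_over_s; apply.
rewrite ltr_distlC => /andP[h _].
have : 0 < w s / s by lra.
by rewrite pmulr_lgt0 // invr_gt0.
Unshelve. all: by end_near. Qed.

Let w0_lim : w s @[s --> 0^'+] --> (0 : R).
Proof.
have s_lim : s @[s --> (0 : R)^'+] --> (0 : R) by apply: cvg_at_right_filter; exact: cvg_id.
have L : w s / s * s @[s --> 0^'+] --> (0 : R).
  by rewrite -[X in _ --> X](mulr0 1); exact: cvgM w_over_s s_lim.
apply: (cvg_trans _ L); apply: near_eq_cvg.
near=> s; have s0 : 0 < s by near: s; exact: nbhs_right_gt.
by rewrite divfK // gt_eqF.
Unshelve. all: by end_near. Qed.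

Let s_over_w : s / w s @[s --> 0^'+] --> (1 : R).
Proof.
have L : (w s / s)^-1 @[s --> 0^'+] --> (1 : R).
  by rewrite -[X in _ --> X]invr1; exact: cvgV (oner_neq0 R) w_over_s.
apply: (cvg_trans _ L).
by apply: near_eq_cvg; near=> s; rewrite /= invf_div.
Unshelve. all: by end_near. Qed.

Let line_lim (V : normedModType R) (G : 'rV[R]_n -> V) : differentiable G x ->
  G (x + s *: v) @[s --> 0^'+] --> G x.
Proof.
move=> dG; apply: cvg_at_right_filter.
have dG0 : differentiable G (x + 0 *: v) by rewrite scale0r addr0.
have [dl _] := is_derive_line dG0.
have cG := differentiable_continuous (proj1 (derivable1_diffP _ _) dl).
have x0 : x = x + 0 *: v by rewrite scale0r addr0.
by rewrite [X in _ --> G X]x0; exact: cG.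
Qed.

Lemma focal_w_admissible : exists2 d, 0 < d &
  [/\ {within `[0, d], continuous w}, w 0 = 0 & forall s, 0 < s <= d -> 0 < w s].
Proof.
have [r1 /= r10 H1] := w_pos.
have nO : \forall s \near (0 : R), Om (x + s *: v).
  have dI : differentiable (id : 'rV[R]_n -> 'rV[R]_n) (x + 0 *: v) by [].
  have [+ _] := is_derive_line dI.
  move=> /derivable1_diffP /differentiable_continuous; apply.
  by apply: open_nbhs_nbhs; split; rewrite // scale0r addr0.
have [r2 /= r20 H2] := proj1 (nbhs_ballP _ _) nO.
pose d := Num.min r1 r2 / 2.
have m0 : 0 < Num.min r1 r2 by rewrite lt_min r10.
have d0 : 0 < d by rewrite divr_gt0.
have : d < Num.min r1 r2 by rewrite /d; lra.
rewrite lt_min => /andP[dr1 dr2].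
exists d => //; split.
- apply: continuous_in_subspaceT => s; rewrite inE /= in_itv /= => /andP[s0 sd].
  have Os : Om (x + s *: v).
    apply: H2; rewrite -ball_normE /= sub0r normrN ger0_norm //.
    exact: le_lt_trans sd dr2.
  have [+ _] := is_derive_line (local_differentiable sf ac Os).
  move=> /derivable1_diffP /differentiable_continuous cF.
  have L : 4 / beta * (F (x + s' *: v) - t0) @[s' --> s] --> 4 / beta * (F (x + s *: v) - t0).
    apply: cvgM; first exact: cvg_cst.
    by apply: cvgB; [exact: cF|exact: cvg_cst].
  exact: (continuous_cvg _ (@sqrt_continuous R _) L).
- by rewrite /w scale0r addr0 Fx subrr mulr0 sqrtr0.
- move=> s /andP[s0 sd]; apply: H1 => //=.
  by rewrite sub0r normrN gtr0_norm // (le_lt_trans sd).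
Qed.

Let mulmx_lim (A : 'M[R]_n) (B : R -> 'M[R]_n) L : B s @[s --> 0^'+] --> L ->
  A *m B s @[s --> 0^'+] --> A *m L.
Proof.
move=> BL.
exact: (@continuous_cvg _ _ _ _ _ _ (fun C : 'M[R]_n => A *m C) _
  (@continuous_mulmxl R n n n A L) BL).
Qed.

(* K projects onto the tangent space of the focal variety, where the Hessian
   vanishes at x: dividing that part by w, asymptotic to s, brings in the derivative
   of the Hessian along v. *)
Lemma focal_det_limit a :
  \det ((w s)^-1 *: K + Pi) * Psi (t0 + beta / 4 * w s ^+ 2) (w s * a) @[s --> 0^'+] -->
  \det (K *m (a *: g x - 'D_v (hessian f c) x) - H) / \det (g x).
Proof.
have dg := metric_differentiable ac Ox; have dH := hessian_differentiable sf ac Ox.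
pose y s := x + s *: v.
have g_lim := line_lim dg; have h_lim := line_lim dH.
have Hx : hessian f c x = H := crit_hessian dF0.
have KH : K *m hessian f c x = 0.
  by rewrite Hx; exact: (tangent_proj_d2local sf ac sb FJ bE Ox Fx bt0 beta0).
have PH : Pi *m hessian f c x = H.
  by rewrite Hx; exact: (normal_proj_d2local sf ac sb FJ bE Ox Fx bt0 beta0).
have S_lim : s^-1 *: (hessian f c (y s) - hessian f c x) @[s --> 0^'+] --> 'D_v (hessian f c) x.
  apply: cvg_dnbhs_at_right.
  have D : h^-1 *: (hessian f c (h *: v + x) - hessian f c x) @[h --> 0^'] -->
      'D_v (hessian f c) x by exact: (@diff_derivable _ _ _ _ _ v dH).
  by under eq_fun do rewrite /y [x + _]addrC.
(* This is (w^-1 K + Pi) (w a g - Hess f) at y s, freed from the division by w: K annihilates the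
   Hessian at x, so w^-1 K Hess f is s / w times a difference quotient. *)
pose M s := K *m (a *: g (y s)) - (s / w s) *: (K *m (s^-1 *: (hessian f c (y s) - hessian f c x)))
  + Pi *m ((w s * a) *: g (y s) - hessian f c (y s)).
have M_lim : M s @[s --> 0^'+] --> K *m (a *: g x - 'D_v (hessian f c) x) - H.
  have -> : K *m (a *: g x - 'D_v (hessian f c) x) - H =
     K *m (a *: g x) - 1 *: (K *m 'D_v (hessian f c) x) + Pi *m ((0 * a) *: g x - hessian f c x).
    by rewrite mul0r scale0r sub0r mulmxN PH mulmxBr scale1r.
  apply: cvgD.
    apply: cvgB.
      by apply: mulmx_lim; apply: cvgZ; [exact: cvg_cst|exact: g_lim].
    apply: cvgZ; first exact: s_over_w.
    by apply: mulmx_lim; exact: S_lim.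
  apply: mulmx_lim; apply: cvgB; last exact: h_lim.
  apply: cvgZ; last exact: g_lim.
  by apply: cvgM; [exact: w0_lim|exact: cvg_cst].
have det_lim : \det (M s) @[s --> 0^'+] --> \det (K *m (a *: g x - 'D_v (hessian f c) x) - H).
  exact: (@continuous_cvg _ _ _ _ _ _ (fun A : 'M[R]_n => \det A) _
    (differentiable_continuous (differentiable_determinant _)) M_lim).
have dgx : \det (g x) != 0 by rewrite -unitfE -unitmxE; exact: metric_unit.
have detg_lim : \det (g (y s)) @[s --> 0^'+] --> \det (g x).
  exact: (line_lim (differentiable_det dg)).
apply: (cvg_trans _ (cvgM det_lim (cvgV dgx detg_lim))); apply: near_eq_cvg.
near=> s; have s0 : 0 < s by near: s; exact: nbhs_right_gt.
have ws : 0 < w s by near: s.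
have Os : Om (y s).
  near: s; have dI : differentiable (id : 'rV[R]_n -> 'rV[R]_n) x by [].
  have nO : nbhs x Om by exact: open_nbhs_nbhs.
  exact: (line_lim dI nO).
have gs0 : \det (g (y s)) != 0 by rewrite -unitfE -unitmxE; exact: metric_unit.
have Fs : F (y s) = t0 + beta / 4 * w s ^+ 2.
  rewrite /w sqr_sqrtr; last by rewrite leNgt; apply/negP => h; move: ws; rewrite /w ltr0_sqrtr // ltxx.
  by rewrite -/(y s); field.
have Fst : b (F (y s)) = 0 -> F (y s) = t0.
  near: s; have FL : F (x + s *: v) @[s --> 0^'+] --> t0.
    by rewrite -[X in _ --> X]Fx; exact: (line_lim (local_differentiable sf ac Ox)).
  exact: (FL _ (focal_value_isolated sb FJ Ox Fx bt0 beta0)).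
(* The points of the segment are regular: t0 is an isolated zero of b, and F (y s) differs from it
   by beta w^2 / 4. *)
have bF : b (F (y s)) != 0.
  apply/eqP => /Fst; rewrite Fs => /eqP; rewrite -subr_eq0 addrAC subrr add0r.
  apply/negP; rewrite mulf_neq0 //; first by rewrite mulf_neq0 // invr_neq0 // pnatr_eq0.
  by rewrite expf_neq0 // gt_eqF.
rewrite -Fs; have := PsiE (w s * a) Os bF => PsiEs.
have ME : M s = ((w s)^-1 *: K + Pi) *m ((w s * a) *: g (y s) - hessian f c (y s)).
  rewrite /M [RHS]mulmxDl; congr (_ + _).
  move: KH; move: (K) (hessian f c x) (hessian f c (y s)) (g (y s)) => K1 h0 h1 g1 KH.
  rewrite -!scalemxAr mulmxBr KH subr0 scalerA mulrAC mulfV ?gt_eqF // mul1r.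
  by rewrite -scalemxAl mulmxBr scalerBr -!scalemxAr scalerA mulKf ?gt_eqF.
rewrite /= ME det_mulmx PsiEs mulrA mulfK //.
Unshelve. all: by end_near. Qed.

End direction.

(** The expression whose limit [focal_det_limit] computes sees the direction only through w, so
    [matched_limits] applies to v and - v; reversing v changes the sign of the derivative of the
    Hessian. *)
Lemma focal_det_sym v a : v *m Pi = v -> inner c x v v = 1 ->
  \det (K *m (a *: g x - 'D_v (hessian f c) x) - H) =
  \det (K *m (a *: g x + 'D_v (hessian f c) x) - H).
Proof.
move=> vPi vv.
have vPi' : - v *m Pi = - v by rewrite mulNmx vPi.
have vv' : inner c x (- v) (- v) = 1.
  by rewrite -vv /inner mulNmx mulNmx linearN /= mulmxN opprK.
have DN : 'D_(- v) (hessian f c) x = - 'D_v (hessian f c) x.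
  have dH := hessian_differentiable sf ac Ox.
  by rewrite !deriveE // linearN.
have [d1 d10 [c1 z1 p1]] := focal_w_admissible vPi vv.
have [d2 d20 [c2 z2 p2]] := focal_w_admissible vPi' vv'.
have L2 := @focal_det_limit _ vPi' vv' a; rewrite DN opprK in L2.
have L1 := @focal_det_limit _ vPi vv a.
have gx0 : \det (g x) != 0 by rewrite -unitfE -unitmxE; exact: metric_unit.
apply: (mulIf (invr_neq0 gx0)).
have m0 : 0 < Num.min d1 d2 by rewrite lt_min d10.
apply: (@matched_limits R (fun s => Num.sqrt (4 / beta * (F (x + s *: v) - t0)))
  (fun s => Num.sqrt (4 / beta * (F (x + s *: - v) - t0)))
  (fun w => \det (w^-1 *: K + Pi) * Psi (t0 + beta / 4 * w ^+ 2) (w * a))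
  _ _ _ m0 _ L1 L2) => w [->|->]; split => //.
- apply: continuous_subspaceW c1 => t; rewrite /= !in_itv /= => /andP[-> h] /=.
  by rewrite (le_trans h) // ge_min lexx.
- by move=> s /andP[s0 h]; apply: p1; rewrite s0 (le_trans h) // ge_min lexx.
- apply: continuous_subspaceW c2 => t; rewrite /= !in_itv /= => /andP[-> h] /=.
  by rewrite (le_trans h) // ge_min lexx orbT.
- by move=> s /andP[s0 h]; apply: p2; rewrite s0 (le_trans h) // ge_min lexx orbT.
Qed.

End focal_limit.

(** * Shape operators of the focal variety *)

Lemma mx11_form_eq0 {F : fieldType} m n (A : 'M[F]_(m, n)) (v : 'cV[F]_n) :
  (forall i, (row i A *m v) 0 0 = 0) -> A *m v = 0.
Proof.
by move=> Av; apply/matrixP => i j; rewrite ord1 [RHS]mxE -(Av i) -row_mul [RHS]mxE.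
Qed.

Section focal_shape.
Context {R : realType} {n : nat} {N : riemannian R n}.
Variables (f : N -> R) (c : chart R N n).
Hypotheses (sf : smooth_fun f) (ac : atlas c).
Variables (b : R -> R) (J : set R).
Hypothesis sb : smooth_on J b.
Hypothesis FJ : forall x, chart_img c x -> J (local_expr f c x).
Hypothesis bE : forall x, chart_img c x -> grad_norm2 f c x = b (local_expr f c x).

Let Om : set 'rV[R]_n := chart_img c.
Let F : 'rV[R]_n -> R := local_expr f c.
Let g : 'rV[R]_n -> 'M[R]_n := metric c.
Let oOm : open Om := open_chart_img (c := c).
Hint Resolve oOm : core.

Variables (x : 'rV[R]_n) (t0 : R).
Hypotheses (Ox : Om x) (Fx : F x = t0) (bt0 : b t0 = 0).
Let beta := 'D_1 b t0.
Hypothesis beta0 : beta != 0.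

Let H : 'M[R]_n := d2local f c x.
Let Pi := normal_proj f c b x t0.
Let K := tangent_proj f c b x t0.

Let dF0 : dlocal f c x = 0. Proof. exact: (focal_crit ac bE bt0). Qed.
Let gu : g x \in unitmx. Proof. exact: metric_unit. Qed.
Let KK : K *m K = K.
Proof. exact: (tangent_proj_idem sf ac sb FJ bE Ox Fx bt0 beta0). Qed.
Let gK : g x *m K^T = K *m g x.
Proof. exact: (metric_tangent_proj_tr sf). Qed.
Let KP : K + Pi = 1%:M. Proof. exact: tangent_normal_proj. Qed.
Let PK : Pi *m K = 0.
Proof. exact: (normal_proj_tangent sf ac sb FJ bE Ox Fx bt0 beta0). Qed.
Variables (P : set N) (v : 'rV[R]_n).
Hypothesis PE : forall q, P q <-> f q = t0.
Hypothesis nv : unit_normal P c x v.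

Let tangentE u : tangent P c x u <-> (u <= K)%MS.
Proof. exact: (tangent_focal sf ac sb FJ bE Ox Fx bt0 beta0). Qed.

(** K is self-adjoint for the metric, so orthogonality of v to the range of K means v K = 0. *)
Lemma unit_normal_proj : v *m Pi = v.
Proof.
have [_ nv'] := nv.
have Kgv : K *m (g x *m v^T) = 0.
  apply: mx11_form_eq0 => i; rewrite mulmxA; apply: nv'.
  by apply/tangentE; exact: row_sub.
have vK : v *m K = 0.
  move: Kgv; rewrite mulmxA -gK -mulmxA -trmx_mul => /(congr1 (mulmx (invmx (g x)))).
  rewrite mulKmx // mulmx0 => /(congr1 trmx); rewrite trmxK trmx0 //.
by rewrite -[RHS]mulmx1 -KP mulmxDr vK add0r.
Qed.

Let S := 'D_v (hessian f c) x.

(** Against a normal vector the metric is a multiple of the Hessian: this trades the inner product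
    with v for d2f, which annihilates the tangent vectors all along P. *)
Let H_form (u w : 'rV[R]_n) : w *m Pi = w ->
  (u *m g x *m w^T) 0 0 = 2 / beta * (u *m H *m w^T) 0 0.
Proof.
move=> wPi; rewrite /H (d2local_proj f ac Ox beta0) -/Pi -/g.
rewrite -scalemxAr -scalemxAl [X in _ = _ * X]mxE mulrA.
have -> : 2 / beta * (2^-1 * beta) = 1 by field.
rewrite mul1r -(metric_normal_proj_tr sf ac b t0 Ox) -/Pi -/g.
by rewrite mulmxA -(mulmxA (u *m g x)) -trmx_mul wPi.
Qed.

(** df vanishes at x, so only its derivative contributes, not that of the Christoffel symbols. *)
Let derive_christoffel_mx (u w : 'rV[R]_n) :
  (u *m 'D_v (christoffel_mx f c) x *m w^T) 0 0 =
  (christoffel_form c x u w *m (v *m H)^T) 0 0.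
Proof.
rewrite christoffel_form_mul; congr ((_ *m _ *m _) 0 0).
have dchr k i j := smooth_on_differentiable (smooth_christoffel ac k i j) Ox.
have dd := dlocal_differentiable sf ac Ox; have /differentiable_rVP ddk := dd.
have dG : differentiable (christoffel_mx f c) x.
  apply/differentiable_mxP => i j.
  rewrite (_ : (fun _ => _) = \sum_k ((fun y => christoffel c y k i j) * (fun y => dlocal f c y 0 k : R))).
    by apply: differentiable_sum => k; exact: differentiableM.
  by apply/funext => y; rewrite mxE fct_sumE.
apply/matrixP => i j; rewrite derive_coord; last exact: diff_derivable.
rewrite (_ : (fun y => _) =
    fun y => \sum_k ((fun y => christoffel c y k i j) * (fun y => dlocal f c y 0 k : R)) y);
  last by apply/funext => y; rewrite mxE.
rewrite derive_sum_fun => [|k]; last exact/diff_derivable/differentiableM.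
rewrite mxE; apply: eq_bigr => k _.
rewrite deriveM; [|exact: diff_derivable|exact: diff_derivable].
rewrite -(derive_coord _ _ (@diff_derivable _ _ _ _ _ v dd)) (derive_dlocal sf ac v Ox).
by rewrite dF0 [(0 : 'rV_n) 0 k]mxE scale0r addr0.
Qed.

(* Differentiate Y . d2f = 0, valid along P, in the direction X. *)
Lemma focal_covd W (X Y : 'rV[R]_n -> 'rV[R]_n) : open W -> W x -> W `<=` chart_img c ->
  tangent_field P c W X -> tangent_field P c W Y ->
  inner c x (covd c X Y x) v = - (2 / beta) * (X x *m S *m (Y x)^T) 0 0.
Proof.
move=> oW Wx WO [_ tX] [sY tY].
have Px : P (chart_inv c x) by apply/PE.
have dY := smooth_on_differentiable sY Wx.
have dH2 := d2local_differentiable sf ac Ox.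
have vPi := unit_normal_proj.
(* The relation holds on P only, hence it is differentiated along a curve of P with velocity X x. *)
have DY : 'D_(X x) Y x *m H = - (Y x *m 'D_(X x) (d2local f c) x).
  have [e [s [e0 ss sP sx su]]] := tX x Wx Px.
  have b0 : ball (0 : R) e 0 by exact: ballxx.
  have d1 : differentiable s 0 by exact: smooth_on_differentiable ss b0.
  have d2 : differentiable (fun z => Y z *m d2local f c z) (s 0).
    by rewrite sx; exact: differentiable_mulmx.
  have : 'D_1 ((fun z => Y z *m d2local f c z) \o s) 0 = 0.
    apply: (derive_near_cst (a := 0)); near=> t.
    have [Ot Pt] : chart_img c (s t) /\ P (chart_inv c (s t)).
      by apply: sP; near: t; exact: nbhsx_ballx.
    have Wt : W (s t).
      near: t; apply: (differentiable_continuous d1); rewrite /= sx.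
      exact: open_nbhs_nbhs.
    apply: (tangent_d2local sf ac bE bt0 (P := P)); first by move=> q /PE.
    exact: tY.
  rewrite (@derive_comp _ _ _ _ s (fun z => Y z *m d2local f c z) 0 1 d1 d2) su sx.
  rewrite derive_mulmx // => /eqP; rewrite addr_eq0 => /eqP -> //.
have SE : (X x *m S *m (Y x)^T) 0 0 = (X x *m 'D_v (d2local f c) x *m (Y x)^T) 0 0 -
    (christoffel_form c x (X x) (Y x) *m (v *m H)^T) 0 0.
  rewrite -derive_christoffel_mx /S.
  have dG : differentiable (christoffel_mx f c) x.
    have -> : christoffel_mx f c = d2local f c - hessian f c.
      by apply/funext => y; rewrite /hessian !fctE opprB addrC subrK.
    by apply: differentiableB => //; exact: hessian_differentiable.
  rewrite -['D_v (hessian f c) x]/('D_v (d2local f c - christoffel_mx f c) x).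
  rewrite deriveB; [|exact: diff_derivable|exact: diff_derivable].
  by rewrite mulmxBr mulmxBl mxE [X in _ + X]mxE.
rewrite /inner H_form // /covd mulmxDl mulmxDl mxE DY mulNmx [X in X + _]mxE.
rewrite SE (derive_d2local_form sf ac (X x) (Y x) v Ox).
have -> : (v *m H)^T = H *m v^T by rewrite trmx_mul (d2local_sym sf ac Ox).
rewrite mulmxA mulNr -mulrN opprB addrC //.
Unshelve. all: by end_near. Qed.

Variables (k : nat) (B : 'M[R]_(k, n)) (A : 'M[R]_(n, k)).
Hypotheses (AB : A *m B = K) (BA : B *m A = 1%:M).

Let fB : row_free B. Proof. by apply/row_freeP; exists A. Qed.

Let BK (u : 'rV[R]_n) : (u <= K)%MS = (u <= B)%MS.
Proof.
have /eqmxP e : (B == K)%MS; last by rewrite e.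
apply/andP; split; apply/submxP; last by exists A.
by exists B; rewrite -AB mulmxA BA mul1mx.
Qed.

(** Matrix, in the basis B of the tangent space, of the tangential part of (D_v Hess f) g^-1; the
    shape operator T_v is - 2 / beta times it. *)
Let M := B *m S *m invmx (g x) *m A.
Let T := - (2 / beta) *: M.

Let TE : T *m B *m g x *m B^T = - (2 / beta) *: (B *m S *m B^T).
Proof. by apply/(shape_formP S T (- (2 / beta)) gu gK AB BA). Qed.

Lemma focal_shape_operator : shape_operator P c x v B T.
Proof.
split=> //; first by move=> u; rewrite tangentE BK.
move=> W X Y p q oW Wx WO tX tY Xx Yx.
rewrite (focal_covd oW Wx WO tX tY) Xx Yx /inner.
have -> : p *m T *m B *m metric c x *m (q *m B)^T = p *m (T *m B *m g x *m B^T) *m q^T.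
  by rewrite trmx_mul !mulmxA.
by rewrite TE -scalemxAr -scalemxAl mxE trmx_mul !mulmxA.
Qed.

(** The derivative of the Hessian is symmetric, so T is self-adjoint for the Gram matrix B g B^T of
    the tangent space. *)
Lemma focal_shape_split : exists s : seq R, char_poly T = \prod_(r <- s) ('X - r%:P).
Proof.
have gt := metric_tr ac Ox.
have S_tr : S^T = S.
  rewrite /S -derive_trmx; last exact: hessian_differentiable.
  apply: near_eq_derive; near=> y; apply: (hessian_tr sf ac).
  by near: y; exact: open_nbhs_nbhs.
apply: (@self_adjoint_split _ _ (B *m g x *m B^T)).
- move=> u u0.
  have -> : u *m (B *m g x *m B^T) *m u^T = (u *m B) *m g x *m (u *m B)^T.
    by rewrite trmx_mul !mulmxA.
  apply: (metric_posdef ac Ox); apply: contra_neq u0 => uB.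
  by apply: (row_free_inj fB); rewrite uB mul0mx.
- rewrite !mulmxA TE linearZ /= !trmx_mul trmxK S_tr mulmxA //.
- by rewrite !trmx_mul trmxK gt mulmxA.
Unshelve. all: by end_near. Qed.

Variable Psi : R -> R -> R.
Hypothesis PsiE : forall y a, Om y -> b (F y) != 0 ->
  \det (a *: g y - hessian f c y) = Psi (F y) a * \det (g y).

(** Both determinants of [focal_det_sym] split into a normal and a tangential block; the normal
    factor and det g are common to v and - v, and non-zero. *)
Let det_M_sym a : \det (a%:M - M) = \det (a%:M + M).
Proof.
have [vv _] := nv.
pose e := 2^-1 * beta.
have e0 : e != 0 by rewrite mulf_neq0 // invr_neq0 // pnatr_eq0.
have HE : H = e *: (Pi *m g x) := d2local_proj f ac Ox beta0.
have unitK := det_split_neq0 KP PK e0.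
have dg0 : \det (g x) != 0 by rewrite -unitfE -unitmxE.
have E Y : \det (K *m (a *: g x - Y) - H) =
    \det (K - e *: Pi) * \det (a%:M - B *m (Y *m invmx (g x)) *m A) * \det (g x).
  rewrite -(det_split_idempotent (Y *m invmx (g x)) a e KP PK AB BA) -det_mulmx; congr (\det _).
  have E2 : K *m (a%:M - Y *m invmx (g x)) *m g x = K *m (a *: g x - Y).
    by rewrite -mulmxA; congr (_ *m _); rewrite mulmxBl mul_scalar_mx mulmxKV.
  by rewrite [RHS]mulmxBl E2 -scalemxAl -HE.
have := focal_det_sym sf ac sb FJ bE PsiE Ox Fx bt0 beta0 a unit_normal_proj vv.
rewrite -/K -/H -/g -/S => Sym.
have E2 := E (- S); rewrite opprK -Sym E in E2.
move: E2 => /(mulIf dg0)/(mulfI unitK).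
by rewrite mulNmx mulmxN mulNmx opprK mulmxA.
Qed.

Lemma focal_shape_opp : char_poly (- T) = char_poly T.
Proof.
apply: horner_inj => l; rewrite !char_poly_horner /T.
have k0 : - (2 / beta) != 0 by rewrite oppr_eq0 mulf_neq0 // ?invr_neq0 // pnatr_eq0.
set e := - (2 / beta).
have -> : l%:M - - (e *: M) = e *: ((l / e)%:M + M).
  by rewrite opprK scalerDr scale_scalar_mx mulrC divfK.
have -> : l%:M - e *: M = e *: ((l / e)%:M - M).
  by rewrite scalerBr scale_scalar_mx mulrC divfK.
by rewrite !detZ det_M_sym.
Qed.

End focal_shape.

(** * Slice charts of the focal variety *)

(** By Gaussian elimination z A = 0 means that the first [\rank A] coordinates of z, after an
    invertible change, vanish. Slice charts ask for the last coordinates to vanish, whence the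
    reversal of the columns by [rev_ord]. *)
Lemma kernel_coordinates {F : fieldType} n (A : 'M[F]_n) :
  exists2 L : 'M[F]_n, L \in unitmx & forall z : 'rV[F]_n,
    z *m A = 0 <-> forall i : 'I_n, (n - \rank A <= i)%N -> (z *m L) 0 i = 0.
Proof.
pose s : 'S_n := perm (@rev_ord_inj n).
exists (col_perm s (col_ebase A)).
  by rewrite col_permE unitmx_mul col_ebase_unit unitmx_perm.
move=> z; have zL i : (z *m col_perm s (col_ebase A)) 0 i = (z *m col_ebase A) 0 (rev_ord i).
  by rewrite !mxE; apply: eq_bigr => k _; rewrite mxE permE.
have zA : z *m A = 0 <-> z *m col_ebase A *m pid_mx (\rank A) = 0 :> 'rV_n.
  rewrite -{1}(mulmx_ebase A) !mulmxA; split=> [E|->]; last by rewrite mul0mx.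
  by rewrite -[LHS](mulmxK (row_ebase_unit A)) E mul0mx.
have pidE (w : 'rV[F]_n) (j : 'I_n) : (w *m pid_mx (\rank A) : 'rV_n) 0 j =
    w 0 j * (j < \rank A)%:R.
  rewrite mxE (bigD1 j) //= mxE eqxx /= big1 ?addr0 // => i ij.
  by rewrite mxE (negbTE ij : (i == j :> nat) = false) mulr0.
rewrite zA; split=> [E i ni|E].
  rewrite zL; have := congr1 (fun w : 'rV_n => w 0 (rev_ord i)) E.
  rewrite pidE [RHS]mxE /= (_ : (n - i.+1 < \rank A)%N) ?mulr1 //.
  have := ltn_ord i; have := rank_leq_row A; lia.
apply/rowP => j; rewrite pidE [RHS]mxE; case: ltnP => jr; rewrite ?mulr0 // mulr1.
rewrite -(rev_ordK j) -zL E //= ; have := ltn_ord j; lia.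
Qed.

Section chart_topology.
Context {R : realType} {n : nat} {T : topologicalType}.

Lemma chart_image_open (c : chart R T n) (O : set T) :
  open O -> O `<=` chart_dom c -> open (c @` O).
Proof.
move=> oO Od; rewrite openE => _ [q Oq <-].
have dq := Od q Oq.
have Iq : (c @` chart_dom c) (c q) by exists q.
have nI : nbhs (c q) (c @` chart_dom c).
  by apply: open_nbhs_nbhs; split => //; exact: chart_img_open.
have nO : \forall y \near c q, O (chart_inv c y).
  apply: (chart_inv_continuous Iq); rewrite /= chart_mapK //.
  exact: open_nbhs_nbhs.
near=> y; have [q' dq' yE] : (c @` chart_dom c) y by near: y.
exists q' => //; rewrite -(chart_mapK dq') yE; near: y; exact: nO.
Unshelve. all: by end_near. Qed.

End chart_topology.

Section straightened_chart.
Context {R : realType} {n : nat} {N : riemannian R n}.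
Variables (c : chart R N n) (U V : set 'rV[R]_n) (Phi G : 'rV[R]_n -> 'rV[R]_n).
Variable L : 'M[R]_n.
Hypotheses (ac : atlas c) (oU : open U) (oV : open V) (UO : U `<=` chart_img c).
Hypotheses (sPhi : smooth_on U Phi) (sG : smooth_on V G).
Hypothesis GP : forall y, U y -> V (Phi y) /\ G (Phi y) = y.
Hypothesis PG : forall z, V z -> U (G z) /\ Phi (G z) = z.
Hypothesis uL : L \in unitmx.

Let dom : set N := chart_dom c `&` [set q | U (c q)].
Let map q : 'rV[R]_n := Phi (c q) *m L.
Let inv (z : 'rV[R]_n) : N := chart_inv c (G (z *m invmx L)).

Let img : map @` dom = [set z | V (z *m invmx L)].
Proof.
apply/seteqP; split=> [_ [q [dq Uq] <-]|z /= Vz].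
  by rewrite /map /= mulmxK //; case: (GP Uq).
have [UG PGz] := PG Vz; have [q dq qE] := UO UG.
exists q; first by split => //=; rewrite qE.
by rewrite /map qE PGz mulmxKV.
Qed.

Let open_dom : open dom.
Proof.
rewrite openE => q [dq Uq]; apply: filterI.
  by apply: open_nbhs_nbhs; split => //; exact: chart_dom_open.
by apply: (chart_map_continuous dq); exact: open_nbhs_nbhs.
Qed.

Let open_img : open (map @` dom).
Proof.
rewrite img; apply: (open_comp (f := mulmxr (invmx L)) (D := V)) => // z _.
exact: continuous_mulmxr.
Qed.

Let mapK q : dom q -> inv (map q) = q.
Proof.
move=> [dq Uq]; rewrite /inv /map mulmxK //; have [_ ->] := GP Uq.
exact: chart_mapK.
Qed.

Let map_continuous q : dom q -> {for q, continuous map}.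
Proof.
move=> [dq Uq].
have c1 := chart_map_continuous dq.
have c2 := differentiable_continuous (smooth_on_differentiable sPhi Uq).
have c3 := @continuous_mulmxr R 1 n n L (Phi (c q)).
exact: (continuous_comp (continuous_comp c1 c2) c3).
Qed.

Let inv_continuous z : (map @` dom) z -> {for z, continuous inv}.
Proof.
rewrite img /= => Vz; have [UG _] := PG Vz.
have c1 := @continuous_mulmxr R 1 n n (invmx L) z.
have c2 := differentiable_continuous (smooth_on_differentiable sG Vz).
have c3 := chart_inv_continuous (UO UG).
exact: (continuous_comp (continuous_comp c1 c2) c3).
Qed.

Definition straightened_chart : chart R N n :=
  Chart open_dom open_img mapK map_continuous inv_continuous.

Lemma straightened_chart_img : chart_img straightened_chart = [set z | V (z *m invmx L)].
Proof. exact: img. Qed.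

(** By maximality of the atlas only compatibility is at stake: the transitions to a chart e are
    those of c composed with Phi or G and a linear map. *)
Lemma straightened_chart_atlas : atlas straightened_chart.
Proof.
apply: atlas_maximal => e ae; have [sce sec] := atlas_compatible ac ae.
set d := straightened_chart.
have od : open (d @` (chart_dom d `&` chart_dom e)).
  apply: chart_image_open; last by move=> q [].
  by apply: openI; exact: chart_dom_open.
have oe : open (e @` (chart_dom d `&` chart_dom e)).
  apply: chart_image_open; last by move=> q [].
  by apply: openI; exact: chart_dom_open.
have oc : open (c @` (chart_dom c `&` chart_dom e)).
  apply: chart_image_open; last by move=> q [].
  by apply: openI; exact: chart_dom_open.
split.
  apply: (smooth_on_comp_mx od oc (G := fun z => G (z *m invmx L)) _ _ sce).
    apply: (smooth_on_comp_mx od oV (G := mulmxr (invmx L)) _ _ sG).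
      exact: smooth_on_mulmxr.
    by move=> _ [q [[dq Uq] _] <-] /=; rewrite mulmxK //; case: (GP Uq).
  move=> _ [q [[dq Uq] eq] <-] /=; rewrite /map mulmxK //; have [_ ->] := GP Uq.
  by exists q.
apply: (smooth_on_comp_mx oe oU (G := transition e c) (f := fun w => Phi w *m L)).
- by apply: smooth_on_sub sec => _ [q [[dq Uq] eq] <-]; exists q.
- by move=> _ [q [[dq Uq] eq] <-]; rewrite /transition chart_mapK.
- by apply: smooth_on_mulmx => //; exact: smooth_on_cst.
Qed.

End straightened_chart.

Section focal_submanifold.
Context {R : realType} {n : nat} {N : riemannian R n}.
Variables (f : N -> R).
Hypotheses (sf : smooth_fun f).
Variables (b : R -> R) (J : set R).
Hypotheses (sb : smooth_on J b) (FJ : forall q, J (f q)).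
Hypothesis bE : forall c q, atlas c -> chart_dom c q -> grad_norm2 f c (c q) = b (f q).
Variables (t0 : R) (P : set N).
Hypotheses (PE : forall q, P q <-> f q = t0) (bt0 : b t0 = 0).
Let beta := 'D_1 b t0.
Hypothesis beta0 : beta != 0.

Lemma local_range c : forall x, chart_img c x -> J (local_expr f c x).
Proof. by move=> x _; exact: FJ. Qed.

Lemma local_transnormal c : atlas c ->
  forall x, chart_img c x -> grad_norm2 f c x = b (local_expr f c x).
Proof.
by move=> ac _ [q dq <-]; rewrite /local_expr chart_mapK // bE.
Qed.

(** At a critical point the Laplacian is the trace of the Hessian endomorphism, beta / 2 times a
    projection, so it counts the codimension of P. A Laplacian that depends on f only thus gives all
    components of P the same dimension, as [submanifold] demands. *)
Lemma focal_laplacian c p : P p -> atlas c -> chart_dom c p ->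
  laplacian f c (c p) = 2^-1 * beta * (\rank (normal_proj f c b (c p) t0))%:R.
Proof.
move=> Pp ac dp; set x := c p.
have Ox : chart_img c x by exists p.
have Fx : local_expr f c x = t0 by rewrite /local_expr chart_mapK //; apply/PE.
have FJc := @local_range c; have bEc := local_transnormal ac.
have dF0 := focal_crit ac bEc bt0 Ox Fx.
rewrite -(mxtrace_normal_proj sf ac sb FJc bEc Ox Fx bt0 beta0).
have y0 : grad f c x = 0 by apply/(grad_eq0 f ac Ox).
have HE := d2local_proj f ac Ox beta0.
rewrite /laplacian /mxtrace big_distrr; apply: eq_bigr => i _ /=.
rewrite /covd (derive_grad_crit sf ac Ox dF0) y0 HE.
rewrite -scalemxAr -scalemxAl -mulmxA mulmxK ?metric_unit //.
rewrite mxE [X in _ + X]mxE [X in _ + X]big1 => [|j _]; last first.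
  by rewrite big1 // => k _; rewrite [(0 : 'rV_n) 0 k]mxE mulr0.
by rewrite addr0 mxE -rowE mxE.
Qed.

Variable l : R.
Hypothesis lapE : forall c q, P q -> atlas c -> chart_dom c q -> laplacian f c (c q) = l.

Lemma focal_submanifold : exists k, submanifold k P.
Proof.
have [P0|/set0P[p0 Pp0]] := eqVneq P set0.
  by exists 0%N; split => // p; rewrite P0.
have rankE c p : P p -> atlas c -> chart_dom c p ->
    (\rank (normal_proj f c b (c p) t0))%:R = 2 / beta * l.
  move=> Pp ac dp; rewrite -(lapE Pp ac dp) (focal_laplacian Pp ac dp); field.
  exact: beta0.
have [c0 ac0 dc0] := atlas_cover p0.
exists (n - \rank (normal_proj f c0 b (c0 p0) t0))%N; split; first exact: leq_subr.
move=> p Pp; have [c ac dp] := atlas_cover p.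
have -> : \rank (normal_proj f c0 b (c0 p0) t0) = \rank (normal_proj f c b (c p) t0).
  by apply/eqP; rewrite -(eqr_nat R) (rankE c0 p0) // (rankE c p).
set x := c p.
have Ox : chart_img c x by exists p.
have Fx : local_expr f c x = t0 by rewrite /local_expr chart_mapK //; apply/PE.
have FJc := @local_range c; have bEc := local_transnormal ac.
have [U [V [Phi [G [[oU Ux UO oV] [sPhi sG] [GP PG] [Phix DG] UE]]]]] :=
  focal_straightening sf ac sb FJc bEc Ox Fx bt0 beta0.
have [L uL LE] := kernel_coordinates (normal_proj f c b x t0).
exists (straightened_chart oU oV UO sPhi sG GP PG uL); split.
- exact: straightened_chart_atlas.
- by split.
- move=> z; rewrite straightened_chart_img /= => Vz; have [UG PGz] := PG _ Vz.
  rewrite PE -[f _]/(local_expr f c (G (z *m invmx L))) (UE _ UG) PGz LE.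
  by rewrite mulmxKV.
Qed.

End focal_submanifold.

(** * Focal varieties of isoparametric functions *)

Section focal_values.
Context {R : realType} {n : nat} {N : riemannian R n}.
Variable f : N -> R.
Hypothesis sf : smooth_fun f.

Lemma extremum_dlocal (p : N) (c : chart R N n) : focal_max f p \/ focal_min f p ->
  atlas c -> chart_dom c p -> dlocal f c (c p) = 0.
Proof.
move=> ext ac dp; set x := c p; have Ox : chart_img c x by exists p.
have oO := open_chart_img (c := c).
apply/rowP => i; rewrite [RHS]mxE mxE; set u := frame i.
have [e e0 [_ Ve _]] := smooth_line u oO Ox (smooth_on_id oO).
have Fx : local_expr f c (x + 0 *: u) = f p.
  by rewrite scale0r addr0 /local_expr chart_mapK.
have ine (t : R) : t \in `](- e), e[%R -> ball (0 : R) e t.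
  by rewrite in_itv /= -ball_normE /= sub0r normrN ltr_norml.
have dline (t : R) : t \in `](- e), e[%R ->
    is_derive t 1 (fun t => local_expr f c (x + t *: u)) ('D_u (local_expr f c) (x + t *: u)).
  by move=> /ine te; apply/is_derive_line/local_differentiable => //; exact: Ve.
have z0 : (0 : R) \in `](- e), e[%R by rewrite in_itv /= oppr_lt0 e0.
have D0 := dline 0 z0; rewrite scale0r addr0 in D0.
rewrite -[LHS](@derive_val _ _ _ _ _ _ _ D0).
have lee : - e <= e by rewrite ge0_cp // ltW.
have dd (t : R) : t \in `](- e), e[%R -> derivable (fun t : R => local_expr f c (x + t *: u)) t 1.
  by move=> /dline[].
suff h : is_derive (0 : R) 1 (fun t : R => local_expr f c (x + t *: u)) 0.
  exact: (@derive_val _ _ _ _ _ _ _ h).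
case: ext => ext.
  by apply: (derive1_at_max lee) => // t _; rewrite Fx; exact: ext.
by apply: (derive1_at_min lee) => // t _; rewrite Fx; exact: ext.
Qed.

Section connected_manifold.
Variables (b : R -> R) (J : set R).
Hypotheses (oJ : open J) (sb : smooth_on J b) (FJ : forall q, J (f q)).
Hypothesis bE : forall c q, atlas c -> chart_dom c q -> grad_norm2 f c (c q) = b (f q).

Lemma focal_derive_neq0 (t0 : R) p q : connected [set: N] -> b t0 = 0 ->
  f p = t0 -> f q <> t0 -> 'D_1 b t0 != 0.
Proof.
move=> conN bt0 fp fq; apply/eqP => b'0; apply: fq.
have near_local r (c : chart R N n) : atlas c -> chart_dom c r ->
    forall A : set R, (\forall y \near c r, A (local_expr f c y)) -> nbhs r [set s | A (f s)].
  move=> ac dr A HA; have cc := chart_map_continuous dr.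
  have nd : nbhs r (chart_dom c).
    by apply: open_nbhs_nbhs; split => //; exact: chart_dom_open.
  apply: filterS2 nd (cc _ HA) => s ds; rewrite /local_expr /= chart_mapK //.
have Oc r (c : chart R N n) : chart_dom c r -> chart_img c (c r) by move=> dr; exists r.
have oP : open [set r | f r = t0].
  rewrite openE => r fr; have [c ac dr] := atlas_cover r.
  have Fr : local_expr f c (c r) = t0 by rewrite /local_expr chart_mapK.
  apply: (near_local r c ac dr [set t | t = t0]).
  have := flat_critical_value sf ac oJ sb (local_range FJ (c := c))
    (local_transnormal bE ac) (Oc r c dr).
  by rewrite Fr => /(_ bt0 b'0).
have cP : closed [set r | f r = t0].
  rewrite -[X in closed X]setCK; apply: open_closedC; rewrite openE => r fr.
  have [c ac dr] := atlas_cover r.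
  apply: (near_local r c ac dr [set t | t <> t0]).
  have dF := local_differentiable sf ac (Oc r c dr).
  have Fr : local_expr f c (c r) != t0 by apply/eqP; rewrite /local_expr chart_mapK.
  have cF := differentiable_continuous dF.
  have nt : nbhs (local_expr f c (c r)) [set t | t != t0].
    by apply: open_nbhs_nbhs; split => //; exact: open_neq.
  have ny : \forall y \near c r, local_expr f c y != t0 by exact: (cF _ nt).
  by apply: filterS ny => y /eqP.
have E : [set r | f r = t0] = [set: N].
  apply: conN; first by exists p.
    by exists [set r | f r = t0] => //; rewrite setTI.
  by exists [set r | f r = t0] => //; rewrite setTI.
by have : [set r | f r = t0] q by rewrite E.
Qed.

End connected_manifold.
End focal_values.

(** Comparison of the coefficients next to the leading one; the empty matrix is set apart because
    its characteristic polynomial has no such coefficient. *)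
Lemma opp_char_poly_trace {R : realType} k (T : 'M[R]_k) :
  char_poly (- T) = char_poly T -> \tr T = 0.
Proof.
case: k T => [|k] T; first by rewrite /mxtrace big_ord0.
move=> E; have := char_poly_trace T (ltn0Sn k); have := char_poly_trace (- T) (ltn0Sn k).
rewrite E => ->; rewrite linearN /= opprK => /eqP; rewrite -addr_eq0 -mulr2n mulrn_eq0 /=.
by move/eqP.
Qed.

Section focal_austerity.
Context {R : realType} {n : nat} {N : riemannian R n}.
Variable f : N -> R.
Hypotheses (sf : smooth_fun f).
Variables (b : R -> R) (J : set R).
Hypotheses (sb : smooth_on J b) (FJ : forall q, J (f q)).
Hypothesis bE : forall c q, atlas c -> chart_dom c q -> grad_norm2 f c (c q) = b (f q).
Hypothesis cpc : constant_principal_curvatures f.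
Variables (t0 : R) (P : set N).
Hypotheses (PE : forall q, P q <-> f q = t0) (bt0 : b t0 = 0).
Hypothesis beta0 : 'D_1 b t0 != 0.

Lemma level_hessian_constant : exists Psi : R -> R -> R,
  forall c y a, atlas c -> chart_img c y -> b (local_expr f c y) != 0 ->
    \det (a *: metric c y - hessian f c y) = Psi (local_expr f c y) a * \det (metric c y).
Proof.
have [kappa kappaE] := cpc.
(* The right-hand side of [level_hessian_det] without det g, with the list [kappa t] common to all
   points of the level. *)
exists (fun t a => (a - 2^-1 * 'D_1 b t) *
    ((- Num.sqrt (b t)) ^+ size (kappa t) *
     (\prod_(r <- kappa t) ('X - r%:P)).[- (a / Num.sqrt (b t))])).
move=> c y a ac Oy bF.
have bEc := local_transnormal bE.
have d0 c' z : atlas c' -> chart_img c' z -> b (local_expr f c' z) != 0 ->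
    dlocal f c' z != 0.
  move=> ac' Oz; apply: contra_neq => dz.
  exact: (grad_norm2_crit ac' (bEc c' ac') Oz dz).
apply: (level_hessian_det sf ac Oy (d0 c y ac Oy bF) sb _ (bEc c ac)).
  by move=> z _; exact: FJ.
have [q dq qE] := Oy; subst y.
have Fq : local_expr f c (c q) = f q by rewrite /local_expr chart_mapK.
rewrite Fq in bF *; apply: kappaE => //.
(* The value is regular because |grad f|^2 = b is a non-zero constant on the whole level, in every
   chart. *)
move=> p c' fp ac' dp; apply: contrapT => /forallNP D0.
have Op : chart_img c' (c' p) by exists p.
have : dlocal f c' (c' p) != 0.
  by apply: d0 => //; rewrite /local_expr chart_mapK // fp.
move=> /eqP; apply; apply/rowP => i; rewrite !mxE.
by apply/eqP/negPn/negP; exact: D0.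
Qed.

Lemma focal_shape p (c : chart R N n) v : P p -> atlas c -> chart_dom c p ->
  unit_normal P c (c p) v ->
  exists k (B : 'M[R]_(k, n)) (T : 'M[R]_k) (s : seq R),
    [/\ shape_operator P c (c p) v B T, char_poly T = \prod_(r <- s) ('X - r%:P) &
        char_poly (- T) = char_poly T].
Proof.
move=> Pp ac dp nv; set x := c p.
have Ox : chart_img c x by exists p.
have Fx : local_expr f c x = t0 by rewrite /local_expr chart_mapK //; apply/PE.
have FJc := local_range FJ (c := c); have bEc := local_transnormal bE ac.
have [Psi PsiE] := level_hessian_constant.
set K := tangent_proj f c b x t0.
have KK : K *m K = K := tangent_proj_idem sf ac sb FJc bEc Ox Fx bt0 beta0.
have AB : col_base K *m row_base K = K by exact: mulmx_base.
have BA := idempotent_base KK.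
have [s sE] := focal_shape_split sf ac Ox v AB BA.
exists _, (row_base K), (- (2 / 'D_1 b t0) *: (row_base K *m 'D_v (hessian f c) x *m
    invmx (metric c x) *m col_base K)), s; split => //.
  exact: (focal_shape_operator sf ac sb FJc bEc Ox Fx bt0 beta0 PE nv AB BA).
exact: (focal_shape_opp sf ac sb FJc bEc Ox Fx bt0 beta0 PE nv AB BA
  (fun y a => @PsiE c y a ac)).
Qed.

End focal_austerity.

Theorem mainTheorem3 (R : realType) (n : nat) (N : riemannian R n)
    (f : N -> R) :
  connected [set: N] ->
  complete N ->
  isoparametric f ->
  constant_principal_curvatures f ->
  forall P : set N, P = focal_max f \/ P = focal_min f -> P !=set0 ->
    [/\ forall (p : N) (c : chart R N n) (v : 'rV[R]_n),
          P p -> atlas c -> chart_dom c p -> unit_normal P c (c p) v ->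
          exists (kappa : seq R) (m : nat),
            principal_curvatures P c (c p) v
              (kappa ++ [seq - r | r <- kappa] ++ nseq m 0),
        austere P
      & minimal P].
Proof.
move=> conN _ [[sf [p1 [p2 f12]] [b [J [oJ FJ sb bE]]]] [a _ aE]] cpc P PM [p0 Pp0].
have {}FJ q : J (f q) by apply: FJ; exists q.
pose t0 := f p0.
(* A focal variety is a full level set, which allows the maximum and the minimum to be treated
   alike. *)
have PE q : P q <-> f q = t0.
  case: PM Pp0 => -> H0; split=> [Hq|fq].
  - by apply/eqP; rewrite eq_le H0 Hq.
  - by move=> r; rewrite fq; exact: H0.
  - by apply/eqP; rewrite eq_le H0 Hq.
  - by move=> r; rewrite fq; exact: H0.
have bt0 : b t0 = 0.
  have [c ac dp] := atlas_cover p0; rewrite -(bE c p0 ac dp).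
  have ext : focal_max f p0 \/ focal_min f p0 by case: PM Pp0 => ->; [left|right].
  have Ox : chart_img c (c p0) by exists p0.
  have /(grad_eq0 f ac Ox) y0 := extremum_dlocal sf ext ac dp.
  by rewrite /grad_norm2 y0 /inner !mul0mx mxE.
have beta0 : 'D_1 b t0 != 0.
  have [q fq] : exists q, f q <> t0.
    have [f1|f1] := eqVneq (f p1) t0; last by exists p1; apply/eqP.
    by exists p2 => f2; apply: f12; rewrite f1.
  exact: (focal_derive_neq0 sf oJ sb FJ bE conN bt0 (erefl : f p0 = t0) fq).
have subP : exists k, submanifold k P.
  apply: (focal_submanifold sf sb FJ bE PE bt0 beta0 (l := a t0)) => c q /PE fq ac dq.
  by rewrite aE // fq.
have shape := focal_shape sf sb FJ bE cpc PE bt0 beta0.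
split.
- move=> p c v Pp ac dp nv; have [k [B [T [s [TE Ts TN]]]]] := shape p c v Pp ac dp nv.
  have [kappa [m sE]] := opp_perm_split (opp_roots_perm Ts TN).
  exists kappa, m, k, B, T; split => //.
  by rewrite Ts; exact: perm_big.
- split => // p c v Pp ac dp nv; have [k [B [T [s [TE Ts TN]]]]] := shape p c v Pp ac dp nv.
  by exists s; [exists k, B, T|exact: opp_roots_perm Ts TN].
- split => // p c v Pp ac dp nv; have [k [B [T [s [TE Ts TN]]]]] := shape p c v Pp ac dp nv.
  by exists k, B, T; split => //; exact: opp_char_poly_trace.
Qed.
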